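(* Let $\theta,\zeta>0$ and let $(\pi_n)$ be a random coherent sequence of permutations with distribution $P^{(\theta,\zeta)}$. As $n\to\infty$, the scaled record values of $\pi_n$ converge: $$\frac{r_k}{n}\to\rho_k\quad\text{almost surely}\qquad(k\in\mathbb Z),$$ where $(r_k)$ is the two-sided sequence of record values of $\pi_n$. The distribution of $\rho_0$ is $\mathrm{beta}(\theta,\zeta)$. Given $\rho_0$, the sequences $(\rho_k,\,k<0)$ and $(\rho_k,\,k>0)$ are independent and representable as $$\rho_k=\rho_0T_kT_{k+1}\cdots T_{-1}\quad(k<0),\qquad \rho_k=1-(1-\rho_0)Z_1Z_2\cdots Z_k\quad(k>0),$$ where the $T_k$'s are $\mathrm{beta}(\theta,1)$, the $Z_k$'s are $\mathrm{beta}(\zeta,1)$, and the variables $\rho_0$, $T_k$ $(k<0)$ and $Z_k$ $(k>0)$ are all independent.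
   Context: Permutations of $[n]=\{1,\dots,n\}$ are written $\pi_n=(\pi_{n1},\dots,\pi_{nn})$. The entry $\pi_{nj}$ is a lower record if $\pi_{nj}=\min(\pi_{n1},\dots,\pi_{nj})$, an upper record if $\pi_{nj}=\max(\pi_{n1},\dots,\pi_{nj})$; records with $j\ge2$ are called proper. If $\pi_n$ has $\ell$ proper lower and $u$ proper upper records, its record values are arranged in increasing order as $r_{-\ell}<\dots<r_{-1}<r_0<r_1<\dots<r_u$, where $r_0=\pi_{n1}$, $r_{-\ell},\dots,r_{-1}$ are the proper lower record values and $r_1,\dots,r_u$ the proper upper record values (all depend on $n$). The sequence is padded by $r_k=1$ for $k<-\ell$ and $r_k=n$ for $k>u$. A sequence $(\pi_n)_{n\ge1}$, $\pi_n\in\mathfrak S_n$, is coherent if for all $m\le n$ the ranking permutation of $(\pi_{n1},\dots,\pi_{nm})$ (each entry replaced by its rank in increasing order) is $\pi_m$. $P^{(\theta,\zeta)}$ is the distribution of a random coherent sequence $(\pi_n)$ such that for every $n$ each $\pi_n\in\mathfrak S_n$ has probability $\theta^{\ell}\zeta^{u}/(\theta+\zeta)_{n-1}$, with $(x)_m=x(x+1)\cdots(x+m-1)$; these laws are compatible for different $n$ and determine $P^{(\theta,\zeta)}$ uniquely. $\mathrm{beta}(a,b)$, $a,b>0$, is the distribution on $[0,1]$ with density $x^{a-1}(1-x)^{b-1}\Gamma(a+b)/(\Gamma(a)\Gamma(b))$. *)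

(* Defs.v *)
(* MathComp / MathComp-Analysis *)
From HB Require Import structures.
From mathcomp Require Export all_boot all_order all_algebra perm.
From mathcomp Require Export all_classical all_reals all_analysis.
Export Order.TTheory GRing.Theory Num.Theory.
Export numFieldNormedType.Exports.

#[export] Set Implicit Arguments.
#[export] Unset Strict Implicit.
#[export] Unset Printing Implicit Defensive.

Local Open Scope classical_set_scope.
Local Open Scope ring_scope.

(* 'S_n permutes 'I_n = {0, ..., n-1}: the j-th entry of the one-line notation
   on {1, ..., n} is (s j).+1, and the first position is j = 0. *)
Definition entry n (s : 'S_n) (j : 'I_n) : nat := (s j).+1.

Definition lower_record n (s : 'S_n) (j : 'I_n) : bool :=
  [forall i : 'I_n, (i <= j)%N ==> (entry s j <= entry s i)%N].

Definition upper_record n (s : 'S_n) (j : 'I_n) : bool :=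
  [forall i : 'I_n, (i <= j)%N ==> (entry s i <= entry s j)%N].

Definition proper_lower n (s : 'S_n) : nat :=
  #|[set j : 'I_n | (0 < j)%N && lower_record s j]%SET|.

Definition proper_upper n (s : 'S_n) : nat :=
  #|[set j : 'I_n | (0 < j)%N && upper_record s j]%SET|.

Definition sorted_records n (s : 'S_n) : seq nat :=
  sort leq [seq entry s j | j <- enum 'I_n & lower_record s j || upper_record s j].

(* sorted_records s has proper_lower s + 1 + proper_upper s items; the shift by
   proper_lower s puts the first entry of s at index k = 0. *)
Definition record_value n (s : 'S_n) (k : int) : nat :=
  if k < - (proper_lower s)%:Z then 1%N
  else if (proper_upper s)%:Z < k then n
  else nth 0%N (sorted_records s) `|(k + (proper_lower s)%:Z)%R|%N.

(* The right-hand side is the rank of the j-th entry of s n among its first m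
   entries. The term s 0 : 'S_0 carries no information. *)
Definition coherent (s : forall n, 'S_n) : Prop :=
  forall (m n : nat) (mn : (m <= n)%N) (j : 'I_m),
    entry (s m) j =
    #|[set i : 'I_m |
        (entry (s n) (widen_ord mn i) <= entry (s n) (widen_ord mn j))%N]%SET|.

Definition rising (R : realType) (x : R) (m : nat) : R :=
  \prod_(i < m) (x + i%:R).

(* The random sequence pi, defined on the probability space (T, P), is coherent
   and has distribution P^(theta, zeta). *)
Definition has_record_law (d : measure_display) (T : measurableType d)
    (R : realType) (P : probability T R) (theta zeta : R)
    (pi : forall n : nat, T -> 'S_n) : Prop :=
  [/\ forall (n : nat) (s : 'S_n), measurable (pi n @^-1` [set s]),
      forall w : T, coherent (fun n => pi n w)
    & forall (n : nat) (s : 'S_n), (0 < n)%N ->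
        P (pi n @^-1` [set s]) =
        (theta ^+ proper_lower s * zeta ^+ proper_upper s
          / rising (theta + zeta) n.-1)%:E].

Definition Gamma (R : realType) (a : R) : R :=
  \int[@lebesgue_measure R]_(x in `]0%R, +oo[) (x `^ (a - 1) * expR (- x)).

(* Real parameters, unlike the library's beta_pdf. *)
Definition beta_density (R : realType) (a b x : R) : R :=
  x `^ (a - 1) * (1 - x) `^ (b - 1) * (Gamma (a + b) / (Gamma a * Gamma b)).

Definition has_beta_law (d : measure_display) (T : measurableType d)
    (R : realType) (P : probability T R) (X : {RV P >-> R}) (a b : R) : Prop :=
  forall A : set R, measurable A ->
    distribution P X A =
    (\int[@lebesgue_measure R]_(x in A `&` `[0%R, 1%R]) (beta_density a b x)%:E)%E.
Arguments has_beta_law {d T R} P X a b.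

Definition mutually_independent (d : measure_display) (T : measurableType d)
    (R : realType) (P : probability T R) (I : choiceType)
    (X : I -> {RV P >-> R}) : Prop :=
  forall (J : seq I) (B : I -> set R), uniq J ->
    (forall i, measurable (B i)) ->
    P (\bigcap_(i in [set` J]) X i @^-1` B i) =
    (\prod_(i <- J) P (X i @^-1` B i))%E.
Arguments mutually_independent {d T R} P {I} X.

Definition sigma_of (d : measure_display) (T : measurableType d)
    (R : realType) (P : probability T R) (I : Type) (K : set I)
    (X : I -> {RV P >-> R}) : set (set T) :=
  <<s \bigcup_(i in K) preimage_set_system [set: T] (X i) measurable >>.
Arguments sigma_of {d T R P I} K X.

(* f x is a version of the conditional probability P(A | X = x). *)
Definition is_cond_prob (d : measure_display) (T : measurableType d)
    (R : realType) (P : probability T R) (X : {RV P >-> R}) (A : set T)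
    (f : R -> R) : Prop :=
  [/\ measurable_fun [set: R] f,
      P.-integrable [set: T] (fun w => (f (X w))%:E)
    & forall C : set R, measurable C ->
        P (A `&` X @^-1` C) = (\int[P]_(w in X @^-1` C) (f (X w))%:E)%E].
Arguments is_cond_prob {d T R} P X A f.

(* P(A `&` B | X) = P(A | X) P(B | X) almost surely. As versions of a
   conditional probability are a.s. unique, it does not matter which f, g are
   chosen. *)
Definition cond_independent (d : measure_display) (T : measurableType d)
    (R : realType) (P : probability T R) (X : {RV P >-> R})
    (F G : set (set T)) : Prop :=
  forall A B : set T, F A -> G B ->
    exists f g : R -> R,
      [/\ is_cond_prob P X A f, is_cond_prob P X B g
        & is_cond_prob P X (A `&` B) (fun x => f x * g x)].
Arguments cond_independent {d T R} P X F G.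

(* Main.v *)
(* Inserting the last entry of pi_(n+1) into pi_n moves the record values like a
   generalized Polya urn: suitable products of ratios of rising factorials in
   theta + r_k - 1, zeta + n - r_k and theta + zeta + n - 1 are martingales with
   values in [0, 1], and those asymptotic to r_k / n (k <= 0) or 1 - r_k / n
   (k >= 0) have increments O(1 / n). Their L^2 increments between times n and m
   are thus at most C (m - n) / n^2, which gives almost sure convergence. The
   martingales with general exponents converge to the mixed monomials in rho_0,
   T_k and Z_k, so the joint moments of these variables are products of beta
   moments. On [0, 1] moments determine measures, which yields at once the beta
   laws and the mutual independence; conditional independence given rho_0
   follows, as the lower records depend on rho_0 and the T_k only, the upper ones
   on rho_0 and the Z_k only. *)
From HB Require Import structures.
Require Import Defs.
From mathcomp Require Import measurable_realfun zify ring lra.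

Local Open Scope nat_scope.

(** * Records under insertion of a last entry *)

(** The two sides of the record sequence evolve alike: if the values beyond each record are counted,
    and the inserted rank is counted from the matching end, both sides obey the same recursion, and
    they meet only in the first entry. The urn computations are therefore done once, for an abstract
    chain. At any time only finitely many records exist. A ratio whose record is still missing is
    frozen at the moment x / (x + e) of beta(x, 1). This is exactly the value with which it starts
    to move once the record appears, so the products are martingales from the one-element
    permutation on, and their initial values are already the moments sought. Convergence and laws
    cannot be separated: a ratio of consecutive counts is controlled only where its denominator has
    a positive limit, which comes from the beta law of the preceding factor, itself a consequence of
    convergence. The induction on the record index alternates between the two. Moments determine
    measures through explicit polynomials 1 - (1 - t^a)^b, which approximate the indicator of t > y
    on [0, 1]. *)

Definition insertion n (i : 'I_n.+1) (s : 'S_n) : 'S_n.+1 := lift_perm ord_max i s.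

Lemma insertion_max n (i : 'I_n.+1) (s : 'S_n) : insertion i s ord_max = i.
Proof. by rewrite /insertion lift_perm_id. Qed.

Lemma insertion_widen n (i : 'I_n.+1) (s : 'S_n) (k : 'I_n) :
  insertion i s (widen_ord (leqnSn n) k) = lift i (s k).
Proof.
rewrite -(lift_perm_lift ord_max); congr (lift_perm _ _ _ _).
by apply/val_inj; rewrite /= /bump leqNgt ltn_ord.
Qed.

Lemma forall_ordS n (Q : pred 'I_n.+1) :
  [forall k, Q k] = [forall k : 'I_n, Q (widen_ord (leqnSn n) k)] && Q ord_max.
Proof.
apply/forallP/andP => [h|[/forallP h1 h2] k]; first by split; [apply/forallP|].
have [kn|] := ltnP k n.
  by rewrite (_ : k = widen_ord (leqnSn n) (Ordinal kn)) //; exact: val_inj.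
by move=> nk; rewrite (_ : k = ord_max) //; apply/val_inj/eqP;
  rewrite eqn_leq /= nk -ltnS ltn_ord.
Qed.

(** Insertion keeps the relative order of the old entries, and being a record depends only on the
    entries up to the given position. *)
Lemma lower_record_widen n (i : 'I_n.+1) (s : 'S_n) (k : 'I_n) :
  lower_record (insertion i s) (widen_ord (leqnSn n) k) = lower_record s k.
Proof.
rewrite /lower_record forall_ordS /= (leqNgt n) ltn_ord /= andbT.
by apply: eq_forallb => j; rewrite /entry !insertion_widen /= !ltnS leq_bump2.
Qed.

Lemma upper_record_widen n (i : 'I_n.+1) (s : 'S_n) (k : 'I_n) :
  upper_record (insertion i s) (widen_ord (leqnSn n) k) = upper_record s k.
Proof.
rewrite /upper_record forall_ordS /= (leqNgt n) ltn_ord /= andbT.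
by apply: eq_forallb => j; rewrite /entry !insertion_widen /= !ltnS leq_bump2.
Qed.

Lemma lower_record_max n (i : 'I_n.+1) (s : 'S_n) :
  lower_record (insertion i s) ord_max = (i == 0 :> nat).
Proof.
(* Compare with the position that holds the smallest value. *)
apply/forallP/eqP => [/(_ ((insertion i s)^-1%g ord0))|i0 k].
  by rewrite /entry permKV insertion_max -ltnS ltn_ord /= ltnS leqn0 => /eqP.
by rewrite /entry insertion_max i0 ltnS leq0n implybT.
Qed.

Lemma upper_record_max n (i : 'I_n.+1) (s : 'S_n) :
  upper_record (insertion i s) ord_max = (i == n :> nat).
Proof.
apply/forallP/eqP => [/(_ ((insertion i s)^-1%g ord_max))|i0 k].
  rewrite /entry permKV insertion_max -ltnS ltn_ord /= ltnS => ni.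
  by apply/eqP; rewrite eqn_leq ni -ltnS ltn_ord.
by apply/implyP => _; rewrite /entry insertion_max i0; exact: ltn_ord.
Qed.

Lemma card_set_ord n (Q : pred 'I_n) : #|[set j | Q j]%SET| = \sum_(j < n) Q j.
Proof.
rewrite -sum1dep_card big_mkcond /=; by apply: eq_bigr => j _; case: (Q j).
Qed.

(** Since [s] is non-empty, the new last position is never the first one, and a record there is
    proper. *)
Lemma proper_lower_insertion n (i : 'I_n.+2) (s : 'S_n.+1) :
  proper_lower (insertion i s) = proper_lower s + (i == 0 :> nat).
Proof.
rewrite /proper_lower !card_set_ord big_ord_recr /= lower_record_max.
by congr (_ + _); apply: eq_bigr => k _; rewrite lower_record_widen.
Qed.

Lemma proper_upper_insertion n (i : 'I_n.+2) (s : 'S_n.+1) :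
  proper_upper (insertion i s) = proper_upper s + (i == n.+1 :> nat).
Proof.
rewrite /proper_upper !card_set_ord big_ord_recr /= upper_record_max.
by congr (_ + _); apply: eq_bigr => k _; rewrite upper_record_widen.
Qed.

Lemma sorted_records_perm n (s : 'S_n) :
  perm_eq (sorted_records s)
    [seq entry s j | j <- enum 'I_n & lower_record s j || upper_record s j].
Proof. by rewrite /sorted_records perm_sort. Qed.

Lemma sorted_records_sorted n (s : 'S_n) : sorted leq (sorted_records s).
Proof. by apply: sort_sorted => a b; exact: leq_total. Qed.

Lemma sorted_records_bounded n (s : 'S_n) v :
  v \in sorted_records s -> 0 < v <= n.
Proof.
by rewrite (perm_mem (sorted_records_perm s)) => /mapP[j _ ->]; rewrite /entry /=.
Qed.

(* Rank i (counted from 0) is inserted, so a value v of s becomes v + 1 exactly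
   when i < v. *)
Lemma sorted_records_insertion n (i : 'I_n.+2) (s : 'S_n.+1) :
  sorted_records (insertion i s) =
  nseq (i == 0 :> nat) 1 ++ [seq v + (i < v) | v <- sorted_records s]
    ++ nseq (i == n.+1 :> nat) n.+2.
Proof.
(* Two sorted lists with the same elements coincide. A new record is an extreme value, 1 or [n.+2],
   so it can only be attached at an end. *)
apply: (sorted_eq leq_trans anti_leq); first exact: sorted_records_sorted.
- have h : sorted leq [seq v + (i < v) | v <- sorted_records s].
    apply: (homo_sorted _ _ (sorted_records_sorted s)) => a b ab.
    by apply: leq_add => //; case: (ltnP i a) => // ia; rewrite (leq_trans ia ab).
  move: h; rewrite !(sorted_pairwise leq_trans) !pairwise_cat => ->.
  have hb : all (fun v => 0 < v <= n.+2) [seq v + (i < v) | v <- sorted_records s].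
    apply/allP => _ /mapP[v /sorted_records_bounded/andP[v0 vn] ->].
    by rewrite addn_gt0 v0 (leq_trans (leq_add vn (leq_b1 _))) // addn1.
  have -> b x : pairwise leq (nseq b x) by elim: b => //= b ->; rewrite all_nseq leqnn orbT.
  have -> b x : pairwise leq (nseq b x) by elim: b => //= b ->; rewrite all_nseq leqnn orbT.
  rewrite !andbT; apply/andP; split.
    apply/allrelP => a b /nseqP[-> _]; rewrite mem_cat => /orP[|/nseqP[-> _] //].
    by move/(allP hb) => /andP[].
  by apply/allrelP => a b /(allP hb)/andP[_ an] /nseqP[-> _].
apply: perm_trans (sorted_records_perm _) _.
rewrite perm_sym perm_catC -catA.
have -> : enum 'I_n.+2 = rcons [seq widen_ord (leqnSn n.+1) k | k <- enum 'I_n.+1] ord_max.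
  by rewrite enum_ordSr.
rewrite -cats1 filter_cat map_cat; apply: perm_cat; last first.
  rewrite /= lower_record_max upper_record_max.
  rewrite /entry; have [i0|i0] := eqVneq (i : nat) 0; have [iN|iN] := eqVneq (i : nat) n.+1 => //=.
  - by move: iN; rewrite i0.
  - by rewrite insertion_max i0.
  - by rewrite insertion_max iN.
rewrite filter_map -map_comp.
apply: perm_trans (perm_map _ (sorted_records_perm s)) _.
rewrite -map_comp.
have -> : [seq k <- enum 'I_n.+1 | (preim (widen_ord (leqnSn n.+1))
        [pred j | lower_record (insertion i s) j || upper_record (insertion i s) j]) k] =
      [seq k <- enum 'I_n.+1 | lower_record s k || upper_record s k].
  by apply: eq_filter => k /=; rewrite lower_record_widen upper_record_widen.
have E : (fun v => v + (i < v)) \o entry s =1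
    entry (insertion i s) \o widen_ord (leqnSn n.+1).
  by move=> k /=; rewrite /entry insertion_widen /= /bump addSn addnC ltnS.
by rewrite (eq_map E).
Qed.

Lemma insertion_surj n (s : 'S_n.+1) : exists t : 'S_n, s = insertion (s ord_max) t.
Proof.
have h (k : 'I_n) : s ord_max != s (lift ord_max k).
  by rewrite (inj_eq perm_inj) neq_lift.
(* The default [k] is never returned: the other entries differ from the last one, so [unlift]
   succeeds. *)
pose f k := odflt k (unlift (s ord_max) (s (lift ord_max k))).
have fE k : lift (s ord_max) (f k) = s (lift ord_max k).
  by rewrite /f; case: unliftP (h k) => [j -> //|->]; rewrite eqxx.
have finj : injective f.
  by move=> a b /(congr1 (lift (s ord_max))); rewrite !fE => /perm_inj/lift_inj.
exists (perm finj); apply/permP => k.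
case: (unliftP ord_max k) => [j ->|->]; last by rewrite insertion_max.
by rewrite /insertion lift_perm_lift permE fE.
Qed.

Lemma insertion_ind (Q : forall n, 'S_n.+1 -> Prop) :
  (forall s : 'S_1, Q 0 s) ->
  (forall n (i : 'I_n.+2) (s : 'S_n.+1), Q n s -> Q n.+1 (insertion i s)) ->
  forall n s, Q n s.
Proof.
move=> Q0 QS; elim=> [|n IHn] s; first exact: Q0.
by have [t ->] := insertion_surj s; exact: QS.
Qed.

Lemma proper1 (s : 'S_1) : (proper_lower s = 0) * (proper_upper s = 0).
Proof.
by split; apply: eq_card0 => j; rewrite !inE; case: j => -[].
Qed.

Lemma size_sorted_records n (s : 'S_n.+1) :
  size (sorted_records s) = proper_lower s + proper_upper s + 1.
Proof.
move: n s; apply: insertion_ind => [s|n i s IH].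
  rewrite !proper1 (perm_size (sorted_records_perm s)) size_map.
  rewrite (eq_filter (a2 := predT)) ?filter_predT ?size_enum_ord // => j /=.
  by rewrite (_ : lower_record s j) //; apply/forallP => k; rewrite !ord1 !leqnn.
rewrite sorted_records_insertion proper_lower_insertion proper_upper_insertion.
by rewrite !size_cat !size_nseq size_map IH; lia.
Qed.

(** Numbers of values beyond the j-th record on its side, r_{-j} - 1 below and n - r_j above. With
    the padding conventions both vanish for missing records, and j = 0 refers to the first entry on
    both sides. *)
Definition low n (s : 'S_n) (j : nat) : nat := (record_value s (- j%:Z)%R).-1.
Definition upp n (s : 'S_n) (j : nat) : nat := n - record_value s j%:Z.

Lemma record_valueN n (s : 'S_n) (j : nat) : record_value s (- j%:Z)%R =
  if proper_lower s < j then 1 else nth 0 (sorted_records s) (proper_lower s - j).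
Proof.
rewrite /record_value ltrN2 ltz_nat; case: ltnP => // jl.
rewrite (_ : (_ < _)%R = false); last by lia.
by congr nth; lia.
Qed.

Lemma record_valueP n (s : 'S_n) (j : nat) : record_value s j%:Z =
  if proper_upper s < j then n else nth 0 (sorted_records s) (j + proper_lower s).
Proof.
rewrite /record_value (_ : (_ < - _)%R = false); last by lia.
by rewrite ltz_nat; case: ltnP.
Qed.

Lemma nth_sorted_records n (s : 'S_n.+1) m : m <= proper_lower s + proper_upper s ->
  0 < nth 0 (sorted_records s) m <= n.+1.
Proof.
move=> mlu; apply: (@sorted_records_bounded _ s).
by rewrite mem_nth // size_sorted_records addn1.
Qed.

Lemma record_value_bounded n (s : 'S_n.+1) k : 0 < record_value s k <= n.+1.
Proof.
have [[j]|[j]] : (exists j : nat, k = Posz j) \/ (exists j : nat, k = (- j%:Z)%R).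
  by case: k => j; [left; exists j|right; exists j.+1].
- move=> ->; rewrite record_valueP; case: (ltnP (proper_upper s)) => ju; first by rewrite /= leqnn.
   by apply: (@nth_sorted_records n s); lia.
- move=> ->; rewrite record_valueN; case: (ltnP (proper_lower s)) => jl //.
  by apply: (@nth_sorted_records n s); lia.
Qed.

(** A new minimum lengthens the sorted list and [proper_lower] together, so existing records keep
    their index and only their values may rise. The guard [j <= proper_lower s] keeps a missing
    record at 0: it stays missing, or it appears as the minimum itself. *)
Lemma low_insertion n (i : 'I_n.+2) (s : 'S_n.+1) j :
  low (insertion i s) j = low s j + ((j <= proper_lower s) && (i <= low s j)).
Proof.
rewrite /low !record_valueN proper_lower_insertion sorted_records_insertion.
have [jl|lj] := leqP j (proper_lower s).
  rewrite ltnNge (leq_trans jl) ?leq_addr //=.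
  rewrite nth_cat size_nseq ifF; last by lia.
  rewrite nth_cat size_map size_sorted_records ifT; last by lia.
  rewrite (nth_map 0) ?size_sorted_records; last by lia.
  rewrite (_ : proper_lower s + (i == 0 :> nat) - j - (i == 0 :> nat) =
    proper_lower s - j); last by lia.
  by have := @nth_sorted_records _ s (proper_lower s - j); lia.
rewrite /=; case: ltnP => // jl.
have i0 : i = 0 :> nat by case: eqP jl lj => //; lia.
by rewrite i0 /= (_ : proper_lower s + 1 - j = 0) //; move: jl; rewrite i0 /=; lia.
Qed.

(** Mirror image of [low_insertion]: [n.+1 - i] is the inserted rank counted from the top. *)
Lemma upp_insertion n (i : 'I_n.+2) (s : 'S_n.+1) j :
  upp (insertion i s) j = upp s j + ((j <= proper_upper s) && (n.+1 - i <= upp s j)).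
Proof.
rewrite /upp !record_valueP proper_lower_insertion proper_upper_insertion.
rewrite sorted_records_insertion.
have [jl|lj] := leqP j (proper_upper s).
  rewrite ltnNge (leq_trans jl) ?leq_addr //=.
  rewrite nth_cat size_nseq ifF; last by lia.
  rewrite nth_cat size_map size_sorted_records ifT; last by lia.
  rewrite (nth_map 0) ?size_sorted_records; last by lia.
  rewrite (_ : j + (proper_lower s + (i == 0 :> nat)) - (i == 0 :> nat) =
    j + proper_lower s); last by lia.
  have := @nth_sorted_records _ s (j + proper_lower s); have := ltn_ord i; lia.
rewrite /=; case: ltnP => jl; first by lia.
have iN : i = n.+1 :> nat by case: eqP jl lj => //; lia.
rewrite iN eqxx /= in jl *.
rewrite nth_cat size_map size_sorted_records ifF; last by lia.
by rewrite (_ : j + _ - _ = 0) /=; lia.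
Qed.

(* l is the number of proper records on one side and a j the number of values
   beyond the j-th record on that side. *)
Definition chain (l : nat) (a : nat -> nat) :=
  (forall j, l <= j -> a j = 0) /\ (forall j, a j.+1 <= a j).

(** One insertion as seen from one side, with [i] the rank counted from the end of that side; rank 0
    creates a record. *)
Definition chain_step (l : nat) (a : nat -> nat) (i j : nat) : nat :=
  a j + ((j <= l) && (i <= a j)).

(** The last record of a side is its extreme value, so the counts vanish from index [l] on. A new
    extreme value puts exactly one value beyond the former one, and the bound moves to [l + 1]. *)
Lemma chain_stepP l a i : chain l a -> chain (l + (i == 0)) (chain_step l a i).
Proof.
move=> [a0 aS]; rewrite /chain_step; split => j.
  by move=> lj; have := a0 j; case: (eqVneq i 0) lj => [->|]; lia.
by have := aS j; lia.
Qed.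

Lemma low1 (s : 'S_1) j : low s j = 0.
Proof. by rewrite /low; have := record_value_bounded s (- j%:Z)%R; lia. Qed.

Lemma upp1 (s : 'S_1) j : upp s j = 0.
Proof. by rewrite /upp; have := record_value_bounded s j; lia. Qed.

Lemma low_chain n (s : 'S_n.+1) : chain (proper_lower s) (low s).
Proof.
move: n s; apply: insertion_ind => [s|n i s IH].
  by split=> j; rewrite !low1.
rewrite proper_lower_insertion.
have -> : low (insertion i s) = chain_step (proper_lower s) (low s) i.
  by apply/funext => j; rewrite low_insertion.
exact: chain_stepP.
Qed.

Lemma upp_chain n (s : 'S_n.+1) : chain (proper_upper s) (upp s).
Proof.
move: n s; apply: insertion_ind => [s|n i s IH].
  by split=> j; rewrite !upp1.
rewrite proper_upper_insertion.
have -> : upp (insertion i s) = chain_step (proper_upper s) (upp s) (n.+1 - i).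
  by apply/funext => j; rewrite upp_insertion.
rewrite (_ : (i == n.+1 :> nat) = (n.+1 - i == 0)); first exact: chain_stepP.
by have := ltn_ord i; lia.
Qed.

(** Every value except the first entry lies below or above it. This is the only relation between the
    two sides. *)
Lemma low_upp n (s : 'S_n.+1) : low s 0 + upp s 0 = n.
Proof.
move: n s; apply: insertion_ind => [s|n i s IH]; first by rewrite low1 upp1.
by rewrite low_insertion upp_insertion /=; have := ltn_ord i; lia.
Qed.

Lemma record_value_low n (s : 'S_n.+1) j : record_value s (- j%:Z)%R = (low s j).+1.
Proof. by rewrite /low; have := record_value_bounded s (- j%:Z)%R; lia. Qed.

Lemma record_value_upp n (s : 'S_n.+1) (j : nat) : record_value s j = n.+1 - upp s j.
Proof. by rewrite /upp; have := record_value_bounded s j%:Z; lia. Qed.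

Local Open Scope classical_set_scope.
Local Open Scope ring_scope.

(** * The martingales *)

Section Ratio.
Context {R : realType}.
Implicit Types (x y : R) (l : nat) (a : nat -> nat).

Lemma rising0 x : rising x 0 = 1.
Proof. by rewrite /rising big_ord0. Qed.

Lemma risingSr x e : rising x e.+1 = rising x e * (x + e%:R).
Proof. by rewrite /rising big_ord_recr. Qed.

Lemma risingS x e : rising x e.+1 = x * rising (x + 1) e.
Proof.
rewrite /rising big_ord_recl addr0; congr (_ * _); apply: eq_bigr => i _.
by rewrite /= -addrA -natr1 (addrC 1).
Qed.

Lemma rising_gt0 x e : 0 < x -> 0 < rising x e.
Proof. by move=> x0; apply: prodr_gt0 => i _; rewrite ltr_wpDr. Qed.

Lemma rising_ge0 x e : 0 <= x -> 0 <= rising x e.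
Proof. by move=> x0; apply: prodr_ge0 => i _; rewrite addr_ge0. Qed.

(** Absorbing a weight into a rising factorial. The martingale identities and the moments of beta(x,
    1) all reduce to this exchange. *)
Lemma risingD1 x e : x * rising (x + 1) e = rising x e * (x + e%:R).
Proof. by rewrite -risingS risingSr. Qed.

Lemma rising_le x y e : 0 <= x -> x <= y -> rising x e <= rising y e.
Proof.
move=> x0 xy; apply: ler_prod => i _.
by rewrite addr_ge0 //= lerD2r.
Qed.

(* While fewer than j + 1 proper records are present, the ratio is frozen at the
   e-th moment x / (x + e) of its limit. *)
Definition ratio x l a (e j : nat) : R :=
  if (j < l)%N then rising (x + (a j.+1)%:R) e / rising (x + (a j)%:R) e
  else x / (x + e%:R).

Lemma chain_le l a j m : chain l a -> (j <= m)%N -> (a m <= a j)%N.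
Proof.
move=> [_ aS]; elim: m => [|m IH]; first by rewrite leqn0 => /eqP ->.
by rewrite leq_eqVlt => /orP[/eqP -> //|/IH]; exact: leq_trans.
Qed.

Lemma ratio_ge0 x l a e j : 0 < x -> 0 <= ratio x l a e j.
Proof.
move=> x0; rewrite /ratio; case: ifP => _.
  by rewrite divr_ge0 ?rising_ge0 ?addr_ge0 // ltW.
by rewrite divr_ge0 ?addr_ge0 // ltW.
Qed.

Lemma ratio_le1 x l a e j : 0 < x -> chain l a -> ratio x l a e j <= 1.
Proof.
move=> x0 ca; rewrite /ratio; case: ifP => _.
  rewrite ler_pdivrMr ?mul1r; last by rewrite rising_gt0 // ltr_wpDr.
  by rewrite rising_le ?addr_ge0 ?(ltW x0) // lerD2l ler_nat; case: ca.
by rewrite ler_pdivrMr ?mul1r ?ltr_wpDr // lerDl.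
Qed.

(** Ranks up to [a j] enter beyond the j-th record. Their weights add up to [x + a j], and averaging
    with them leaves the product of the ratios from [j] on unchanged. Ranks up to [a j.+1] shift
    numerator and denominator of the first ratio and reproduce the claim for the others; the
    remaining ranks shift only its denominator and touch no later ratio. *)
Lemma chain_sum x l a (e : nat -> nat) (j k : nat) : 0 < x -> chain l a ->
  \sum_(0 <= i < (a j).+1) (if i == 0%N then x else 1) *
    \prod_(j <= m < j + k) ratio x (l + (i == 0%N)) (chain_step l a i) (e m) m =
  (x + (a j)%:R) * \prod_(j <= m < j + k) ratio x l a (e m) m.
Proof.
move=> x0 ca.
have wsum N : \sum_(0 <= i < N.+1) (if i == 0%N then x else 1) = x + N%:R.
  elim: N => [|N IH]; first by rewrite big_nat1 addr0.
  by rewrite big_nat_recr //= IH -natr1 addrA.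
elim: k j => [|k IH] j.
  rewrite addn0 big_geq // mulr1 -wsum; apply: eq_bigr => i _.
  by rewrite big_geq // mulr1.
have [lj|jl] := leqP l j.
  have aj : a j = 0%N by case: ca => h _; exact: h.
  rewrite aj big_nat1 /= addr0; congr (_ * _); apply: eq_big_nat => m /andP[jm _].
  rewrite /ratio (ltnNge m l) (leq_trans lj jm) /=.
  rewrite addn1 ltnS; case: leqP => // ml.
  have -> : m = l by apply/eqP; rewrite eqn_leq ml (leq_trans lj jm).
  rewrite /chain_step ltnn leqnn /= addn0.
  have [h _] := ca; rewrite !h //= add0n addr0; apply/eqP.
  have n1 : rising (x + 1) (e l) != 0 by rewrite gt_eqF // rising_gt0 // addr_gt0.
  have n2 : x + (e l)%:R != 0 by rewrite gt_eqF // ltr_wpDr.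
  by rewrite (eqr_div _ _ n1 n2) risingD1.
have ajS : (a j.+1 <= a j)%N by case: ca.
rewrite (big_cat_nat _ (n := (a j.+1).+1)) //=.
have jk : (j < j + k.+1)%N by lia.
rewrite [in RHS]big_ltn //.
set A := rising (x + (a j.+1)%:R) (e j); set B := rising (x + (a j)%:R) (e j).
set A' := rising (x + (a j.+1)%:R + 1) (e j).
set B' := rising (x + (a j)%:R + 1) (e j).
have -> : ratio x l a (e j) j = A / B by rewrite /ratio jl.
under eq_big_nat => i /andP[_ ia].
  rewrite big_ltn //.
  have -> : ratio x (l + (i == 0%N)) (chain_step l a i) (e j) j = A' / B'.
    rewrite /ratio ltn_addr // /chain_step jl (ltnW jl) /=.
    by rewrite -ltnS ia (leq_trans _ ajS) // !natrD /= !addrA.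
  rewrite mulrCA.
  over.
rewrite -mulr_sumr addnS -addSn IH.
set Q := \prod_(_ <= m < _) ratio x l a (e m) m.
have -> : \sum_((a j.+1).+1 <= i < (a j).+1) (if i == 0%N then x else 1) *
    \prod_(j <= m < j.+1 + k) ratio x (l + (i == 0%N)) (chain_step l a i) (e m) m =
  ((a j)%:R - (a j.+1)%:R) * (A / B' * Q).
  transitivity (\sum_((a j.+1).+1 <= i < (a j).+1) (A / B' * Q)); last first.
    by rewrite big_const_nat iter_addr_0 subSS -[LHS]mulr_natl natrB.
  apply: eq_big_nat => i /andP[ai ia].
  have i0 : (i == 0%N) = false by case: i ai {ia}.
  rewrite i0 addn0 mul1r big_ltn; last by lia.
  congr (_ * _).
    rewrite /ratio jl /chain_step jl (ltnW jl) /= leqNgt ai -ltnS ia /=.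
    by rewrite addn0 natrD addrA.
  apply: eq_big_nat => m /andP[jm _].
  rewrite /ratio /chain_step.
  have h p : (j.+1 <= p)%N -> (i <= a p)%N = false.
    by move=> jp; rewrite leqNgt (leq_ltn_trans (chain_le ca jp)).
  by rewrite !h ?andbF ?addn0 // leqW.
have B0 : B != 0 by rewrite gt_eqF // rising_gt0 // ltr_wpDr.
have B'0 : B' != 0 by rewrite gt_eqF // rising_gt0 // addr_gt0 // ltr_wpDr.
(* After [risingD1] both blocks are multiples of A / B', with coefficients [x + a j.+1 + e j] and
   [a j - a j.+1]; their sum [x + a j + e j] is absorbed again by [hB]. *)
have hA : (x + (a j.+1)%:R) * A' = A * (x + (a j.+1)%:R + (e j)%:R) := risingD1 _ _.
have hB : (x + (a j)%:R) * B' = B * (x + (a j)%:R + (e j)%:R) := risingD1 _ _.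
have y0 : x + (a j)%:R + (e j)%:R != 0 by rewrite gt_eqF // !ltr_wpDr.
have -> : A' / B' * ((x + (a j.+1)%:R) * Q) = (x + (a j.+1)%:R) * A' * (Q / B') by field; rewrite ?B'0.
rewrite hA.
have -> : (x + (a j)%:R) * (A / B * Q) = (x + (a j)%:R) * B' * (A / B * Q / B') by field; rewrite ?B0 ?B'0.
by rewrite hB; field; rewrite ?B0 ?B'0.
Qed.

End Ratio.

(** * Coherent sequences as successive insertions *)

Lemma insertion_inj n (i j : 'I_n.+1) (s t : 'S_n) :
  insertion i s = insertion j t -> i = j /\ s = t.
Proof.
move=> ij; have ij' : i = j by rewrite -(insertion_max i s) ij insertion_max.
split => //; apply/permP => k.
move/(congr1 (fun s => fun_of_perm s (widen_ord (leqnSn n) k))): ij.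
by rewrite !insertion_widen ij' => /lift_inj.
Qed.

Definition restriction n (s : 'S_n.+1) : 'S_n := projT1 (cid (insertion_surj s)).

Lemma restrictionK n (s : 'S_n.+1) : insertion (s ord_max) (restriction s) = s.
Proof. by rewrite /restriction; case: cid. Qed.

Lemma insertionK n (i : 'I_n.+1) : cancel (insertion i) (@restriction n).
Proof. by move=> s; have [] := insertion_inj (restrictionK (insertion i s)). Qed.

Lemma sum_insertion (V : nmodType) n (F : 'S_n.+1 -> V) :
  \sum_s F s = \sum_(s : 'S_n) \sum_(i < n.+1) F (insertion i s).
Proof.
rewrite pair_big /= (reindex (fun p : 'S_n * 'I_n.+1 => insertion p.2 p.1)) //.
exists (fun s => (restriction s, s ord_max)) => [[s i]|s] _ /=.
  by rewrite insertionK insertion_max.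
by rewrite restrictionK.
Qed.

(** Ranks among the first n entries are unchanged when the last entry is deleted, and a permutation
    is its own ranking; so coherence identifies [s n] with the restriction of [s n.+1]. *)
Lemma coherent_insertion (s : forall n, 'S_n) n : coherent s ->
  s n.+1 = insertion (s n.+1 ord_max) (s n).
Proof.
move=> cs; rewrite -{1}(restrictionK (s n.+1)); congr insertion.
apply/permP => j; apply/val_inj/succn_inj.
have := cs n n.+1 (leqnSn n) j; rewrite /entry => ->.
rewrite -{2 3}(restrictionK (s n.+1)); set t := restriction _.
transitivity #|[set k : 'I_n | (k <= t j)%N]%SET|.
  have tj : (t j < n)%N by [].
  rewrite -sum1dep_card (eq_bigl (fun k : 'I_n => (k < (t j).+1)%N)) //.
  by rewrite (big_ord_narrow tj) sum1_card card_ord.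
rewrite -(card_preimset _ (@perm_inj _ t)); congr #|pred_of_set _|.
by apply/setP => k; rewrite !inE !insertion_widen /= !ltnS leq_bump2.
Qed.

Section Martingale.
Context {R : realType} (theta zeta : R).
Hypotheses (theta0 : 0 < theta) (zeta0 : 0 < zeta).

Definition law n (s : 'S_n) : R :=
  theta ^+ proper_lower s * zeta ^+ proper_upper s / rising (theta + zeta) n.-1.

(** Unnormalised probability that rank [i] is inserted into a permutation of [n.+1] elements: theta
    for a new minimum, zeta for a new maximum, 1 for each of the n ranks between. *)
Definition weight (n i : nat) : R :=
  if i == 0%N then theta else if i == n.+1 then zeta else 1.

Lemma total_gt0 n : 0 < theta + zeta + n%:R.
Proof. by rewrite ltr_wpDr // addr_gt0. Qed.

Lemma law_gt0 n (s : 'S_n) : 0 < law s.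
Proof. by rewrite divr_gt0 ?mulr_gt0 ?exprn_gt0 ?rising_gt0 ?addr_gt0. Qed.

Lemma weight_gt0 n i : 0 < weight n i.
Proof. by rewrite /weight; do 2 case: ifP => //. Qed.

Lemma law_insertion n (i : 'I_n.+2) (s : 'S_n.+1) :
  law (insertion i s) = law s * (weight n i / (theta + zeta + n%:R)).
Proof.
rewrite /law proper_lower_insertion proper_upper_insertion /= risingSr !exprD.
have -> : weight n i = theta ^+ (i == 0 :> nat)%N * zeta ^+ (i == n.+1 :> nat).
  rewrite /weight; have [->|i0] := eqVneq (i : nat) 0%N; first by rewrite mulr1.
  by case: eqP; rewrite ?mul1r.
by rewrite invfM; ring.
Qed.

(* The exponents p, q, e j, f j become those of rho_0, 1 - rho_0, T_{-(j + 1)}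
   and Z_{j + 1} in the limit. *)
Definition mart (p q K : nat) (e f : nat -> nat) n (s : 'S_n.+1) : R :=
  rising (theta + (low s 0)%:R) p * rising (zeta + (upp s 0)%:R) q
    / rising (theta + zeta + n%:R) (p + q)
  * (\prod_(0 <= j < K) ratio theta (proper_lower s) (low s) (e j) j)
  * (\prod_(0 <= j < K) ratio zeta (proper_upper s) (upp s) (f j) j).

(** Ranks up to [low s 0] enter below the first entry, the others above it. Each block leaves the
    opposite side unchanged, and [chain_sum] averages its own side. By [risingD1] the blocks carry
    the factors A + p and B + q, whose sum cancels against the shift of the normalising factorial
    because W = A + B. *)
Lemma mart_insertion p q K e f n (s : 'S_n.+1) :
  \sum_(i < n.+2) weight n i * mart p q K e f (insertion i s) =
  (theta + zeta + n%:R) * mart p q K e f s.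
Proof.
rewrite {2}/mart; move: (fun i => @low_insertion n i s) (fun i => @upp_insertion n i s) (low_upp s).
move: (low_chain s) (upp_chain s) (fun i => @proper_lower_insertion n i s).
move: (fun i => @proper_upper_insertion n i s); rewrite /mart.
move: (low s) (upp s) (proper_lower s) (proper_upper s) => a b l u.
move=> uE ca cb lE aE bE ab.
set L := \prod_(0 <= j < K) ratio theta l a (e j) j.
set U := \prod_(0 <= j < K) ratio zeta u b (f j) j.
have Wn : n%:R = (a 0%N)%:R + (b 0%N)%:R :> R by rewrite -natrD ab.
set W := theta + zeta + n%:R.
set A := theta + (a 0%N)%:R; set B := zeta + (b 0%N)%:R.
pose F i := weight n i *
  (rising (theta + (chain_step l a i 0)%:R) p
   * rising (zeta + (chain_step u b (n.+1 - i) 0)%:R) q / rising (W + 1) (p + q)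
   * (\prod_(0 <= j < K) ratio theta (l + (i == 0%N)) (chain_step l a i) (e j) j)
   * (\prod_(0 <= j < K) ratio zeta (u + (n.+1 - i == 0)%N)
       (chain_step u b (n.+1 - i)) (f j) j)).
rewrite (eq_bigr (fun i : 'I_n.+2 => F i)); last first.
  move=> i _; rewrite /F lE uE.
  rewrite (_ : low (insertion i s) = chain_step l a i); last first.
    by apply/funext => j; rewrite aE.
  rewrite (_ : upp (insertion i s) = chain_step u b (n.+1 - i)); last first.
    by apply/funext => j; rewrite bE.
  rewrite (_ : (i == n.+1 :> nat) = (n.+1 - i == 0)%N); last first.
    by have := ltn_ord i; lia.
  by rewrite -natr1 addrA.
rewrite -(big_mkord xpredT F) (big_cat_nat _ (n := (a 0%N).+1)) //=; last by lia.
have low_part : \sum_(0 <= i < (a 0%N).+1) F i =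
    A * L * (rising (A + 1) p * rising B q / rising (W + 1) (p + q) * U).
  rewrite /L -(add0n K) -(chain_sum e 0 K theta0 ca) mulr_suml.
  apply: eq_big_nat => i /andP[_ ia].
  have iN : (i == n.+1) = false by lia.
  have iN' : (n.+1 - i <= b 0%N)%N = false by lia.
  have h j : (n.+1 - i <= b j)%N = false.
    by have := chain_le cb (leq0n j); lia.
  have Ni : (n.+1 - i == 0)%N = false by lia.
  rewrite /F /weight iN Ni addn0.
  have -> : chain_step u b (n.+1 - i) = b.
    by apply/funext => j; rewrite /chain_step h andbF addn0.
  rewrite {1}/chain_step leq0n -ltnS ia /= natrD addrA -/U !add0n.
  by ring.
have upp_part : \sum_((a 0%N).+1 <= i < n.+2) F i =
    B * U * (rising A p * rising (B + 1) q / rising (W + 1) (p + q) * L).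
  rewrite -(add0n (a 0%N).+1) big_addn.
  rewrite (_ : (n.+2 - (a 0%N).+1 = (b 0%N).+1)%N); last by lia.
  (* Reversing the sum makes the rank counted from the top the summation index, as [chain_sum]
     requires. *)
  rewrite big_nat_rev /= /U -(add0n K) -(chain_sum f 0 K zeta0 cb) mulr_suml.
  apply: eq_big_nat => i /andP[_ ib].
  rewrite (_ : (0 + (b 0%N).+1 - i.+1 + (a 0%N).+1 = n.+1 - i)%N); last by lia.
  have ii : (n.+1 - (n.+1 - i) = i)%N by lia.
  have iN : (n.+1 - i == 0)%N = false by lia.
  have iN' : (n.+1 - i == n.+1)%N = (i == 0)%N by lia.
  have h j : (n.+1 - i <= a j)%N = false.
    by have := chain_le ca (leq0n j); lia.
  rewrite /F /weight iN iN' ii addn0.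
  have -> : chain_step l a (n.+1 - i) = a.
    by apply/funext => j; rewrite /chain_step h andbF addn0.
  rewrite {1}/chain_step leq0n -ltnS ib /= natrD addrA -/L !add0n.
  by ring.
rewrite low_part upp_part -/W -/L -/U -/A -/B.
have r0 : rising W (p + q) != 0 by rewrite gt_eqF // rising_gt0 // total_gt0.
have r1 : rising (W + 1) (p + q) != 0.
  by rewrite gt_eqF // rising_gt0 // addr_gt0 // total_gt0.
have W0 : W != 0 by rewrite gt_eqF // total_gt0.
have Wpq : W + (p + q)%:R != 0 by rewrite gt_eqF // ltr_wpDr // total_gt0.
have hA := risingD1 A p; have hB := risingD1 B q; have hW := risingD1 W (p + q).
have -> : A * L * (rising (A + 1) p * rising B q / rising (W + 1) (p + q) * U) =
  (A * rising (A + 1) p) * (rising B q * (W / (W * rising (W + 1) (p + q))) * L * U).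
  by field; rewrite r1.
have -> : B * U * (rising A p * rising (B + 1) q / rising (W + 1) (p + q) * L) =
  (B * rising (B + 1) q) * (rising A p * (W / (W * rising (W + 1) (p + q))) * L * U).
  by field; rewrite r1.
rewrite hA hB hW.
have WE : W = A + B by rewrite /W Wn /A /B; ring.
by rewrite WE natrD; field; rewrite -natrD -WE r0.
Qed.

(** With all exponents 0 the martingale is the constant 1. *)
Lemma weight_sum n : \sum_(i < n.+2) weight n i = theta + zeta + n%:R.
Proof.
have [t _] := insertion_surj (1%g : 'S_n.+2).
have M1 m (s : 'S_m.+1) : mart 0 0 0 (fun=> 0%N) (fun=> 0%N) s = 1.
  by rewrite /mart !big_geq // !rising0 !mulr1 divr1.
have := mart_insertion 0 0 0 (fun=> 0%N) (fun=> 0%N) t.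
by under eq_bigr do rewrite M1 mulr1; rewrite M1 mulr1.
Qed.


End Martingale.

(** * Almost sure convergence *)

Section AlmostSure.
Context {d : measure_display} {T : measurableType d} {R : realType}.
Variable P : probability T R.

Lemma sum_inv_sqr_le (c : R) n : 0 <= c ->
  \sum_(0 <= j < n) c / j.+1%:R ^+ 2 <= 2 * c.
Proof.
move=> c0; rewrite -mulr_sumr mulrC; apply: ler_wpM2r => //.
(* The sharper bound 2 - 1 / (n + 1) passes through the induction, since 1 / (x + 1)^2 is at most 1
   / x - 1 / (x + 1). *)
suff : \sum_(0 <= j < n.+1) (j.+1%:R ^+ 2)^-1 <= 2 - n.+1%:R^-1 :> R.
  rewrite big_nat_recr //= => h.
  have h1 : 0 <= (n.+1%:R ^+ 2)^-1 :> R by rewrite invr_ge0 exprn_ge0.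
  have h2 : 0 <= n.+1%:R^-1 :> R by rewrite invr_ge0.
  by apply: le_trans (le_trans _ h) _; rewrite ?lerDl // gerBl.
elim: n => [|n IH]; first by rewrite big_nat1 expr1n invr1; lra.
rewrite big_nat_recr //=; apply: le_trans (lerD IH (lexx _)) _.
have n0 : 0 < n.+1%:R :> R by [].
rewrite -[n.+2%:R]natr1; set x : R := n.+1%:R in n0 *.
have -> : 2 - (x + 1)^-1 = 2 - x^-1 + (x^-1 - (x + 1)^-1) by ring.
rewrite lerD2l.
have -> : x^-1 - (x + 1)^-1 = (x * (x + 1))^-1.
  by field; rewrite !gt_eqF // addr_gt0.
by rewrite lef_pV2 ?posrE ?mulr_gt0 ?exprn_gt0 ?addr_gt0 // expr2 ler_pM2r ?addr_gt0 // lerDl.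
Qed.

(** With m = j + 1 the difference is 4m^3 + 6m^2 + 4m + 1, and 15 = 4 + 6 + 4 + 1. *)
Lemma fourth_powers (j : nat) :
  (j.+2 ^ 4 - j.+1 ^ 4 <= 15 * j.+1 ^ 3)%N.
Proof. by rewrite !expnS !expn0; nia. Qed.

Lemma fourth_root n : exists j, (j.+1 ^ 4 <= n.+1 < j.+2 ^ 4)%N.
Proof.
elim: n => [|n [j /andP[jn nj]]]; first by exists 0%N.
have [h|h] := ltnP n.+2 (j.+2 ^ 4).
  by exists j; rewrite h andbT (leq_trans jn).
by exists j.+1; rewrite h (leq_ltn_trans nj) // ltn_exp2r.
Qed.

Variables (M : nat -> T -> R) (C : R).
Hypotheses (mM : forall n, measurable_fun setT (M n)) (C0 : 0 <= C).
Hypothesis incr_le : forall n w, `|M n.+1 w - M n w| <= C / n.+1%:R.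
Hypothesis sqr_le : forall n m, (n <= m)%N ->
  (\int[P]_w ((M m w - M n w) ^+ 2)%:E <= ((m - n)%:R * C ^+ 2 / n.+1%:R ^+ 2)%:E)%E.

(** Bounds at time [n] involve [n.+1], hence the shift. Between consecutive fourth powers the second
    moments are O(j^-5), which leaves room for the integer weight [a ^+ 2] in the AM-GM bound. *)
Let N j := (j.+1 ^ 4).-1.

Let NS j : (N j).+1 = (j.+1 ^ 4)%N.
Proof. by rewrite /N prednK // expn_gt0. Qed.

Lemma incr_sum_le n m w : (n <= m)%N ->
  `|M m w - M n w| <= (m - n)%:R * (C / n.+1%:R).
Proof.
elim: m => [|m IH]; first by rewrite leqn0 => /eqP ->; rewrite !subrr normr0 mul0r.
rewrite leq_eqVlt => /orP[/eqP <-|]; first by rewrite subrr normr0 subnn mul0r.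
rewrite ltnS => nm; rewrite subSn // -natr1 mulrDl mul1r.
have -> : M m.+1 w - M n w = (M m w - M n w) + (M m.+1 w - M m w) by ring.
apply: le_trans (ler_normD _ _) _; apply: lerD; first exact: IH.
apply: le_trans (incr_le _ _) _; apply: ler_wpM2l => //.
by rewrite lef_pV2 ?posrE // ler_nat.
Qed.

(* By AM-GM the increments between the times j^4 have means O(j^-2), hence are
   almost surely summable; in between M moves by O(j^3 / j^4). *)
Lemma ae_cvg_of_increments : {ae P, forall w, cvgn (M ^~ w)}.
Proof.
pose X j w : R := `|M (N j.+1) w - M (N j) w|.
have X0 j w : (0 <= (X j w)%:E)%E by rewrite lee_fin /X.
have mX j : measurable_fun setT (X j).
  by apply: measurableT_comp => //; exact: measurable_funB.
(* The 15 comes from [fourth_powers], the 1 from the term a^-2 of the AM-GM bound. *)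
pose c := 15 * C ^+ 2 + 1.
have c0 : 0 <= c by rewrite addr_ge0 ?mulr_ge0 ?exprn_ge0.
have intX j : (\int[P]_w (X j w)%:E <= (c / j.+1%:R ^+ 2)%:E)%E.
  set a : R := j.+1%:R.
  have a0 : 0 < a by [].
  have a2 : 0 <= a ^+ 2 := sqr_ge0 a.
  have mD : measurable_fun setT (fun w => (M (N j.+1) w - M (N j) w) ^+ 2).
    by apply: measurable_funX; exact: measurable_funB.
  apply: (@le_trans _ _ (\int[P]_w
     ((a ^+ 2)%:E * ((M (N j.+1) w - M (N j) w) ^+ 2)%:E + ((a ^+ 2)^-1)%:E))%E).
    apply: ge0_le_integral => //.
    - exact/measurable_EFinP.
    - apply: emeasurable_funD; last exact: measurable_cst.
      by apply: emeasurable_funM; [exact: measurable_cst|exact/measurable_EFinP].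
    - move=> w _; rewrite -EFinM -EFinD lee_fin /X.
      set y := M _ w - M _ w; rewrite -[y ^+ 2]real_normK ?num_real //.
      have h : 0 <= (a * `|y| - a^-1) ^+ 2 := sqr_ge0 _.
      have -> : a ^+ 2 * `|y| ^+ 2 + (a ^+ 2)^-1 = (a * `|y| - a^-1) ^+ 2 + 2 * `|y|.
        by field; rewrite gt_eqF.
      by rewrite -[leLHS]add0r; apply: lerD => //; rewrite ler_peMl // ler1n.
  rewrite ge0_integralD //; last 3 first.
  - by move=> w _; rewrite -EFinM lee_fin; apply: mulr_ge0 => //; exact: sqr_ge0.
  - by apply: emeasurable_funM; [exact: measurable_cst|exact/measurable_EFinP].
  - by move=> w _; rewrite lee_fin invr_ge0.
  rewrite integral_cst //= probability_setT mule1 ge0_integralZl //; last 2 first.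
  - exact/measurable_EFinP.
  - by move=> w _; rewrite lee_fin sqr_ge0.
  have NN : (N j <= N j.+1)%N by rewrite -ltnS !NS leq_exp2r.
  apply: (@le_trans _ _ ((a ^+ 2)%:E * ((15 * j.+1 ^ 3)%:R * C ^+ 2 / (N j).+1%:R ^+ 2)%:E
    + ((a ^+ 2)^-1)%:E)%E).
    apply: leeD => //; apply: lee_pmul => //.
      by apply: integral_ge0 => w _; rewrite lee_fin sqr_ge0.
    apply: le_trans (sqr_le NN) _; rewrite lee_fin.
    rewrite ler_wpM2r ?invr_ge0 ?exprn_ge0 // ler_wpM2r ?exprn_ge0 // ler_nat.
    by apply: leq_trans (fourth_powers j); rewrite -!NS subSS.
  rewrite -EFinM -EFinD lee_fin NS natrM !natrX -/a.
  have -> : a ^+ 2 * (15 * a ^+ 3 * C ^+ 2 / (a ^+ 4) ^+ 2) + (a ^+ 2)^-1 =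
     (15 * C ^+ 2 / a + 1) / a ^+ 2 by field; rewrite gt_eqF.
  rewrite ler_wpM2r ?invr_ge0 ?exprn_ge0 ?(ltW a0) // lerD2r.
  rewrite ler_pdivrMr // ler_peMr ?mulr_ge0 ?exprn_ge0 //.
  by rewrite /a -(natr1 j) lerDr.
have sumX : (\int[P]_w (\sum_(0 <= j <oo) (X j w)%:E) <= (2 * c)%:E)%E.
  rewrite integral_nneseries //; last first.
    by move=> j; exact/measurable_EFinP.
  apply: lime_le.
    by apply: is_cvg_nneseries => j _ _; apply: integral_ge0.
  apply: nearW => n; apply: le_trans (lee_sum _ (fun j _ => intX j)) _.
  by rewrite sumEFin lee_fin sum_inv_sqr_le.
have intS : P.-integrable setT (fun w => \sum_(0 <= j <oo) (X j w)%:E)%E.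
  apply/integrableP; split.
    by apply: ge0_emeasurable_sum => // j _; exact/measurable_EFinP.
  apply: le_lt_trans (ltry (2 * c)); apply: le_trans sumX.
  rewrite le_eqVlt; apply/orP; left; apply/eqP; apply: eq_integral => w _.
  by rewrite gee0_abs // nneseries_ge0.
apply: filterS (integrable_ae measurableT intS) => w /(_ I) Sfin.
have cvgN : cvgn (fun j => M (N j) w).
  have : cvgn (series (fun j => M (N j.+1) w - M (N j) w)).
    apply: normed_cvg; apply: nondecreasing_is_cvgn.
      by apply: nondecreasing_series => j *; exact: normr_ge0.
    exists (fine (\sum_(0 <= j <oo) (X j w)%:E)) => _ [n _ <-].
    rewrite -lee_fin fineK // /series /= -sumEFin.
    by apply: nneseries_lim_ge.
  rewrite (_ : series _ = fun j => M (N j) w - M (N 0%N) w).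
    move=> h; have -> : (fun j => M (N j) w) =
        (fun j => (M (N j) w - M (N 0%N) w) + M (N 0%N) w).
      by apply/funext => j; rewrite subrK.
    by apply: is_cvgD h _; exact: is_cvg_cst.
  by apply/funext => j; rewrite /series /= telescope_sumr.
have /cvg_ex[/= L NL] := cvgN.
apply/cvg_ex; exists L; apply/cvgrPdist_le => e e0.
have e20 : 0 < e / 2 by rewrite divr_gt0.
have /cvgrPdist_le/(_ _ e20) [J _ HJ] := NL.
(* From [j = J'] on, the oscillation bound 15 C / (j + 1) between fourth powers is at most e / 2. *)
pose D := 15 * C / (e / 2).
have D0 : 0 <= D by rewrite divr_ge0 ?mulr_ge0 // ltW.
pose J' := maxn J (Num.truncn D).+1.
exists (J'.+1 ^ 4)%N => // n /= Jn.
have [j /andP[jn nj]] := fourth_root n.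
have J'j : (J' <= j)%N.
  rewrite leqNgt; apply/negP => jJ.
  have : (j.+2 ^ 4 <= J'.+1 ^ 4)%N by rewrite leq_exp2r.
  by lia.
have Nn : (N j <= n)%N by rewrite -ltnS NS.
have -> : L - M n w = (L - M (N j) w) - (M n w - M (N j) w) by ring.
apply: le_trans (ler_normB _ _) _; rewrite [e]splitr; apply: lerD.
  by apply: HJ; apply: leq_trans J'j; rewrite leq_maxl.
apply: le_trans (incr_sum_le w Nn) _.
apply: (@le_trans _ _ ((15 * j.+1 ^ 3)%:R * (C / (N j).+1%:R))).
  rewrite ler_wpM2r ?divr_ge0 // ler_nat (leq_trans _ (fourth_powers j)) //.
  by have := NS j; lia.
rewrite NS natrM !natrX; set a : R := j.+1%:R.
have a0 : 0 < a by [].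
have -> : 15 * a ^+ 3 * (C / a ^+ 4) = 15 * C / a by field; rewrite gt_eqF.
rewrite ler_pdivrMr // -ler_pdivrMl ?divr_gt0 // mulrC -/D.
apply: le_trans (ltW (truncnS_gt D)) _; rewrite /a ler_nat.
by rewrite (leq_trans _ (leqW J'j)) // leq_maxr.
Qed.

End AlmostSure.

(** * Bounds and increments of the martingales *)

Section ChainValue.
Context {R : realType} (x : R).
Hypothesis x0 : 0 < x.

(** The ratios with exponent 1 telescope, so this equals [x + a j] as long as [j <= l]; past the
    last record it stays in [0, x]. It replaces [a j] by a martingale up to normalisation. *)
Definition chain_val l a (j : nat) : R :=
  (x + (a 0%N)%:R) * \prod_(0 <= m < j) ratio x l a 1 m.

Lemma ratio1 l a j : ratio x l a 1 j =
  if (j < l)%N then (x + (a j.+1)%:R) / (x + (a j)%:R) else x / (x + 1).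
Proof. by rewrite /ratio /rising !big_ord1 !addr0. Qed.

Lemma ratio0 l a j : ratio x l a 0 j = 1.
Proof.
by rewrite /ratio !rising0 addr0 !divff ?oner_neq0 ?gt_eqF // if_same.
Qed.

Lemma chain_val_bounded l a j : chain l a ->
  (a j)%:R <= chain_val l a j <= x + (a j)%:R.
Proof.
move=> [a0 aS].
(* The two regimes overlap at [j = l], where [a j = 0] and both describe the value x. *)
have h : ((j <= l)%N -> chain_val l a j = x + (a j)%:R) /\
         ((l <= j)%N -> 0 <= chain_val l a j <= x).
  elim: j => [|j [IH1 IH2]].
    split => [_|l0]; first by rewrite /chain_val big_geq // mulr1.
    by rewrite /chain_val big_geq // mulr1 a0 // addr0 lexx ltW.
  have vS : chain_val l a j.+1 = chain_val l a j * ratio x l a 1 j.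
    by rewrite /chain_val big_nat_recr //= mulrA.
  split => [jl|lj].
    rewrite vS IH1 ?(ltnW jl) // ratio1 jl mulrC divfK // gt_eqF //.
    by rewrite ltr_wpDr.
  rewrite leq_eqVlt in lj; case/orP: lj => [/eqP lj|lj].
    rewrite vS IH1 ?lj ?leqnSn // ratio1 -lj leqnn mulrC divfK.
      by rewrite a0 -?lj // addr0 lexx ltW.
    by rewrite gt_eqF // ltr_wpDr.
  rewrite ltnS in lj.
  have /andP[v0 vx] := IH2 lj.
  rewrite vS ratio1 ltnNge lj /=.
  have r0 : 0 <= x / (x + 1) by rewrite divr_ge0 ?addr_ge0 // ltW.
  have r1 : x / (x + 1) <= 1 by rewrite ler_pdivrMr ?mul1r ?lerDl // addr_gt0.
  by rewrite mulr_ge0 //= (le_trans _ vx) // ler_piMr.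
have [jl|lj] := leqP j l.
  by rewrite (h.1 jl) lexx lerDr ltW.
by have := h.2 (ltnW lj); rewrite a0 ?(ltnW lj) // addr0.
Qed.

(** The count [a j] moves by 0 or 1, and [chain_val] exceeds it by at most x both before and
    after. *)
Lemma chain_val_step l a i j : chain l a ->
  `|chain_val (l + (i == 0%N)) (chain_step l a i) j - chain_val l a j| <= 1 + x.
Proof.
move=> ca; have /andP[h1 h2] := chain_val_bounded j ca.
have /andP[h3 h4] := chain_val_bounded j (chain_stepP i ca).
have s0 : (a j)%:R <= (chain_step l a i j)%:R :> R by rewrite ler_nat leq_addr.
have s1 : (chain_step l a i j)%:R <= (a j)%:R + 1 :> R.
  by rewrite natr1 ler_nat /chain_step -addn1 leq_add2l leq_b1.
by rewrite ler_norml; lra.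
Qed.

Lemma chain_val_ge0 l a j : 0 <= chain_val l a j.
Proof.
apply: mulr_ge0; first by rewrite addr_ge0 // ltW.
by apply: prodr_ge0 => m _; exact: ratio_ge0.
Qed.

Lemma chain_val_le l a j : chain l a -> chain_val l a j <= x + (a 0%N)%:R.
Proof.
move=> ca; rewrite ler_piMr ?addr_ge0 ?(ltW x0) //.
apply: prodr_ile1 => m _; by rewrite ratio_ge0 ?ratio_le1.
Qed.

End ChainValue.

Section Urn.
Context {R : realType} (theta zeta : R).
Hypotheses (theta0 : 0 < theta) (zeta0 : 0 < zeta).
Local Notation mart := (mart theta zeta).

(** Exponent 1 on the centre and on the first [j] ratios of one side: these are [chain_val] divided
    by theta + zeta + n. *)
Definition martL j := mart 1 0 j (fun=> 1%N) (fun=> 0%N).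
Definition martU j := mart 0 1 j (fun=> 0%N) (fun=> 1%N).

Lemma martLE j n (s : 'S_n.+1) :
  martL j s = chain_val theta (proper_lower s) (low s) j / (theta + zeta + n%:R).
Proof.
rewrite /martL /mart /chain_val [X in _ * X]big1; last by move=> m _; exact: ratio0.
by rewrite rising0 /rising addn0 !big_ord1 !addr0 !mulr1 mulrAC.
Qed.

Lemma martUE j n (s : 'S_n.+1) :
  martU j s = chain_val zeta (proper_upper s) (upp s) j / (theta + zeta + n%:R).
Proof.
rewrite /martU /mart /chain_val [X in _ * X * _]big1; last by move=> m _; exact: ratio0.
by rewrite rising0 /rising add0n !big_ord1 !addr0 mulr1 mul1r mulrAC.
Qed.

Lemma mart_ge0 p q K e f n (s : 'S_n.+1) : 0 <= mart p q K e f s.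
Proof.
have t0 := total_gt0 theta0 zeta0 n.
rewrite /mart !mulr_ge0 ?invr_ge0 ?rising_ge0 ?addr_ge0 ?(ltW theta0) ?(ltW zeta0) //.
- by apply: prodr_ge0 => m _; exact: ratio_ge0.
- by apply: prodr_ge0 => m _; exact: ratio_ge0.
Qed.

(** The first p factors of the right side dominate those of [rising y p], the last q those of
    [rising z q]. This bounds the central factor of [mart] by 1. *)
Lemma rising_mulD (y z : R) p q : 0 <= y -> 0 <= z ->
  rising y p * rising z q <= rising (y + z) (p + q).
Proof.
move=> y0 z0; rewrite {3}/rising big_split_ord /=; apply: ler_pM.
- exact: rising_ge0.
- exact: rising_ge0.
- by apply: ler_prod => i _; rewrite addr_ge0 //= lerD2r lerDl.
- apply: ler_prod => i _; rewrite addr_ge0 //= natrD addrA lerD2r.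
  by rewrite addrAC lerDr addr_ge0.
Qed.

Lemma mart_le1 p q K e f n (s : 'S_n.+1) : mart p q K e f s <= 1.
Proof.
have t0 := total_gt0 theta0 zeta0 n.
have th := ltW theta0; have ze := ltW zeta0.
rewrite /mart; apply: mulr_ile1.
- by rewrite !mulr_ge0 ?invr_ge0 ?rising_ge0 ?addr_ge0 ?prodr_ge0 // => m _; exact: ratio_ge0.
- by apply: prodr_ge0 => m _; exact: ratio_ge0.
- apply: mulr_ile1.
  + by rewrite !mulr_ge0 ?invr_ge0 ?rising_ge0 ?addr_ge0.
  + by apply: prodr_ge0 => m _; exact: ratio_ge0.
  + rewrite ler_pdivrMr ?rising_gt0 // mul1r.
    have -> : theta + zeta + n%:R = (theta + (low s 0)%:R) + (zeta + (upp s 0)%:R).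
      by rewrite -{1}(low_upp s) natrD; ring.
    by rewrite rising_mulD // addr_ge0.
  + apply: prodr_ile1 => m _; rewrite ratio_ge0 //= ratio_le1 //; exact: low_chain.
- apply: prodr_ile1 => m _; rewrite ratio_ge0 //= ratio_le1 //; exact: upp_chain.
Qed.

(** In 2 + x, the part 1 + x is the move of the numerator, and the remaining 1 bounds v / W, the
    effect of the growing denominator. *)
Lemma div_total_incr (v v' x : R) n : 0 <= v <= theta + zeta + n%:R ->
  `|v' - v| <= 1 + x ->
  `|v' / (theta + zeta + n.+1%:R) - v / (theta + zeta + n%:R)| <= (2 + x) / n.+1%:R.
Proof.
move=> /andP[v0 vW] vv'; set W := theta + zeta + n%:R in vW *.
have W0 : 0 < W := total_gt0 theta0 zeta0 n.
have WS : theta + zeta + n.+1%:R = W + 1 by rewrite -natr1 addrA.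
have W1 : 0 < W + 1 by rewrite addr_gt0.
have nW : n.+1%:R <= W + 1 by rewrite -WS lerDr addr_ge0 // ltW.
rewrite WS.
have -> : v' / (W + 1) - v / W = ((v' - v) - v / W) / (W + 1).
  by field; rewrite !gt_eqF.
rewrite normrM [`|(W + 1)^-1|]ger0_norm ?invr_ge0 ?(ltW W1) //.
apply: ler_pM => //; first by rewrite invr_ge0 ltW.
  apply: le_trans (ler_normB _ _) _.
  have : `|v / W| <= 1.
    by rewrite ger0_norm ?divr_ge0 ?(ltW W0) // ler_pdivrMr // mul1r.
  by move: vv'; lra.
by rewrite lef_pV2 // posrE.
Qed.

Lemma total_low_upp n (s : 'S_n.+1) :
  theta + zeta + n%:R = (theta + (low s 0)%:R) + (zeta + (upp s 0)%:R).
Proof. by rewrite -{1}(low_upp s) natrD; ring. Qed.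

Lemma martL_incr j n (i : 'I_n.+2) (s : 'S_n.+1) :
  `|martL j (insertion i s) - martL j s| <= (2 + theta) / n.+1%:R.
Proof.
rewrite !martLE; apply: div_total_incr.
  rewrite chain_val_ge0 //= (le_trans (chain_val_le theta0 j (low_chain s))) //.
  by rewrite (total_low_upp s) lerDl addr_ge0 // ltW.
rewrite proper_lower_insertion.
have -> : low (insertion i s) = chain_step (proper_lower s) (low s) i.
  by apply/funext => m; rewrite low_insertion.
exact: chain_val_step (low_chain s).
Qed.

Lemma martU_incr j n (i : 'I_n.+2) (s : 'S_n.+1) :
  `|martU j (insertion i s) - martU j s| <= (2 + zeta) / n.+1%:R.
Proof.
rewrite !martUE; apply: div_total_incr.
  rewrite chain_val_ge0 //= (le_trans (chain_val_le zeta0 j (upp_chain s))) //.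
  by rewrite (total_low_upp s) lerDr addr_ge0 // ltW.
rewrite proper_upper_insertion.
have -> : upp (insertion i s) = chain_step (proper_upper s) (upp s) (n.+1 - i).
  by apply/funext => m; rewrite upp_insertion.
rewrite (_ : (i == n.+1 :> nat) = (n.+1 - i == 0)%N); last by have := ltn_ord i; lia.
exact: chain_val_step (upp_chain s).
Qed.

End Urn.

(** * Expectations and second moments along the random sequence *)

Section FiniteValued.
Context {d : measure_display} {T : measurableType d} {R : realType}.
Variables (P : probability T R) (S : finType) (X : T -> S).
Hypothesis mX : forall s, measurable (X @^-1` [set s]).

Lemma finite_valued_sum (F : S -> R) w : F (X w) = \sum_s F s * \1_(X @^-1` [set s]) w.
Proof.
rewrite (bigD1 (X w)) //= big1 ?addr0 => [|s sX].
  by rewrite indicE mem_set // mulr1.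
by rewrite indicE memNset ?mulr0 //= => Xs; rewrite Xs eqxx in sX.
Qed.

Lemma measurable_finite_valued (F : S -> R) : measurable_fun setT (F \o X).
Proof.
rewrite (_ : F \o X = fun w => \sum_s F s * \1_(X @^-1` [set s]) w); last first.
  by apply/funext => w; exact: finite_valued_sum.
apply: measurable_sum => s; apply: measurable_funM; first exact: measurable_cst.
exact: measurable_indic.
Qed.

Lemma integral_finite_valued (F : S -> R) :
  (\int[P]_w (F (X w))%:E = \sum_s (F s)%:E * P (X @^-1` [set s]))%E.
Proof.
under eq_integral do rewrite finite_valued_sum -sumEFin.
have intI s : P.-integrable setT (fun w => (\1_(X @^-1` [set s]) w)%:E).
  exact: integrable_indic.
rewrite integral_sum //; last first.
  by move=> s; under eq_fun do rewrite EFinM; exact: integrableZl.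
apply: eq_bigr => s _; under eq_integral do rewrite EFinM.
by rewrite integralZl // integral_indic // setIT.
Qed.

End FiniteValued.

Section Process.
Context {d : measure_display} {T : measurableType d} {R : realType}.
Variables (P : probability T R) (theta zeta : R) (pi : forall n : nat, T -> 'S_n).
Hypotheses (theta0 : 0 < theta) (zeta0 : 0 < zeta).
Hypothesis hpi : has_record_law P theta zeta pi.
Local Notation law := (law theta zeta).
Local Notation W n := (theta + zeta + n%:R).
Local Notation weight := (weight theta zeta).

Lemma measurable_pi n (F : 'S_n -> R) : measurable_fun setT (fun w => F (pi n w)).
Proof. by case: hpi => mpi _ _; exact: (measurable_finite_valued (mpi n)).  Qed.

Lemma expectation_pi n (F : 'S_n.+1 -> R) :
  (\int[P]_w (F (pi n.+1 w))%:E = (\sum_s F s * law s)%:E)%E.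
Proof.
case: hpi => mpi _ lpi; rewrite (integral_finite_valued P (mpi n.+1)) -sumEFin.
by apply: eq_bigr => s _; rewrite lpi.
Qed.

Lemma restriction_pi n w : restriction (pi n.+1 w) = pi n w.
Proof.
case: hpi => _ /(_ w) co _.
by rewrite (coherent_insertion n co) insertionK.
Qed.

(** The earlier permutation is the restriction of the later one, so a sum over the later one splits
    into the earlier one and the inserted rank. *)
Lemma expectation_pi2 n (H : 'S_n.+1 -> 'S_n.+2 -> R) :
  (\int[P]_w (H (pi n.+1 w) (pi n.+2 w))%:E =
   (\sum_s law s * \sum_(i < n.+2) weight n i / W n * H s (insertion i s))%:E)%E.
Proof.
under eq_integral do rewrite -restriction_pi.
rewrite (expectation_pi (fun s => H (restriction s) s)) sum_insertion.
congr EFin; apply: eq_bigr => s _; rewrite mulr_sumr; apply: eq_bigr => i _.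
by rewrite insertionK law_insertion; ring.
Qed.

Lemma law_sum n : \sum_(s : 'S_n.+1) law s = 1.
Proof.
apply: EFin_inj; have := expectation_pi (fun _ : 'S_n.+1 => 1).
rewrite /= integral_cst //= probability_setT mule1 => ->.
by congr EFin; apply: eq_bigr => s _; rewrite mul1r.
Qed.

(** Harmonicity for the insertion probabilities. As [pi n.+1] determines all earlier permutations,
    this is the martingale property for the natural filtration. *)
Definition martingale (F : forall n, 'S_n.+1 -> R) :=
  forall n (s : 'S_n.+1), \sum_(i < n.+2) weight n i / W n * F n.+1 (insertion i s) = F n s.

Lemma mart_martingale p q K e f : martingale (fun n => @mart R theta zeta p q K e f n).
Proof.
move=> n s; have W0 : W n != 0 by rewrite gt_eqF // total_gt0.
rewrite -[RHS](mulKf W0) -mart_insertion // mulr_sumr.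
by apply: eq_bigr => i _; ring.
Qed.

(** 'S_1 has one element, so the initial value is a constant; this makes all limiting moments
    explicit. *)
Lemma martingale_expectation F n : martingale F ->
  (\int[P]_w (F n (pi n.+1 w))%:E = (F 0%N (1%g))%:E)%E.
Proof.
move=> mF; elim: n => [|n IH].
  rewrite expectation_pi (eq_bigr (fun s => F 0%N 1%g * law s)).
    by rewrite -mulr_sumr law_sum mulr1.
  by move=> s _; congr (F 0%N _ * _); apply/permP => i; rewrite [LHS]ord1 [RHS]ord1.
rewrite -IH (expectation_pi2 (fun _ => F n.+1)) expectation_pi; congr EFin.
by apply: eq_bigr => s _; rewrite mF mulrC.
Qed.

Lemma factor_pi n m (F : 'S_n.+1 -> R) : (n <= m)%N ->
  exists G : 'S_m.+1 -> R, forall w, F (pi n.+1 w) = G (pi m.+1 w).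
Proof.
elim: m => [|m IH]; first by rewrite leqn0 => /eqP n0; subst n; exists F.
rewrite leq_eqVlt => /orP[/eqP nm|]; first by subst n; exists F.
rewrite ltnS => /IH[G FG]; exists (fun s => G (restriction s)) => w.
by rewrite FG restriction_pi.
Qed.

(** Orthogonality of increments: given [pi m.+1], the cross term between the next increment and the
    past one [psi] averages to 0. Each of the m - n squared increments is then bounded by the
    largest bound, C^2 / (n + 1)^2. *)
Lemma martingale_sqr F C : martingale F -> 0 <= C ->
  (forall n (i : 'I_n.+2) (s : 'S_n.+1), `|F n.+1 (insertion i s) - F n s| <= C / n.+1%:R) ->
  forall n m, (n <= m)%N ->
  (\int[P]_w ((F m (pi m.+1 w) - F n (pi n.+1 w)) ^+ 2)%:E <=
    ((m - n)%:R * C ^+ 2 / n.+1%:R ^+ 2)%:E)%E.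
Proof.
move=> mF C0 incr n; elim=> [|m IH].
  rewrite leqn0 => /eqP ->; rewrite subnn mul0r mul0r.
  under eq_integral do rewrite subrr expr0n.
  by rewrite integral0.
rewrite leq_eqVlt => /orP[/eqP <-|].
  rewrite subnn mul0r mul0r.
  under eq_integral do rewrite subrr expr0n.
  by rewrite integral0.
rewrite ltnS => nm.
have [G FG] := factor_pi (F n) nm.
pose psi s := F m s - G s.
have IH' := IH nm.
under eq_integral do rewrite FG.
rewrite (expectation_pi2 (fun s s' => (F m.+1 s' - G s) ^+ 2)).
have : (\int[P]_w ((F m (pi m.+1 w) - F n (pi n.+1 w)) ^+ 2)%:E =
   (\sum_s psi s ^+ 2 * law s)%:E)%E.
  by under eq_integral do rewrite FG; rewrite (expectation_pi (fun s => psi s ^+ 2)).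
move=> h; rewrite h lee_fin in IH'; rewrite lee_fin.
rewrite subSn // -natr1 mulrDl mulrDl mul1r.
have Cn : C ^+ 2 / n.+1%:R ^+ 2 = \sum_(s : 'S_m.+1) (C ^+ 2 / n.+1%:R ^+ 2) * law s.
  by rewrite -mulr_sumr law_sum mulr1.
apply: le_trans (lerD IH' (lexx _)); rewrite [X in _ <= _ + X]Cn -big_split /=.
apply: ler_sum => s _; rewrite -mulrDl mulrC ler_pM2r ?law_gt0 //.
apply: (@le_trans _ _ (\sum_(i < m.+2) (weight m i / W m * (C ^+ 2 / n.+1%:R ^+ 2)
   + 2 * psi s * (weight m i / W m * F m.+1 (insertion i s) - weight m i / W m * F m s)
   + weight m i / W m * psi s ^+ 2))).
  apply: ler_sum => i _.
  have -> : F m.+1 (insertion i s) - G s = (F m.+1 (insertion i s) - F m s) + psi s.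
    by rewrite /psi; ring.
  set x := _ - F m s.
  have -> : weight m i / W m * (x + psi s) ^+ 2 = weight m i / W m * x ^+ 2
   + 2 * psi s * (weight m i / W m * x) + weight m i / W m * psi s ^+ 2 by ring.
  rewrite /x -mulrBr -/x lerD2r lerD2r ler_wpM2l //.
    by rewrite divr_ge0 // ltW ?weight_gt0 ?total_gt0.
  rewrite -expr_div_n -[x ^+ 2]real_normK ?num_real // lerXn2r ?nnegrE ?divr_ge0 //.
  apply: le_trans (incr _ _ _) _; rewrite ler_wpM2l //.
  by rewrite lef_pV2 ?posrE // ler_nat.
rewrite !big_split /= -mulr_sumr sumrB mF -!mulr_suml weight_sum // divff ?gt_eqF ?total_gt0 // !mul1r.
by rewrite subrr mulr0 addr0 addrC.
Qed.

Lemma martingale_cvg F C : martingale F -> 0 <= C ->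
  (forall n (i : 'I_n.+2) (s : 'S_n.+1), `|F n.+1 (insertion i s) - F n s| <= C / n.+1%:R) ->
  {ae P, forall w, cvgn (fun n => F n (pi n.+1 w))}.
Proof.
move=> mF C0 incr; apply: (@ae_cvg_of_increments _ _ _ P (fun n w => F n (pi n.+1 w)) C).
- by move=> n; exact: measurable_pi.
- by [].
- by move=> n w; rewrite -(restriction_pi n.+1) -{1}(restrictionK (pi n.+2 w)); exact: incr.
- exact: martingale_sqr.
Qed.

Lemma martL_cvg j : {ae P, forall w, cvgn (fun n => martL theta zeta j (pi n.+1 w))}.
Proof.
apply: (@martingale_cvg (fun n s => martL theta zeta j s) (2 + theta)).
- exact: mart_martingale.
- by rewrite addr_ge0 // ltW.
- by move=> n i s; exact: martL_incr.
Qed.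

Lemma martU_cvg j : {ae P, forall w, cvgn (fun n => martU theta zeta j (pi n.+1 w))}.
Proof.
apply: (@martingale_cvg (fun n s => martU theta zeta j s) (2 + zeta)).
- exact: mart_martingale.
- by rewrite addr_ge0 // ltW.
- by move=> n i s; exact: martU_incr.
Qed.

End Process.

(** * Measures on the unit interval are determined by their moments *)

Section StepPolynomials.
Context {R : realType}.
Implicit Types (x t y u : R).

Lemma bernoulli_ge x n : 0 <= x -> 1 + n%:R * x <= (1 + x) ^+ n.
Proof.
move=> x0; elim: n => [|n IH]; first by rewrite mul0r addr0 expr0.
rewrite exprSr; apply: le_trans (ler_wpM2r _ IH); last by rewrite addr_ge0.
have : 0 <= n%:R * x ^+ 2 by rewrite mulr_ge0 // sqr_ge0.
by rewrite -natr1 -subr_ge0; congr (0 <= _); ring.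
Qed.

Lemma bernoulli_le u n : 0 <= u <= 1 -> 1 - n%:R * u <= (1 - u) ^+ n.
Proof.
move=> /andP[u0 u1]; elim: n => [|n IH]; first by rewrite mul0r subr0 expr0.
rewrite exprSr; apply: le_trans (ler_wpM2r _ IH); last by rewrite subr_ge0.
have : 0 <= n%:R * u ^+ 2 by rewrite mulr_ge0 // sqr_ge0.
by rewrite -natr1 -subr_ge0; congr (0 <= _); ring.
Qed.

(** By Bernoulli, 1 + nu is at most (1 + u)^n, and (1 - u)(1 + u) is at most 1. *)
Lemma exprB_le u n : 0 <= u <= 1 -> (1 - u) ^+ n * (1 + n%:R * u) <= 1.
Proof.
move=> /andP[u0 u1]; apply: le_trans (ler_wpM2l _ (bernoulli_ge n u0)) _.
  by rewrite exprn_ge0 // subr_ge0.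
rewrite -exprMn (_ : (1 - u) * (1 + u) = 1 - u ^+ 2); last by ring.
by rewrite exprn_ile1 // ?subr_ge0 ?exprn_ile1 // gerBl sqr_ge0.
Qed.

(** Maps [0, 1] into itself; when [a] and [b] grow in the right proportion it tends pointwise to a
    step function. *)
Definition step_poly (a b : nat) : {poly R} := 1 - (1 - 'X^a) ^+ b.

Lemma horner_step_poly a b t : (step_poly a b).[t] = 1 - (1 - t ^+ a) ^+ b.
Proof. by rewrite /step_poly !(hornerE, horner_exp). Qed.

Lemma step_poly01 a b t : 0 <= t <= 1 -> 0 <= (step_poly a b).[t] <= 1.
Proof.
move=> /andP[t0 t1]; rewrite horner_step_poly.
have h0 : 0 <= 1 - t ^+ a by rewrite subr_ge0 exprn_ile1.
have h1 : 1 - t ^+ a <= 1 by rewrite gerBl exprn_ge0.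
by rewrite subr_ge0 exprn_ile1 //= gerBl exprn_ge0.
Qed.

(* Of order y^-(2n) / n, so that the threshold times t^(2n) tends to 0 for t <= y and
   to infinity for t > y. *)
Definition threshold (y : R) (n : nat) : nat :=
  Num.truncn ((y ^+ (n.+1).*2)^-1 / n.+1%:R).

(** With u = t^(2(n+1)) and b the threshold: for t <= y, including t = y, the value is at most b u
    <= 1 / (n + 1); for t > y its distance to 1 is at most 1 / (1 + b u), and b u tends to
    infinity. *)
Lemma step_poly_cvg y t : 0 < y -> 0 <= t <= 1 ->
  (step_poly (n.+1).*2 (threshold y n)).[t] @[n --> \oo] --> (if y < t then 1 else 0 : R).
Proof.
move=> y0 /andP[t0 t1].
have yn n : 0 < y ^+ n by rewrite exprn_gt0.
have u01 n : 0 <= t ^+ (n.+1).*2 <= 1 by rewrite exprn_ge0 //= exprn_ile1.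
have B0 n : 0 <= (y ^+ (n.+1).*2)^-1 / n.+1%:R by rewrite divr_ge0 // invr_ge0 ltW.
case: ltP => [yt|ty].
  pose e := t / y - 1.
  have e0 : 0 < e by rewrite subr_gt0 ltr_pdivlMr ?mul1r.
  apply: (@squeeze_cvgr _ _ _ _ (fun n => 1 - (e ^+ 2)^-1 * harmonic n) (cst 1)).
  - near=> n; have /andP[_ ->] := step_poly01 (n.+1).*2 (threshold y n) (introT andP (conj t0 t1)).
    rewrite andbT horner_step_poly lerD2l lerN2 /harmonic /=.
    set u := t ^+ _; set b := threshold y n.
    (* The doubled exponent gives the square of (1 + e)^(n+1), at least ((n + 1) e)^2, which beats
       the division by n + 1. The spare 1 pays for truncation. *)
    have ub : n.+1%:R * e ^+ 2 <= 1 + b%:R * u.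
      have /andP[_ bgt] := truncn_itv (B0 n).
      have bge : (y ^+ (n.+1).*2)^-1 / n.+1%:R - 1 <= b%:R.
        by rewrite lerBlDr natr1 ltW.
      have /andP[ule0 ule1] := u01 n.
      apply: (@le_trans _ _ (1 + ((y ^+ (n.+1).*2)^-1 / n.+1%:R - 1) * u)); last first.
        by rewrite lerD2l ler_wpM2r.
      have -> : 1 + ((y ^+ (n.+1).*2)^-1 / n.+1%:R - 1) * u =
        (1 - u) + ((t / y) ^+ n.+1) ^+ 2 / n.+1%:R.
        by rewrite -exprM muln2 expr_div_n -/u; ring.
      rewrite -[leLHS]add0r lerD ?subr_ge0 // ler_pdivlMr //.
      rewrite (_ : n.+1%:R * _ * _ = (n.+1%:R * e) ^+ 2); last by ring.
      have ne : 0 <= n.+1%:R * e by rewrite mulr_ge0 // ltW.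
      rewrite lerXn2r ?nnegrE ?exprn_ge0 ?divr_ge0 ?(ltW y0) //.
      have -> : t / y = 1 + e by rewrite /e; ring.
      by apply: le_trans (bernoulli_ge n.+1 (ltW e0)); rewrite lerDr.
    have h := exprB_le b (u01 n).
    have ne0 : 0 < n.+1%:R * e ^+ 2 by rewrite mulr_gt0 // exprn_gt0.
    rewrite -invfM mulrC -[leRHS]mul1r ler_pdivlMr //.
    apply: le_trans h; rewrite ler_wpM2l // exprn_ge0 // subr_ge0.
    by case/andP: (u01 n).
  - rewrite -[X in _ --> X]subr0; apply: cvgB; first exact: cvg_cst.
    rewrite -[X in _ --> X](mulr0 ((e ^+ 2)^-1)); apply: cvgMr; exact: cvg_harmonic.
  - exact: cvg_cst.
apply: (@squeeze_cvgr _ _ _ _ (cst 0) harmonic).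
- near=> n; have /andP[-> _] := step_poly01 (n.+1).*2 (threshold y n) (introT andP (conj t0 t1)).
  rewrite horner_step_poly /= lerBlDr -lerBlDl.
  apply: le_trans (bernoulli_le (threshold y n) (u01 n)).
  rewrite lerD2l lerN2 /harmonic /=.
  have /andP[ble _] := truncn_itv (B0 n).
  apply: (@le_trans _ _ ((y ^+ (n.+1).*2)^-1 / n.+1%:R * t ^+ (n.+1).*2)).
    by rewrite ler_wpM2r // exprn_ge0.
  rewrite mulrAC ler_piMl ?invr_ge0 // mulrC ler_pdivrMr ?mul1r //.
  by rewrite lerXn2r ?nnegrE ?(ltW y0).
- exact: cvg_cst.
- exact: cvg_harmonic.
Unshelve. all: by end_near.
Qed.

Lemma step_poly_cvg0 t : 0 <= t <= 1 ->
  (step_poly 1 n).[t] @[n --> \oo] --> (if 0 < t then 1 else 0 : R).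
Proof.
move=> /andP[t0 t1].
rewrite (_ : (fun n => _) = fun n => 1 - (1 - t) ^+ n); last first.
  by apply/funext => n; rewrite horner_step_poly expr1.
case: ltP => [tp|tn].
  rewrite -[X in _ --> X]subr0; apply: cvgB; first exact: cvg_cst.
  by apply: cvg_expr; rewrite ger0_norm ?subr_ge0 // gtrBl.
have -> : t = 0 by apply/eqP; rewrite eq_le tn.
rewrite (_ : (fun n => _) = cst 0); first exact: cvg_cst.
by apply/funext => n; rewrite subr0 expr1n subrr.
Qed.

Lemma indic_poly_cvg y : exists2 p : nat -> {poly R},
  (forall n t, 0 <= t <= 1 -> 0 <= (p n).[t] <= 1) &
  (forall t, 0 <= t <= 1 -> (p n).[t] @[n --> \oo] --> (\1_(`]y, +oo[) t : R)).
Proof.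
have ind t : (\1_(`]y, +oo[) t : R) = if y < t then 1 else 0.
  by rewrite indicE; case: ltP => h; [rewrite mem_set|rewrite memNset] => //=;
    rewrite in_itv /= andbT ?h //; apply/negP; rewrite -leNgt.
have [y0|y0|y0] := ltgtP y 0.
- exists (fun=> 1) => [n t _|t /andP[t0 _]]; first by rewrite hornerC ler01 lexx.
  by rewrite ind (lt_le_trans y0 t0) (_ : (fun n => _) = cst 1); [exact: cvg_cst|];
    apply/funext => n; rewrite /= hornerC.
- exists (fun n => step_poly (n.+1).*2 (threshold y n)) => [n t|t t01].
    exact: step_poly01.
  by rewrite ind; exact: step_poly_cvg.
- exists (fun n => step_poly 1 n) => [n t|t t01]; first exact: step_poly01.
  by rewrite ind y0; exact: step_poly_cvg0.
Qed.

End StepPolynomials.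

(** * Image measures with a density and their moments *)

Section WeightedMeasure.
Context {R : realType} {d d' : measure_display}.
Context {T : measurableType d} {T' : measurableType d'}.
Variables (mu : {measure set T -> \bar R}) (D : set T) (X : T -> T') (g : T -> R).
Hypotheses (mD : measurable D) (mX : measurable_fun D X) (mg : measurable_fun D g).
Hypothesis g0 : forall x, D x -> 0 <= g x.

(** Image under [X] of the measure with density [g] on [D]. This covers the law of a random variable
    (g = 1), the beta law (X the identity), and the law of one coordinate weighted by the others. *)
Definition weighted_law (A : set T') : \bar R :=
  (\int[mu]_(x in D `&` X @^-1` A) (g x)%:E)%E.

Lemma weighted_law0 : weighted_law set0 = 0%E.
Proof. by rewrite /weighted_law preimage_set0 setI0 integral_set0. Qed.

Lemma weighted_law_ge0 A : (0 <= weighted_law A)%E.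
Proof. by apply: integral_ge0 => x [Dx _]; rewrite lee_fin g0. Qed.

Lemma weighted_law_sigma_additive : semi_sigma_additive weighted_law.
Proof.
move=> F mF tF mUF; rewrite /weighted_law preimage_bigcup setI_bigcupr.
rewrite ge0_integral_bigcup //.
- by apply: is_cvg_ereal_nneg_natsum => n _; exact: weighted_law_ge0.
- by move=> k; exact: mX.
- apply/measurable_EFinP; apply: measurable_funS mg => //.
  by move=> x [k _ []].
- by move=> x [k _ [Dx _]]; rewrite lee_fin g0.
- apply/trivIsetP => i j _ _ ij; rewrite setIACA setIid -preimage_setI.
  by move/trivIsetP : tF => ->//; rewrite preimage_set0 setI0.
Qed.

Definition weighted_measure : {measure set T' -> \bar R} :=
  HB.pack weighted_law (isMeasure.Build _ _ R weighted_law
    weighted_law0 weighted_law_ge0 weighted_law_sigma_additive).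

End WeightedMeasure.

Section Weighted.
Context {R : realType}.

Definition weighted d (T : measurableType d) (mu : {measure set T -> \bar R})
    (D : set T) (X g : T -> R) : Prop :=
  [/\ measurable D, measurable_fun D X, mu.-integrable D (EFin \o g),
      (forall x, D x -> 0 <= X x <= 1) & (forall x, D x -> 0 <= g x)].

Section OneSide.
Context {d : measure_display} {T : measurableType d}.
Variables (mu : {measure set T -> \bar R}) (D : set T) (X g : T -> R).
Hypothesis w : weighted mu D X g.

Let mD : measurable D. Proof. by case: w. Qed.
Let mX : measurable_fun D X. Proof. by case: w. Qed.
Let mg : measurable_fun D g.
Proof. by case: w => _ _ /measurable_int /measurable_EFinP. Qed.
Let X01 x : D x -> 0 <= X x <= 1. Proof. by case: w => _ _ _ + _; exact. Qed.
Let g0 x : D x -> 0 <= g x. Proof. by case: w => _ _ _ _; exact. Qed.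

Lemma weighted_integrable (f : T -> R) : measurable_fun D f ->
  (forall x, D x -> `|f x| <= 1) ->
  mu.-integrable D (fun x => (g x * f x)%:E).
Proof.
case: w => _ _ ig _ _ mf f1; apply: le_integrable ig => //.
  by apply/measurable_EFinP; exact: measurable_funM.
move=> x Dx /=; rewrite lee_fin normrM.
by rewrite ler_piMr // f1.
Qed.

Lemma weighted_integrable_exp n : mu.-integrable D (fun x => (g x * X x ^+ n)%:E).
Proof.
apply: weighted_integrable => [|x Dx]; first exact: measurable_funX.
have /andP[x0 x1] := X01 Dx.
by rewrite ger0_norm ?exprn_ge0 // exprn_ile1.
Qed.

Lemma weighted_poly (p : {poly R}) :
  (\int[mu]_(x in D) (g x * p.[X x])%:E =
   \sum_(i < size p) (p`_i)%:E * \int[mu]_(x in D) (g x * X x ^+ i)%:E)%E.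
Proof.
transitivity (\int[mu]_(x in D) \sum_(i < size p) ((p`_i)%:E * (g x * X x ^+ i)%:E))%E.
  apply: eq_integral => x _; rewrite horner_coef mulr_sumr -sumEFin.
  by apply: eq_bigr => i _; rewrite -EFinM; congr EFin; ring.
rewrite integral_sum // => [|i]; last by apply: integrableZl => //; exact: weighted_integrable_exp.
by apply: eq_bigr => i _; rewrite integralZl //; exact: weighted_integrable_exp.
Qed.

Lemma weighted_indic (E : set R) : measurable E ->
  (\int[mu]_(x in D `&` X @^-1` E) (g x)%:E =
   \int[mu]_(x in D) (g x * \1_E (X x))%:E)%E.
Proof.
move=> mE; rewrite integral_mkcondr; apply: eq_integral => x _.
rewrite patchE indicE; case: ifPn => xE.
  by rewrite mem_set ?mulr1 //; rewrite inE in xE.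
by rewrite memNset ?mulr0 //; apply: contraNnot xE; rewrite inE.
Qed.

Lemma weighted_limit (p : nat -> {poly R}) (f : R -> R) :
  measurable_fun setT f ->
  (forall n t, 0 <= t <= 1 -> 0 <= (p n).[t] <= 1) ->
  (forall t, 0 <= t <= 1 -> (p n).[t] @[n --> \oo] --> f t) ->
  (\int[mu]_(x in D) (g x * (p n).[X x])%:E @[n --> \oo] -->
   \int[mu]_(x in D) (g x * f (X x))%:E)%E.
Proof.
move=> mf p01 pf.
have mpn n : measurable_fun D (fun x => (p n).[X x]).
  rewrite (_ : (fun x => _) = fun x => \sum_(i < size (p n)) (p n)`_i * X x ^+ i).
    apply: measurable_sum => i; apply: measurable_funM; first exact: measurable_cst.
    exact: measurable_funX.
  by apply/funext => x; rewrite horner_coef.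
have [] := @dominated_convergence _ _ _ mu D mD
  (fun n x => (g x * (p n).[X x])%:E) (fun x => (g x * f (X x))%:E) (EFin \o g); last by [].
- by move=> n; apply/measurable_EFinP; exact: measurable_funM.
- apply/measurable_EFinP; apply: measurable_funM => //.
  exact: (measurable_comp (F := setT)).
- apply: aeW => x Dx; apply: cvg_EFin; first exact: nearW.
  by apply: cvgM; [exact: cvg_cst|exact/pf/X01].
- by case: w.
- apply: aeW => x n Dx; rewrite lee_fin normrM ger0_norm ?g0 //.
  have /andP[p0 p1] := p01 n _ (X01 Dx).
  by rewrite ler_piMr ?g0 // ger0_norm.
Qed.

End OneSide.

(** Equal moments give equal integrals of polynomials in X, hence by dominated convergence equal
    masses of the rays ]y, +oo[, which form a generating pi-system. The two sides may live on
    different spaces, so that a law can be compared with a Lebesgue density. *)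
Lemma weighted_unique d (T : measurableType d) (mu : {measure set T -> \bar R})
    (D : set T) (X g : T -> R) d' (T' : measurableType d')
    (mu' : {measure set T' -> \bar R}) (D' : set T') (X' g' : T' -> R) :
  weighted mu D X g -> weighted mu' D' X' g' ->
  (forall n, \int[mu]_(x in D) (g x * X x ^+ n)%:E =
             \int[mu']_(x in D') (g' x * X' x ^+ n)%:E)%E ->
  forall A, measurable A ->
  (\int[mu]_(x in D `&` X @^-1` A) (g x)%:E =
   \int[mu']_(x in D' `&` X' @^-1` A) (g' x)%:E)%E.
Proof.
move=> w w' mom A mA.
have [mD mX ig _ g0] := w; have [mD' mX' ig' _ g0'] := w'.
have mg : measurable_fun D g by move/measurable_int/measurable_EFinP : ig.
have mg' : measurable_fun D' g' by move/measurable_int/measurable_EFinP : ig'.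
pose m := weighted_measure mu mD mX mg g0.
pose m' := weighted_measure mu' mD' mX' mg' g0'.
suff : m A = m' A by [].
apply: (measure_unique (@RGenOInfty.G R) (fun k => `]- k%:R, +oo[%classic)) => //.
- exact: RGenOInfty.measurableE.
- move=> _ _ [x ->] [y ->]; exists (Num.max x y).
  by apply/seteqP; split=> t /=; rewrite !in_itv /= !andbT gt_max => /andP.
- by move=> k; exists (- k%:R).
- apply/seteqP; split=> // t _; exists (Num.truncn `|t|).+1 => //=.
  rewrite in_itv /= andbT ltrNl; apply: le_lt_trans (truncnS_gt _).
  by rewrite -normrN ler_norm.
- move=> _ [y ->]; rewrite /m /m' /= /weighted_law.
  rewrite !weighted_indic //.
  have [p p01 pf] := @indic_poly_cvg R y.
  have mI : measurable_fun setT (\1_(`]y, +oo[) : R -> R) by exact: measurable_indic.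
  have h := weighted_limit w mI p01 pf; have h' := weighted_limit w' mI p01 pf.
  have E : (fun n => \int[mu]_(x in D) (g x * (p n).[X x])%:E)%E =
           (fun n => \int[mu']_(x in D') (g' x * (p n).[X' x])%:E)%E.
    apply/funext => n; rewrite (weighted_poly w) (weighted_poly w').
    by apply: eq_bigr => i _; rewrite mom.
  by rewrite E in h; exact: cvg_unique h h'.
- move=> k; rewrite /m /= /weighted_law; apply: integrable_lty.
    exact: (mX mD _ (measurable_itv _)).
  by apply: integrableS ig => //; exact: (mX mD _ (measurable_itv _)).
Qed.

End Weighted.

(** * Beta integrals *)

Section Affine.
Context {R : realType}.
Local Notation leb := (@lebesgue_measure R).

Lemma measurable_affine (c b : R) : measurable_fun [set: R] (fun x : R => c * x + b).
Proof.
apply: measurable_funD; last exact: measurable_cst.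
by apply: measurable_funM => //; exact: measurable_cst.
Qed.

(** Lebesgue measure is determined by its values on the intervals ]p, q], and c times its image
    under x |-> c x + b has the same values. *)
Lemma integral_affine (c b : R) (f : R -> \bar R) : 0 < c ->
  measurable_fun setT f -> (forall x, (0 <= f x)%E) ->
  (\int[leb]_x f x = c%:E * \int[leb]_x f (c * x + b)%R)%E.
Proof.
move=> c0 mf f0.
pose phi : measurableTypeR R -> measurableTypeR R := fun x : R => c * x + b.
have mphi : measurable_fun setT phi by exact: measurable_affine.
pose k := NngNum (ltW c0).
have mE A : measurable A -> leb A = mscale k (pushforward leb phi) A.
  move=> mA; apply/lebesgue_measure_unique => //= _ [[p q] _ <-] /=.
  rewrite /mscale /=.
  have -> : pushforward leb phi `]p, q] = leb `](p - b) / c, (q - b) / c].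
    rewrite /pushforward; congr (leb _).
    apply/seteqP; split=> x /=; rewrite !in_itv /= /phi ltr_pdivrMr // ler_pdivlMr //;
    by rewrite ltrBlDr lerBrDr mulrC.
  rewrite !lebesgue_measure_itv /= !lte_fin ltr_pM2r ?invr_gt0 // ltrD2r.
  case: ifP => _; last by rewrite mule0.
  rewrite -!EFinB -EFinM; congr EFin; field.
  by rewrite gt_eqF.
rewrite (eq_measure_integral (mscale k (pushforward leb phi))) => [|A mA _].
  by rewrite ge0_integral_mscale //= ge0_integral_pushforward.
exact: mE.
Qed.

End Affine.

Section GammaBeta.
Context {R : realType}.
Local Notation leb := (@lebesgue_measure R).

Lemma integral_indicM (D : set R) (f : R -> R) :
  (\int[leb]_(x in D) (f x)%:E = \int[leb]_x (f x * \1_D x)%:E)%E.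
Proof.
rewrite integral_mkcond; apply: eq_integral => x _; rewrite patchE indicE.
by case: ifPn => _; rewrite ?mulr1 ?mulr0.
Qed.

(** The integrands are extended by 0 to the whole line, so that substitution and Tonelli apply
    without tracking domains; the integrals are extended reals, so that identities can precede
    finiteness. *)
Definition gamma_ker (a x : R) : R := x `^ (a - 1) * expR (- x) * \1_(`]0, +oo[) x.
Definition beta_ker (a b x : R) : R :=
  x `^ (a - 1) * (1 - x) `^ (b - 1) * \1_(`]0, 1[) x.
Definition eGamma (a : R) : \bar R := (\int[leb]_x (gamma_ker a x)%:E)%E.
Definition eBeta (a b : R) : \bar R := (\int[leb]_x (beta_ker a b x)%:E)%E.

Lemma gamma_ker_ge0 a x : 0 <= gamma_ker a x.
Proof. by rewrite /gamma_ker !mulr_ge0 ?powR_ge0 ?expR_ge0 // indicE. Qed.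

Lemma beta_ker_ge0 a b x : 0 <= beta_ker a b x.
Proof. by rewrite /beta_ker !mulr_ge0 ?powR_ge0 // indicE. Qed.

Lemma measurable_gamma_ker a : measurable_fun setT (gamma_ker a).
Proof.
apply: measurable_funM; last exact: measurable_indic.
apply: measurable_funM; first exact: measurable_powR.
by apply: measurableT_comp => //; exact: measurable_funN.
Qed.

Lemma measurable_beta_ker a b : measurable_fun setT (beta_ker a b).
Proof.
apply: measurable_funM; last exact: measurable_indic.
apply: measurable_funM; first exact: measurable_powR.
apply: (measurableT_comp (measurable_powR _)).
by apply: measurable_funB.
Qed.

Lemma gamma_kerE a x : 0 < x -> gamma_ker a x = x `^ (a - 1) * expR (- x).
Proof. by move=> x0; rewrite /gamma_ker indicE mem_set ?mulr1 //= in_itv /= x0. Qed.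

Lemma gamma_ker_le0 a x : x <= 0 -> gamma_ker a x = 0.
Proof.
move=> x0; rewrite /gamma_ker indicE memNset ?mulr0 //=.
by rewrite in_itv /= andbT; apply/negP; rewrite -leNgt.
Qed.

Lemma beta_kerE a b x : 0 < x < 1 -> beta_ker a b x = x `^ (a - 1) * (1 - x) `^ (b - 1).
Proof. by move=> x0; rewrite /beta_ker indicE mem_set ?mulr1 //= in_itv /= x0. Qed.

Lemma beta_ker_out a b x : ~~ (0 < x < 1) -> beta_ker a b x = 0.
Proof.
move=> x0; rewrite /beta_ker indicE memNset ?mulr0 //=.
by rewrite in_itv /=; exact/negP.
Qed.

Lemma GammaE a : Gamma a = fine (eGamma a).
Proof. by rewrite /Gamma /Rintegral integral_indicM. Qed.

(* Substitute y = t - x in the product of the two Gamma integrals, exchange the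
   integrals, then substitute x = t u. *)
Lemma eGammaM a b : (eGamma a * eGamma b = eBeta a b * eGamma (a + b))%E.
Proof.
have mg c : measurable_fun setT (fun x => (gamma_ker c x)%:E).
  by apply/measurable_EFinP; exact: measurable_gamma_ker.
have g0 c x : (0 <= (gamma_ker c x)%:E)%E by rewrite lee_fin gamma_ker_ge0.
have G0 c : (0 <= eGamma c)%E by apply: integral_ge0.
transitivity (\int[leb]_x \int[leb]_t (gamma_ker a x * gamma_ker b (t - x))%:E)%E.
  rewrite muleC {2}/eGamma -ge0_integralZl //; last exact: mg.
  apply: eq_integral => x _; rewrite muleC /eGamma.
  rewrite [X in (_ * X)%E](integral_affine (- x) ltr01) // mul1e.
  have mgx := measurableT_comp (mg b) (measurable_affine 1 (- x)).
  rewrite -ge0_integralZl //.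
  by apply: eq_integral => t _; rewrite mul1r.
pose f (z : R * R) := (gamma_ker a z.1 * gamma_ker b (z.2 - z.1))%:E.
have mf : measurable_fun setT f.
  apply/measurable_EFinP; apply: measurable_funM.
    by apply: (measurableT_comp (measurable_gamma_ker a)).
  apply: (measurableT_comp (measurable_gamma_ker b)).
  by apply: measurable_funB.
have f0 z : (0 <= f z)%E by rewrite lee_fin mulr_ge0 // gamma_ker_ge0.
rewrite (@fubini_tonelli _ _ (measurableTypeR R) (measurableTypeR R) R leb leb f mf f0) /=.
rewrite muleC {1}/eGamma -ge0_integralZr //; last 2 first.
- exact: mg.
- by apply: integral_ge0 => x _; rewrite lee_fin beta_ker_ge0.
apply: eq_integral => t _; rewrite /f /=; have [t0|t0] := leP t 0.
  rewrite gamma_ker_le0 // mul0e integral0_eq // => x _.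
  have [x0|x0] := leP x 0; first by rewrite gamma_ker_le0 // mul0r.
  by rewrite (@gamma_ker_le0 b) ?mulr0 // subr_le0 (le_trans t0) // ltW.
have mb : measurable_fun setT (fun x => (beta_ker a b x)%:E).
  by apply/measurable_EFinP; exact: measurable_beta_ker.
have b0 x : (0 <= (beta_ker a b x)%:E)%E by rewrite lee_fin beta_ker_ge0.
have mt : measurable_fun setT (fun x : R => (gamma_ker a x * gamma_ker b ((t : R) - x))%:E).
  apply/measurable_EFinP; apply: measurable_funM; first exact: measurable_gamma_ker.
  by apply: (measurableT_comp (measurable_gamma_ker b)); apply: measurable_funB.
rewrite (integral_affine 0 t0) //; last by move=> x; rewrite lee_fin mulr_ge0 // gamma_ker_ge0.
rewrite /eBeta -ge0_integralZl //; first last.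
- by rewrite lee_fin ltW.
- by move=> x _; rewrite lee_fin mulr_ge0 // gamma_ker_ge0.
- exact: (measurableT_comp mt (measurable_affine t 0)).
rewrite -ge0_integralZl //.
apply: eq_integral => u _; rewrite -!EFinM addr0; congr EFin.
have [/andP[u0 u1]|u01] := boolP (0 < u < 1).
  have tu : 0 < t * u by rewrite mulr_gt0.
  have tu1 : t - t * u = t * (1 - u) by ring.
  have u1' : 0 < 1 - u by rewrite subr_gt0.
  rewrite beta_kerE ?u0 // tu1 !gamma_kerE ?mulr_gt0 //.
  rewrite !powRM ?(ltW t0) ?(ltW u0) ?(ltW u1') //.
  have -> : t `^ (a + b - 1) = t * (t `^ (a - 1) * t `^ (b - 1)).
    have tn : t != 0 by rewrite gt_eqF.
    rewrite (_ : a + b - 1 = 1 + ((a - 1) + (b - 1))); last by ring.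
    rewrite (@powRD _ t 1) ?tn ?implybT // powRr1 ?(ltW t0) //.
    by rewrite (@powRD _ t (a - 1)) ?tn ?implybT.
  rewrite (_ : expR (- t) = expR (- (t * u)) * expR (- (t * (1 - u)))); last first.
    by rewrite -expRD; congr expR; ring.
  by ring.
rewrite beta_ker_out // mulr0; move: u01; rewrite negb_and -!leNgt => /orP[u0|u1].
  by rewrite gamma_ker_le0 ?mul0r ?mulr0 // pmulr_rle0.
by rewrite (@gamma_ker_le0 b) ?mulr0 ?mule0 // subr_le0 ler_peMr // ltW.
Qed.

(** The integrand x^(a - 1) may be singular at 0: the fundamental theorem of calculus is applied on
    [1 / (n + 1), 1], then n tends to infinity. *)
Lemma eBeta_1r a : 0 < a -> eBeta a 1 = (a^-1)%:E.
Proof.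
move=> a0; rewrite /eBeta.
have -> : (\int[leb]_x (beta_ker a 1 x)%:E = \int[leb]_(x in `]0%R, 1%R]) (x `^ (a - 1))%:E)%E.
  rewrite -integral_itv_bndo_bndc.
    rewrite [RHS]integral_indicM; apply: eq_integral => x _.
    by rewrite /beta_ker subrr powRr0 mulr1.
  by apply/measurable_EFinP; apply: measurable_funTS; exact: measurable_powR.
pose F n : set R := `[n.+1%:R^-1, 1]%classic.
have FE : \bigcup_n F n = `]0, 1]%classic.
  apply/seteqP; split=> x; rewrite /F /= in_itv /=.
    move=> [n _]; rewrite /= in_itv /= => /andP[nx ->]; rewrite andbT.
    by apply: lt_le_trans nx; rewrite invr_gt0.
  move=> /andP[x0 x1]; exists (Num.truncn x^-1) => //=.
  rewrite in_itv /= x1 andbT invf_ple ?posrE //.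
  by rewrite ltW // truncnS_gt.
have mp n : measurable_fun (F n) (fun x => (x `^ (a - 1))%:E).
  by apply/measurable_EFinP; apply: measurable_funTS; exact: measurable_powR.
have h := @ge0_nondecreasing_set_cvg_integral _ (measurableTypeR R) R F (fun x => (x `^ (a - 1))%:E) leb.
have {}h : (\int[leb]_(x in F n) (x `^ (a - 1))%:E @[n --> \oo] -->
    \int[leb]_(x in `]0%R, 1%R]) (x `^ (a - 1))%:E)%E.
  rewrite -FE; apply: h => //.
  - move=> n m nm; apply/subsetPset => x; rewrite /F /= !in_itv /= => /andP[nx ->].
    by rewrite andbT (le_trans _ nx) // lef_pV2 ?posrE // ler_nat.
  - by move=> n; exact: measurable_itv.
  - by move=> n x _; rewrite lee_fin powR_ge0.
(* The index is shifted because [F 0] is the single point 1. *)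
have Fn n : (\int[leb]_(x in F n.+1) (x `^ (a - 1))%:E =
    (a^-1 - a^-1 * (n.+2%:R^-1) `^ a)%:E)%E.
  have n0 : 0 < n.+2%:R^-1 :> R by rewrite invr_gt0.
  have n1 : n.+2%:R^-1 < 1 :> R by rewrite invf_lt1 // ltr1n.
  have pos x : n.+2%:R^-1 <= x -> x \in `]0, +oo[.
    by move=> nx; rewrite in_itv /= andbT; exact: lt_le_trans nx.
  have dF x : n.+2%:R^-1 <= x -> derivable (fun x => a^-1 * x `^ a) x 1.
    by move=> nx; apply: derivableM => //; apply: derivable_powR; exact: pos.
  have cF x : n.+2%:R^-1 <= x -> {for x, continuous (fun x : R => a^-1 * x `^ a)}.
    by move=> nx; apply/differentiable_continuous/derivable1_diffP; exact: dF.
  rewrite (@continuous_FTC2 _ _ (fun x => a^-1 * x `^ a)) //.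
  - by rewrite powR1 mulr1 -EFinB.
  - apply: derivable_within_continuous => x; rewrite in_itv /= => /andP[nx _].
    by apply: derivable_powR; exact: pos.
  - split.
    + by move=> x; rewrite in_itv /= => /andP[/ltW nx _]; exact: dF.
    + by apply: cvg_at_right_filter; exact: cF.
    + by apply: cvg_at_left_filter; apply: cF; exact: ltW.
  - move=> x; rewrite in_itv /= => /andP[/ltW nx _].
    rewrite derive1Ml; last by apply: derivable_powR; exact: pos.
    rewrite powR_derive1; last exact: pos.
    by rewrite mulrA mulVf ?mul1r // gt_eqF.
rewrite -cvg_shiftS (_ : [sequence _]_n = EFin \o (fun n => a^-1 - a^-1 * (n.+2%:R^-1) `^ a)) in h; last first.
  by apply/funext => n; exact: Fn.
apply: (cvg_unique _ h) => //.
apply: cvg_EFin; first exact: nearW.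
rewrite -[X in _ --> X]subr0; apply: cvgB; first exact: cvg_cst.
rewrite -[X in _ --> X](mulr0 a^-1); apply: cvgMr.
have /cvg_at_rightP := powR_cvg0 a0.
apply; split => //.
by have := @cvg_harmonic R; rewrite -cvg_shiftS.
Qed.


End GammaBeta.

Section BetaMoments.
Context {R : realType}.
Local Notation leb := (@lebesgue_measure R).
Implicit Types a b : R.

Lemma eGamma1 : eGamma (1 : R) = 1%E.
Proof.
transitivity (\int[leb]_(x in `]0%R, +oo[) (expR (- x))%:E)%E.
  rewrite integral_indicM; apply: eq_integral => x _.
  by rewrite /gamma_ker subrr powRr0 mul1r.
rewrite integral_itv_obnd_cbnd; last first.
  apply/measurable_EFinP; apply: measurable_funTS.
  by apply: measurableT_comp => //; exact: measurable_funN.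
rewrite -(@integral_exponential_pdf R 1 ltr01) integral_indicM.
apply: eq_integral => x _; rewrite /exponential_pdf patchE indicE.
by case: ifPn => _; rewrite ?mulr0 // mulr1 mul1r mulN1r.
Qed.

Lemma eGamma_ge0 a : (0 <= eGamma a)%E.
Proof. by apply: integral_ge0 => x _; rewrite lee_fin gamma_ker_ge0. Qed.

(** The case b = 1 of [eGammaM], where the beta integral is 1 / a; this replaces integration by
    parts. *)
Lemma eGammaS a : 0 < a -> eGamma (a + 1) = (a%:E * eGamma a)%E.
Proof.
move=> a0; have := eGammaM a 1; rewrite eGamma1 mule1 eBeta_1r // => ->.
by rewrite muleA -EFinM divff ?mul1e // gt_eqF.
Qed.

Lemma eGamma_nat n : (eGamma (n.+1%:R : R) < +oo)%E.
Proof.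
elim: n => [|n IH]; first by rewrite eGamma1 ltry.
rewrite -natr1 eGammaS // lte_mul_pinfty // lee_fin.
Qed.

(** For a + 1 the integrand is dominated through x^a <= 1 + x^n by those of Gamma at 1 and n + 1.
    The functional equation then descends to [a], which avoids the singularity at 0. *)
Lemma eGamma_lty a : 0 < a -> (eGamma a < +oo)%E.
Proof.
move=> a0.
have mg c : measurable_fun setT (fun x => (gamma_ker c x)%:E).
  by apply/measurable_EFinP; exact: measurable_gamma_ker.
have g0 c x : (0 <= (gamma_ker c x)%:E)%E by rewrite lee_fin gamma_ker_ge0.
suff h : (eGamma (a + 1) < +oo)%E.
  have -> : eGamma a = (a^-1%:E * eGamma (a + 1))%E.
    by rewrite eGammaS // muleA -EFinM mulVf ?mul1e // gt_eqF.
  by rewrite lte_mul_pinfty // lee_fin invr_ge0 ltW.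
have [n an] : exists n : nat, a <= n%:R.
  by exists (Num.truncn a).+1; rewrite ltW // truncnS_gt.
apply: (@le_lt_trans _ _ (eGamma 1 + eGamma (n.+1%:R))%E); last first.
  by apply: lte_add_pinfty; [rewrite eGamma1 ltry|exact: eGamma_nat].
rewrite /eGamma -ge0_integralD //; [|exact: mg|exact: mg].
apply: ge0_le_integral => //; [exact: mg|apply: emeasurable_funD; exact: mg|].
move=> x _; rewrite -EFinD lee_fin.
have [x0|x0] := leP x 0; first by rewrite !gamma_ker_le0 // addr0.
rewrite !gamma_kerE // -mulrDl ler_wpM2r ?expR_ge0 //.
rewrite subrr powRr0 -natr1 !addrK.
have [x1|x1] := leP x 1.
  apply: (@le_trans _ _ 1); last by rewrite lerDl powR_ge0.
  rewrite -[leRHS](powRr0 x); apply: ger_powR; rewrite ?x0 // ltW //.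
apply: (@le_trans _ _ (x `^ n%:R)); last by rewrite lerDr.
by apply: ler_powR; rewrite // ltW.
Qed.

Lemma eGamma_gt0 a : (0 < eGamma a)%E.
Proof.
have mg : measurable_fun setT (fun x => (gamma_ker a x)%:E).
  by apply/measurable_EFinP; exact: measurable_gamma_ker.
(* On [1, 2] the power x^(a - 1) is monotone, so its minimum is attained at an endpoint, whatever
   the sign of a - 1. *)
pose c : R := Num.min 1 (2 `^ (a - 1)) * expR (- 2).
have c0 : 0 < c by rewrite mulr_gt0 ?expR_gt0 // lt_min ltr01 powR_gt0.
apply: (@lt_le_trans _ _ (\int[leb]_(x in `[1%R, 2%R]) c%:E)%E).
  rewrite integral_cst //= lebesgue_measure_itv /= lte_fin ltr1n /=.
  by rewrite -EFinB -EFinM lte_fin mulr_gt0 // subr_gt0 ltr1n.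
apply: (@le_trans _ _ (\int[leb]_(x in `[1%R, 2%R]) (gamma_ker a x)%:E)%E); last first.
  apply: ge0_subset_integral => //.
  by move=> x _; rewrite lee_fin gamma_ker_ge0.
apply: ge0_le_integral => //.
- by move=> x _; rewrite lee_fin ltW.
- exact: measurable_funTS.
- move=> x /=; rewrite in_itv /= => /andP[x1 x2]; rewrite lee_fin.
  have x0 : 0 < x by rewrite (lt_le_trans ltr01).
  rewrite gamma_kerE // ler_pM ?expR_ge0 ?le_min ?ler01 ?powR_ge0 //.
    rewrite ge_min; have [a1|a1] := leP 0 (a - 1).
      have := ge0_ler_powR a1 (ler01 : 1 \in Num.nneg) (ltW x0 : x \in Num.nneg) x1.
      by rewrite powR1 => ->.
    have b0 : 0 <= - (a - 1) by rewrite oppr_ge0 ltW.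
    apply/orP; right; rewrite -[a - 1]opprK; move: (- (a - 1)) b0 => b b0.
    rewrite !powRN lef_pV2 ?posrE ?powR_gt0 //.
    exact: (ge0_ler_powR b0 (ltW x0 : x \in Num.nneg) (ler0n R 2 : 2 \in Num.nneg) x2).
  by rewrite ler_expR lerN2.
Qed.

Lemma eGamma_fin a : 0 < a -> eGamma a = (Gamma a)%:E.
Proof.
move=> a0; rewrite GammaE fineK // ge0_fin_numE ?eGamma_lty //; exact: eGamma_ge0.
Qed.

Lemma Gamma_gt0 a : 0 < a -> 0 < Gamma a.
Proof. by move=> a0; rewrite -lte_fin -eGamma_fin // eGamma_gt0. Qed.

Lemma Gamma_rising a n : 0 < a -> Gamma (a + n%:R) = rising a n * Gamma a.
Proof.
move=> a0; elim: n => [|n IH]; first by rewrite addr0 rising0 mul1r.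
have an : 0 < a + n%:R by rewrite ltr_wpDr.
apply: EFin_inj; rewrite -eGamma_fin ?ltr_wpDr // -natr1 addrA eGammaS //.
by rewrite eGamma_fin // IH risingSr -EFinM; congr EFin; ring.
Qed.

Lemma eBetaE a b : 0 < a -> 0 < b ->
  eBeta a b = (Gamma a * Gamma b / Gamma (a + b))%:E.
Proof.
move=> a0 b0; have ab : 0 < a + b by rewrite addr_gt0.
have g : Gamma (a + b) != 0 by rewrite gt_eqF // Gamma_gt0.
have := eGammaM a b; rewrite !eGamma_fin // -EFinM => h.
by rewrite EFinM h -muleA -EFinM divff // mule1.
Qed.

(** The factor x^n raises the first parameter to a + n, so the moment is a quotient of beta
    functions. *)
Lemma beta_density_moment a b n : 0 < a -> 0 < b ->
  (\int[leb]_(x in `[0%R, 1%R]) (beta_density a b x * x ^+ n)%:E =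
   (rising a n / rising (a + b) n)%:E)%E.
Proof.
move=> a0 b0.
have an : 0 < a + n%:R by rewrite ltr_wpDr.
set c := Gamma (a + b) / (Gamma a * Gamma b).
transitivity (\int[leb]_x (c%:E * (beta_ker (a + n%:R) b x)%:E))%E.
  (* The endpoints, where the powers take conventional values, form a null set. *)
  rewrite integral_itv_bndoo; last first.
    apply/measurable_EFinP; apply: measurable_funTS.
    apply: measurable_funM; last exact: measurable_funX.
    apply: measurable_funM; last exact: measurable_cst.
    apply: measurable_funM; first exact: measurable_powR.
    apply: (measurableT_comp (measurable_powR _)); exact: measurable_funB.
  rewrite integral_indicM; apply: eq_integral => x _.
  have [x01|x01] := boolP (0 < x < 1); last first.
    rewrite beta_ker_out // mule0 indicE memNset ?mulr0 //=.
    by rewrite in_itv /=; exact/negP.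
  rewrite beta_kerE // -EFinM indicE mem_set ?mulr1 //=.
  case/andP: x01 => x0 x1.
  rewrite /beta_density -/c (_ : a + n%:R - 1 = (a - 1) + n%:R); last by ring.
  rewrite (@powRD _ x (a - 1) n%:R) ?(gt_eqF x0) ?implybT // powR_mulrn ?(ltW x0) //.
  by congr EFin; ring.
rewrite ge0_integralZl //; last 3 first.
- by apply/measurable_EFinP; exact: measurable_beta_ker.
- by move=> x _; rewrite lee_fin beta_ker_ge0.
- by rewrite lee_fin divr_ge0 ?mulr_ge0 ?ltW // Gamma_gt0 // addr_gt0.
rewrite -/(eBeta _ _) eBetaE // -EFinM /c; congr EFin.
rewrite -addrA (addrC n%:R) addrA !Gamma_rising ?addr_gt0 //.
have ab : 0 < a + b by rewrite addr_gt0.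
by field; rewrite !gt_eqF // ?Gamma_gt0 ?rising_gt0.
Qed.

Lemma weighted_beta a b : 0 < a -> 0 < b ->
  weighted leb `[0, 1]%classic idfun (beta_density a b).
Proof.
move=> a0 b0; have ab : 0 < a + b by rewrite addr_gt0.
have d0 x : 0 <= beta_density a b x.
  by rewrite /beta_density !mulr_ge0 ?powR_ge0 ?invr_ge0 ?mulr_ge0 ?ltW ?Gamma_gt0.
split => //.
- exact: measurable_id.
- apply/integrableP; split.
    apply/measurable_EFinP; apply: measurable_funTS.
    apply: measurable_funM; last exact: measurable_cst.
    apply: measurable_funM; first exact: measurable_powR.
    apply: (measurableT_comp (measurable_powR _)); exact: measurable_funB.
  under eq_integral => x _ do rewrite /= ger0_norm // -[beta_density a b x]mulr1 -(expr0 x).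
  by rewrite beta_density_moment // ltry.
Qed.

Lemma beta_law_of_moments d (T : measurableType d) (P : probability T R)
    (X : {RV P >-> R}) a b : 0 < a -> 0 < b -> (forall w, 0 <= X w <= 1) ->
  (forall n, \int[P]_w (X w ^+ n)%:E = (rising a n / rising (a + b) n)%:E)%E ->
  has_beta_law P X a b.
Proof.
move=> a0 b0 X01 mom A mA.
have wX : weighted P setT X (cst 1).
  by split => //; exact: finite_measure_integrable_cst.
have := weighted_unique wX (weighted_beta a0 b0) _ mA.
rewrite setTI preimage_id /= integral_cst; last first.
  by rewrite -[X in measurable X]setTI; exact: measurable_funP.
rewrite mul1e setIC; apply => n.
rewrite beta_density_moment // -mom.
by apply: eq_integral => w _; rewrite mul1r.
Qed.

End BetaMoments.

(** * Independence and conditional independence *)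

Section IndependenceFromMoments.
Context {d : measure_display} {T : measurableType d} {R : realType}.
Variables (P : probability T R) (I : choiceType) (Y : I -> {RV P >-> R}).
Hypothesis Y01 : forall i w, 0 <= Y i w <= 1.
Variable m : I -> nat -> R.
Hypothesis mE : forall i n, (\int[P]_w (Y i w ^+ n)%:E = (m i n)%:E)%E.
Hypothesis joint : forall (J : seq I) (e : I -> nat), uniq J ->
  (\int[P]_w (\prod_(i <- J) Y i w ^+ e i)%:E = (\prod_(i <- J) m i (e i))%:E)%E.

Let mpre i B : measurable B -> measurable (Y i @^-1` B).
Proof. by move=> mB; rewrite -[X in measurable X]setTI; exact: measurable_funP. Qed.

(* The indicators replace the powers one coordinate at a time. *)
Lemma joint_indic (B : I -> set R) (J1 J2 : seq I) (e : I -> nat) :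
  (forall i, measurable (B i)) -> uniq (J1 ++ J2) ->
  (\int[P]_w ((\prod_(i <- J1) \1_(B i) (Y i w)) * (\prod_(i <- J2) Y i w ^+ e i))%:E =
   ((\prod_(i <- J1) fine (P (Y i @^-1` B i))) * (\prod_(i <- J2) m i (e i)))%:E)%E.
Proof.
move=> mB; elim: J1 J2 e => [|i J1 IH] J2 e.
  move=> uJ; under eq_integral do rewrite big_nil mul1r.
  by rewrite joint // big_nil mul1r.
rewrite /= => /andP[iJ uJ].
have iJ1 : i \notin J1 by move: iJ; rewrite mem_cat negb_or => /andP[].
have iJ2 : i \notin J2 by move: iJ; rewrite mem_cat negb_or => /andP[].
(* All other coordinates together form a weight [g]. The law of [Y i] weighted by [g] and [c] times
   its law have the same moments, hence they coincide. *)
pose g w := (\prod_(k <- J1) \1_(B k) (Y k w)) * (\prod_(k <- J2) Y k w ^+ e k).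
pose c := (\prod_(k <- J1) fine (P (Y k @^-1` B k))) * (\prod_(k <- J2) m k (e k)).
have m0 k n : 0 <= m k n.
  rewrite -lee_fin -mE; apply: integral_ge0 => w _; rewrite lee_fin exprn_ge0 //.
  by case/andP: (Y01 k w).
have c0 : 0 <= c.
  by apply: mulr_ge0; apply: prodr_ge0 => k _ //; rewrite fine_ge0.
have mg : measurable_fun setT g.
  apply: measurable_funM; apply: measurable_prod => k _.
    apply: (measurableT_comp (measurable_indic _)) => //.
  by apply: measurable_funX.
have g01 w : 0 <= g w <= 1.
  have h1 k : 0 <= (\1_(B k) (Y k w) : R) <= 1 by rewrite indicE; case: (_ \in _); rewrite ?lexx ler01.
  have h2 k : 0 <= Y k w ^+ e k <= 1.
    by have /andP[y0 y1] := Y01 k w; rewrite exprn_ge0 // exprn_ile1.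
  rewrite mulr_ge0 /=; [|by apply: prodr_ge0 => k _; case/andP: (h1 k)
                        |by apply: prodr_ge0 => k _; case/andP: (h2 k)].
  by apply: mulr_ile1; rewrite ?prodr_ge0 ?prodr_ile1 // => k _; case/andP: (h1 k) (h2 k) => ? ? /andP[].
have w1 : weighted P setT (Y i) g.
  split => //; last by move=> w _; case/andP: (g01 w).
 apply: (@le_integrable _ _ _ P setT measurableT (EFin \o g) (EFin \o cst 1)) => //.
  - exact/measurable_EFinP.
  - by move=> w _ /=; have /andP[g0 g1] := g01 w; rewrite lee_fin ger0_norm // normr1.
  - exact: finite_measure_integrable_cst.
have w2 : weighted P setT (Y i) (cst c).
  by split => //; exact: finite_measure_integrable_cst.
have mom n : (\int[P]_w (g w * Y i w ^+ n)%:E = \int[P]_w (cst c w * Y i w ^+ n)%:E)%E.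
  pose e' k := if k == i then n else e k.
  have e'E (F : I -> nat -> R) : \prod_(k <- i :: J2) F k (e' k) =
      F i n * \prod_(k <- J2) F k (e k).
    rewrite big_cons /e' eqxx; congr (_ * _); rewrite big_seq_cond [RHS]big_seq_cond.
    by apply: eq_bigr => k /andP[kJ _]; case: eqP kJ iJ2 => // -> ->.
  have uJ' : uniq (J1 ++ i :: J2).
    by rewrite -cat1s uniq_catCA /= iJ.
  have := IH (i :: J2) e' uJ'; rewrite (e'E m).
  under eq_integral => w _ do rewrite (e'E (fun k n => Y k w ^+ n)) mulrCA mulrC.
  move=> ->; under eq_integral do rewrite /= EFinM.
  rewrite ge0_integralZl //; first by rewrite mE -EFinM; congr EFin; rewrite /c; ring.
  - apply/measurable_EFinP; exact: measurable_funX.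
  - by move=> w _; rewrite lee_fin exprn_ge0 //; case/andP: (Y01 i w).
have := weighted_unique w1 w2 mom (mB i).
rewrite (weighted_indic P setT _ _ (mB i)) setTI /= integral_cst; last exact: mpre.
move=> h; rewrite [in RHS]big_cons -mulrA -/c EFinM fineK ?fin_num_measure //; last exact: mpre.
rewrite muleC -h; apply: eq_integral => w _; rewrite big_cons /g; congr EFin.
by ring.
Qed.

Lemma indep_of_moments : mutually_independent P Y.
Proof.
move=> J B uJ mB.
have := @joint_indic B J [::] (fun=> 0%N) mB; rewrite cats0 big_nil mulr1 => /(_ uJ) h.
transitivity (\int[P]_w (\prod_(i <- J) \1_(B i) (Y i w))%:E)%E.
  have mbig : measurable (\bigcap_(i in [set` J]) Y i @^-1` B i).
    by apply: fin_bigcap_measurable => // i _; exact: mpre.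
  rewrite -[X in P X = _]setIT -integral_indic //; apply: eq_integral => w _; congr EFin.
  rewrite indicE; case: (boolP (w \in _)) => [|wn].
    rewrite inE => wJ; rewrite big_seq big1 // => i iJ; rewrite indicE mem_set //.
    exact: wJ.
  have [i iJ iB] : exists2 i, i \in J & ~ B i (Y i w).
    apply: contrapT => h'; move: wn; rewrite notin_setE; apply => i /= iJ.
    by apply: contrapT => nB; apply: h'; exists i.
  by rewrite (big_rem i) //= indicE memNset // mul0r.
under eq_integral do rewrite -[X in X%:E]mulr1.
have -> : (\int[P]_x (\prod_(i <- J) \1_(B i) (Y i x) * 1)%:E =
  \int[P]_x (\prod_(i <- J) \1_(B i) (Y i x) * \prod_(i <- [::]) Y i x ^+ 0)%:E)%E.
  by apply: eq_integral => w _; rewrite big_nil.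
rewrite h -prodEFin; apply: eq_bigr => i _.
by rewrite fineK // fin_num_measure //; exact: mpre.
Qed.

End IndependenceFromMoments.

(** * From independent variables to independent sigma-algebras *)

Section PiSystem.
Context {d : measure_display} {T : measurableType d} {R : realType}.

Lemma pi_system_unique (G : set (set T)) (m1 m2 : {measure set T -> \bar R}) :
  G `<=` measurable -> setI_closed G -> G setT -> (m1 setT < +oo)%E ->
  (forall A, G A -> m1 A = m2 A) -> forall A, <<s G >> A -> m1 A = m2 A.
Proof.
move=> mG GI GT fin eqG A sA.
apply: (@g_sigma_algebra_measure_unique _ _ _ G mG (fun=> setT)) => //.
by rewrite bigcup_const //; exists 0%N.
Qed.

Lemma sigma_measurable (G : set (set T)) :
  G `<=` measurable -> <<s G >> `<=` measurable.
Proof. by move=> mG; apply: smallest_sub => //; exact: sigma_algebra_measurable. Qed.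

End PiSystem.

Section Cylinders.
Context {d : measure_display} {T : measurableType d} {R : realType}.
Variables (P : probability T R) (I : choiceType) (Y : I -> {RV P >-> R}).

Let mpre i B : measurable B -> measurable (Y i @^-1` B).
Proof. by move=> mB; rewrite -[X in measurable X]setTI; exact: measurable_funP. Qed.

Definition cylinder (K : set I) : set (set T) :=
  [set A | exists (J : seq I) (B : I -> set R),
    [/\ forall i, i \in J -> K i, forall i, measurable (B i)
      & A = \bigcap_(i in [set` J]) Y i @^-1` B i]].

Lemma cylinder_setT K : cylinder K setT.
Proof. by exists [::], (fun=> setT); split => //; rewrite set_nil bigcap_set0. Qed.

Lemma cylinder_preimage (K : set I) i B : K i -> measurable B ->
  cylinder K (Y i @^-1` B).
Proof.
move=> Ki mB; exists [:: i], (fun=> B); split => // [j|].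
  by rewrite inE => /eqP ->.
by rewrite set_cons1 bigcap_set1.
Qed.

Lemma cylinder_measurable K : cylinder K `<=` measurable.
Proof.
move=> _ [J [B [_ mB ->]]]; apply: fin_bigcap_measurable => // i _; exact: mpre.
Qed.

(** Filling up with [setT] puts both families on one index list; duplicates are removed because
    independence is stated for [uniq] lists. *)
Lemma cylinder_cat (J1 J2 : seq I) (B1 B2 : I -> set R) :
  (\bigcap_(i in [set` J1]) Y i @^-1` B1 i) `&`
  (\bigcap_(i in [set` J2]) Y i @^-1` B2 i) =
  \bigcap_(i in [set` undup (J1 ++ J2)]) Y i @^-1`
    ((if i \in J1 then B1 i else setT) `&` (if i \in J2 then B2 i else setT)).
Proof.
apply/seteqP; split => [w [h1 h2] i _|w h].
  split; case: ifP => //; [exact: h1|exact: h2].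
split=> i /= iJ.
- have [] := h i; first by rewrite /= mem_undup mem_cat iJ.
  by rewrite iJ.
- have [] := h i; first by rewrite /= mem_undup mem_cat iJ orbT.
  by rewrite iJ.
Qed.

Lemma cylinder_setI K : setI_closed (cylinder K).
Proof.
move=> _ _ [J1 [B1 [K1 mB1 ->]]] [J2 [B2 [K2 mB2 ->]]].
rewrite cylinder_cat; eexists; eexists; split; last by [].
- by move=> i; rewrite mem_undup mem_cat => /orP[/K1|/K2].
- by move=> i; apply: measurableI; case: ifP.
Qed.

Hypothesis ind : mutually_independent P Y.

Lemma cylinder_indep K1 K2 A B : K1 `&` K2 = set0 ->
  cylinder K1 A -> cylinder K2 B -> P (A `&` B) = (P A * P B)%E.
Proof.
move=> K12 [J1 [B1 [KJ1 mB1 AE]]] [J2 [B2 [KJ2 mB2 BE]]].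
pose S (J : seq I) (B' : I -> set R) i := if i \in J then B' i else setT.
have mS J B' i : (forall i, measurable (B' i)) -> measurable (S J B' i).
  by rewrite /S; case: ifP.
have PJ (J : seq I) B' : (forall i, measurable (B' i)) ->
    P (\bigcap_(i in [set` J]) Y i @^-1` B' i) =
    (\prod_(i <- undup J) P (Y i @^-1` B' i))%E.
  move=> mB'; rewrite (_ : [set` J] = [set` undup J]) ?ind ?undup_uniq //.
  by apply/seteqP; split => i /=; rewrite mem_undup.
rewrite AE BE cylinder_cat ind ?undup_uniq //; last first.
  by move=> i; apply: measurableI; exact: mS.
have disj i : i \in J1 -> i \in J2 -> False.
  by move=> /KJ1 k1 /KJ2 k2; have : (K1 `&` K2) i by []; rewrite K12.
have -> : undup (J1 ++ J2) = undup J1 ++ undup J2.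
  rewrite undup_cat; congr (_ ++ _); apply/all_filterP/allP => i.
  by rewrite mem_undup => iJ1; apply/negP => /(disj _ iJ1).
rewrite big_cat /= !PJ //; congr (_ * _)%E; rewrite big_seq [RHS]big_seq;
  apply: eq_bigr => i; rewrite mem_undup => iJ.
- rewrite iJ; case: ifP => [/(disj _ iJ)//|_]; by rewrite setIT.
- rewrite iJ; case: ifP => [/disj/(_ iJ)//|_]; by rewrite setTI.
Qed.

(** For fixed D, the measures P(E [&] D) and P(E) P(D) of E agree on a pi-system, hence on the
    sigma-algebra it generates. Applied once for each side. *)
Lemma sigma_indep K1 K2 A B : K1 `&` K2 = set0 ->
  <<s cylinder K1 >> A -> <<s cylinder K2 >> B -> P (A `&` B) = (P A * P B)%E.
Proof.
move=> K12 sA sB.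
have mc K := @cylinder_measurable K.
have mA : measurable A := sigma_measurable (mc K1) sA.
have mB : measurable B := sigma_measurable (mc K2) sB.
have k0 C : 0 <= fine (P C) by rewrite fine_ge0.
have PE C : measurable C -> P C = (fine (P C))%:E by move=> mC; rewrite fineK // fin_num_measure.
have step K D E : measurable D -> <<s cylinder K >> E ->
    (forall C, cylinder K C -> P (C `&` D) = (P C * P D)%E) ->
    P (E `&` D) = (P E * P D)%E.
  move=> mD sE h.
  have := @pi_system_unique _ T R (cylinder K) (mrestr P mD) (mscale (NngNum (k0 D)) P)
    (mc K) (@cylinder_setI K) (cylinder_setT K) _ _ E sE.
  rewrite [X in _ -> _ -> _ = X](_ : _ = ((fine (P D))%:E * P E)%E) // -PE // muleC; apply.
  - exact: le_lt_trans (probability_le1 P (measurableI _ _ measurableT mD)) (ltry 1).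
  - move=> C KC; transitivity ((fine (P D))%:E * P C)%E; last by [].
    by rewrite -PE // muleC; exact: h.
apply: (step K1) => // C KC.
rewrite setIC muleC; apply: (step K2) => //; first exact: mc KC.
by move=> D KD; rewrite setIC muleC; exact: (cylinder_indep K12).
Qed.

End Cylinders.

(** * Conditional probabilities given a random variable *)

Section ConditionalIndependence.
Import HBNNSimple.
Context {d : measure_display} {T : measurableType d} {R : realType}.
Variables (P : probability T R) (X : {RV P >-> R}).

Let mX : measurable_fun setT X. Proof. exact: measurable_funP. Qed.

Let mpre B : measurable B -> measurable (X @^-1` B).
Proof. by move=> mB; rewrite -[X in measurable X]setTI; exact: mX. Qed.

Lemma integral_sfun_weight (g : T -> R) (h : {nnsfun R >-> R}) :
  measurable_fun setT g -> (forall w, 0 <= g w) ->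
  (\int[P]_w (h (X w) * g w)%:E =
   \sum_(y \in range h) y%:E * \int[P]_(w in X @^-1` (h @^-1` [set y])) (g w)%:E)%E.
Proof.
move=> mg g0.
have mh y : measurable (h @^-1` [set y]).
  by rewrite -[X in measurable X]setTI; exact: measurable_funP.
have m1 y : measurable_fun setT (fun w => (\1_(h @^-1` [set y]) (X w) : R)).
  exact: (measurableT_comp (measurable_indic _)).
transitivity (\int[P]_w \sum_(y \in range h)
    (y%:E * (g w * \1_(h @^-1` [set y]) (X w))%:E))%E.
  apply: eq_integral => w _; rewrite {1}(fimfunE h) mulr_fsuml -fsumEFin //.
  by apply: eq_fsbigr => y _; rewrite -EFinM; congr EFin; ring.
rewrite ge0_integral_fsum //; last 2 first.
- move=> y; apply: emeasurable_funM; first exact: measurable_cst.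
  by apply/measurable_EFinP; exact: measurable_funM.
- move=> y w _; rewrite -EFinM lee_fin indicE; case: (boolP (_ \in _)) => [|_].
    by rewrite inE /= => <-; rewrite mulr1 mulr_ge0.
  by rewrite !mulr0.
apply: eq_fsbigr => y; rewrite inE => -[x _ <-].
rewrite ge0_integralZl //; last 3 first.
- by apply/measurable_EFinP; exact: measurable_funM.
- by move=> w _; rewrite lee_fin mulr_ge0 // indicE.
- by rewrite lee_fin.
by rewrite -[in RHS](setTI (X @^-1` _)) weighted_indic.
Qed.

(** Weights with the same conditional expectation given X are interchangeable against functions of
    X. The proof passes from simple functions to [h] by monotone convergence; the lemma serves to
    replace an indicator by its conditional probability. *)
Lemma weight_ext (g1 g2 : T -> R) (h : R -> R) :
  measurable_fun setT g1 -> measurable_fun setT g2 ->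
  (forall w, 0 <= g1 w) -> (forall w, 0 <= g2 w) ->
  (forall C, measurable C ->
     \int[P]_(w in X @^-1` C) (g1 w)%:E = \int[P]_(w in X @^-1` C) (g2 w)%:E)%E ->
  measurable_fun setT h -> (forall x, 0 <= h x) ->
  (\int[P]_w (h (X w) * g1 w)%:E = \int[P]_w (h (X w) * g2 w)%:E)%E.
Proof.
move=> mg1 mg2 g10 g20 g12 mh h0.
have mEh : measurable_fun setT (EFin \o h) by exact/measurable_EFinP.
pose h_ := nnsfun_approx measurableT mEh.
have lim_h (g : T -> R) : measurable_fun setT g -> (forall w, 0 <= g w) ->
    (\int[P]_w (h_ n (X w) * g w)%:E @[n --> \oo] --> \int[P]_w (h (X w) * g w)%:E)%E.
  move=> mg g0.
  have -> : (\int[P]_w (h (X w) * g w)%:E =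
      \int[P]_w limn (fun n => (h_ n (X w) * g w)%:E))%E.
    apply: eq_integral => w _; apply/esym/cvg_lim => //.
    apply: cvg_EFin; first exact: nearW.
    apply: cvgM; last exact: cvg_cst.
    have := @cvg_nnsfun_approx _ _ _ _ measurableT _ mEh (fun x _ => h0 x) (X w) I.
    by move/fine_cvgP => [_].
  apply: cvg_monotone_convergence => //.
  - move=> n; apply/measurable_EFinP; apply: measurable_funM => //.
    exact: (measurableT_comp (measurable_funP (h_ n))).
  - by move=> n w _; rewrite lee_fin mulr_ge0.
  - move=> w _ m n mn; rewrite lee_fin ler_wpM2r //.
    exact/lefP/nd_nnsfun_approx.
have h1 := lim_h g1 mg1 g10; have h2 := lim_h g2 mg2 g20.
have E : (fun n => \int[P]_w (h_ n (X w) * g1 w)%:E)%E = (fun n => \int[P]_w (h_ n (X w) * g2 w)%:E)%E.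
  apply/funext => n; rewrite !integral_sfun_weight //.
  by apply: eq_fsbigr => y _; rewrite g12.
by rewrite E in h1; exact: cvg_unique h1 h2.
Qed.

(* The Radon-Nikodym derivative of C |-> P(A `&` X^-1 C) with respect to the law
   of X. *)
Lemma cond_prob_exists A : measurable A ->
  exists2 f : R -> R, (forall x, 0 <= f x) & is_cond_prob P X A f.
Proof.
move=> mA.
have m1 : measurable_fun setT (\1_A : T -> R) by exact: measurable_indic.
have i0 w : setT w -> 0 <= (\1_A w : R) by [].
pose nu0 := weighted_measure P measurableT mX m1 i0.
have nuE C : measurable C -> nu0 C = P (A `&` X @^-1` C).
  by move=> mC; rewrite /nu0 /= /weighted_law setTI integral_indic //; exact: mpre.
have fin0 : fin_num_fun nu0.
  move=> C mC; rewrite nuE // fin_num_measure //.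
  by apply: measurableI => //; exact: mpre.
have sig0 : sigma_finite setT nu0.
  by apply: fin_num_fun_sigma_finite; [rewrite measure0|exact: fin0].
have sfin0 : sfinite_measure nu0 by exact: sfinite_measure_sigma_finite.
pose H1 := isFinite.Build _ _ _ _ fin0.
pose H2 := isSFinite.Build _ _ _ _ sfin0.
pose H3 := isSigmaFinite.Build _ _ _ _ sig0.
pose nu := HB.pack_for (FiniteMeasure.type R R) (Measure.sort nu0) H1 H2 H3.
pose mu : probability R R := distribution P X.
have dom : nu `<< mu.
  apply/null_content_dominatesP => C mC muC; apply/eqP; rewrite eq_le measure_ge0 andbT.
  have <- : mu C = 0%E := muC.
  rewrite [leLHS](nuE C mC); apply: le_measure; rewrite ?inE //.
  - by apply: measurableI => //; exact: mpre.
  - exact: mpre.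
have [f [f0 ffin intf fE]] := radon_nikodym_sigma_finite dom.
have mf : measurable_fun setT (fine \o f).
  by apply: measurableT_comp => //; exact: measurable_int intf.
have fEF x : f x = (fine (f x))%:E by rewrite fineK.
have fP C : measurable C ->
    P (A `&` X @^-1` C) = (\int[P]_(w in X @^-1` C) ((fine \o f) (X w))%:E)%E.
  move=> mC; rewrite -nuE // [LHS](fE C mC).
  rewrite ge0_integral_pushforward //; last first.
    by apply: measurable_funTS; exact: measurable_int intf.
  by apply: eq_integral => w _; rewrite /= -fEF.
exists (fine \o f); first by move=> x; rewrite fine_ge0.
split => //.
apply/integrableP; split.
  by apply/measurable_EFinP; exact: measurableT_comp.
have -> : (\int[P]_w `|((fine \o f) (X w))%:E| = P (A `&` X @^-1` setT))%E.
  rewrite fP // preimage_setT; apply: eq_integral => w _.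
  by rewrite gee0_abs // lee_fin fine_ge0.
by rewrite preimage_setT setIT ltey_eq fin_num_measure.
Qed.

(* It suffices to integrate over the events X^-1 C `&` D, on which D factors
   out. *)
Lemma cond_independent_of_pi_system (F G : set (set T)) :
  F `<=` measurable -> G `<=` measurable -> F setT -> setI_closed G -> G setT ->
  (forall A C D, F A -> measurable C -> G D ->
    P (A `&` X @^-1` C `&` D) = (P (A `&` X @^-1` C) * P D)%E) ->
  cond_independent P X F
    <<s [set B | exists C D, [/\ measurable C, G D & B = X @^-1` C `&` D]] >>.
Proof.
move=> mF mG FT GI GT ind A B FA sB.
set H := [set B | _] in sB.
have mH : H `<=` measurable.
  by move=> _ [C [D [mC GD ->]]]; apply: measurableI; [exact: mpre|exact: mG].
have HI : setI_closed H.
  move=> _ _ [C [D [mC GD ->]]] [C' [D' [mC' GD' ->]]].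
  exists (C `&` C'), (D `&` D'); split; [exact: measurableI|exact: GI|].
  by rewrite preimage_setI setIACA.
have HT : H setT by exists setT, setT; split => //; rewrite preimage_setT setIT.
have mA := mF _ FA; have mB : measurable B := sigma_measurable mH sB.
have [f f0 fA] := cond_prob_exists mA; have [g g0 gB] := cond_prob_exists mB.
have [mf intf fE] := fA; have [mg intg gE] := gB.
have mind E : measurable E -> measurable_fun setT (\1_E : T -> R).
  by move=> mE; exact: measurable_indic.
have mfX : measurable_fun setT (f \o X) by exact: measurableT_comp.
have mgX : measurable_fun setT (g \o X) by exact: measurableT_comp.
have key C : measurable C ->
    P (A `&` B `&` X @^-1` C) = (\int[P]_(w in X @^-1` C) (f (X w) * g (X w))%:E)%E.
  move=> mC; pose h x : R := f x * \1_C x.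
  have mh : measurable_fun setT h.
    by apply: measurable_funM => //; exact: measurable_indic.
  have h0 x : 0 <= h x by rewrite mulr_ge0 // indicE.
  have mhX : measurable_fun setT (h \o X) by exact: measurableT_comp.
  have hX0 w : setT w -> 0 <= (h \o X) w by move=> _; exact: h0.
  have mAC : measurable (A `&` X @^-1` C) by apply: measurableI => //; exact: mpre.
  have hE E : (\int[P]_(w in E) (h (X w))%:E = \int[P]_w (h (X w) * \1_E w)%:E)%E.
    rewrite integral_mkcond; apply: eq_integral => w _; rewrite patchE indicE.
    by case: ifPn => _; rewrite ?mulr1 ?mulr0.
  have hC C2 : measurable C2 ->
      (\int[P]_(w in X @^-1` C2) (h (X w))%:E = P (A `&` X @^-1` (C `&` C2)))%E.
    move=> mC2; rewrite fE; last exact: measurableI.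
    rewrite preimage_setI setIC integral_mkcondr; apply: eq_integral => w _.
    rewrite patchE /h indicE; case: (boolP (w \in _)) => [|wC].
      by rewrite inE => wC; rewrite mem_set ?mulr1.
    by rewrite memNset ?mulr0 //; apply: contraNnot wC => wC; rewrite inE.
  (* The point is that [f (X w)] remains the conditional probability of A given the larger
     sigma-algebra generated by H: the mass of B within A [&] X^-1 C and the integral of h(X) over B
     are measures in B that agree on H. *)
  pose m2 := weighted_measure P measurableT (@measurable_id _ T setT) mhX hX0.
  have m12 : mrestr P mAC B = m2 B.
    apply: (@pi_system_unique _ T R H) sB => //.
    - exact: le_lt_trans (probability_le1 P (measurableI _ _ measurableT mAC)) (ltry 1).
    - move=> _ [C2 [D [mC2 GD ->]]]; rewrite /m2 /= /weighted_law setTI preimage_id.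
      have mD := mG _ GD.
      have mXC : measurable (X @^-1` C2) := mpre mC2.
      transitivity (P (A `&` X @^-1` (C `&` C2)) * P D)%E.
        rewrite -ind //; last exact: measurableI.
        rewrite /mrestr preimage_setI; congr (P _); apply/seteqP; split=> w.
          by move=> [[? ?] [? ?]].
        by move=> [[? [? ?]] ?].
      have k0 : 0 <= fine (P D) by rewrite fine_ge0.
      have PD : P D = (fine (P D))%:E by rewrite fineK // fin_num_measure.
      pose h2 x : R := h x * \1_C2 x.
      have mh2 : measurable_fun setT h2.
        by apply: measurable_funM => //; exact: measurable_indic.
      have h20 x : 0 <= h2 x by rewrite mulr_ge0 // indicE.
      have E1 : (\int[P]_w (h2 (X w) * \1_D w)%:E =
                 \int[P]_w (h2 (X w) * (cst (fine (P D)) w : R))%:E)%E.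
        apply: weight_ext => //.
        move=> C' mC'; rewrite integral_indic //; last exact: mpre.
        rewrite /= integral_cst; last exact: mpre.
        (* With A = setT the hypothesis says that D is independent of X. *)
        have := ind setT C' D FT mC' GD; rewrite setTI setIC => ->.
        by rewrite -PD muleC.
      have ind2 w : \1_(X @^-1` C2 `&` D) w = \1_C2 (X w) * \1_D w :> R.
        by rewrite indicI.
      transitivity (\int[P]_w (h2 (X w) * \1_D w)%:E)%E; last first.
        by rewrite hE; apply: eq_integral => w _; rewrite ind2 mulrA.
      rewrite E1 -hC // hE; under [RHS]eq_integral do rewrite /= EFinM.
      rewrite ge0_integralZr -?PD //.
      + by apply/measurable_EFinP; exact: (measurableT_comp mh2).
      + by move=> w _; rewrite lee_fin.
  transitivity (m2 B).
    rewrite -m12 /mrestr; congr (P _); apply/seteqP; split=> w.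
      by move=> [[? ?] ?].
    by move=> [? [? ?]].
  rewrite /m2 /= /weighted_law setTI preimage_id hE.
  (* What multiplies the indicator of B is now a function of X, so the indicator may be replaced by
     [g (X w)]. *)
  transitivity (\int[P]_w (h (X w) * g (X w))%:E)%E.
    apply: weight_ext => //.
    move=> C' mC'; rewrite integral_indic //; last exact: mpre.
    by rewrite -gE.
  rewrite [RHS]integral_mkcond; apply: eq_integral => w _; rewrite patchE /h indicE.
  case: (boolP (w \in _)) => [|wC].
    by rewrite inE => wC; rewrite mem_set ?mulr1.
  by rewrite memNset ?mulr0 ?mul0r //; apply: contraNnot wC => wC; rewrite inE.
exists f, g; split => //; split.
- exact: measurable_funM.
- apply/integrableP; split.
    by apply/measurable_EFinP; exact: measurable_funM.
  have := key setT measurableT; rewrite preimage_setT setIT => E.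
  apply: (@le_lt_trans _ _ (P (A `&` B))); last first.
    by rewrite ltey_eq fin_num_measure //; exact: measurableI.
  rewrite E le_eqVlt; apply/orP; left; apply/eqP; apply: eq_integral => w _.
  by rewrite gee0_abs // lee_fin mulr_ge0.
- exact: key.
Qed.

End ConditionalIndependence.

(** * Limits along a path *)

Section Paths.
Context {R : realType} (x c : R) (l : nat -> nat) (a : nat -> nat -> nat).
Hypotheses (x0 : 0 < x) (c0 : 0 < c) (ca : forall n, chain (l n) (a n)).
Local Notation W n := (c + n%:R).
Local Notation v j n := (chain_val x (l n) (a n) j / W n).

Let W0 n : 0 < W n. Proof. by rewrite ltr_wpDr. Qed.

Lemma cvg_inv_total : (W n)^-1 @[n --> \oo] --> (0 : R).
Proof.
apply/cvgrPdist_le => e e0; exists (Num.truncn e^-1).+1 => // n /= en.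
rewrite sub0r normrN ger0_norm ?invr_ge0 ?(ltW (W0 n)) // invf_ple ?posrE //.
apply: le_trans (ltW (truncnS_gt e^-1)) _.
by apply: (@le_trans _ _ n%:R); rewrite ?ler_nat // lerDr ltW.
Qed.

(** [x + a n j] differs from [chain_val] by at most x, so bounded shifts disappear after division by
    W n. *)
Lemma cvg_chain j (m i : R) : v j n @[n --> \oo] --> m ->
  (x + (a n j)%:R + i) / W n @[n --> \oo] --> m.
Proof.
move=> vm.
have h k : v j n + k / W n @[n --> \oo] --> m.
  rewrite -[X in _ --> X]addr0; apply: cvgD => //.
  by rewrite -[X in _ --> X](mulr0 k); apply: cvgMr; exact: cvg_inv_total.
apply: (squeeze_cvgr _ (h i) (h (x + i))); apply: nearW => n.
have /andP[h1 h2] := chain_val_bounded x0 j (ca n).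
rewrite -!mulrDl !ler_wpM2r ?invr_ge0 ?(ltW (W0 n)) //= ?lerD2r //.
by rewrite addrA lerD2r (addrC x) lerD2r.
Qed.

Lemma cvg_prod_nat (f : nat -> nat -> R) (y : nat -> R) (e : nat) :
  (forall i, f i n @[n --> \oo] --> y i) ->
  \prod_(i < e) f i n @[n --> \oo] --> \prod_(i < e) y i.
Proof.
move=> fy; elim: e => [|e IH].
  by rewrite big_ord0; under eq_fun do rewrite big_ord0; exact: cvg_cst.
rewrite big_ord_recr /=; under eq_fun do rewrite big_ord_recr /=.
exact: cvgM.
Qed.

Lemma path_center p (m : R) : v 0 n @[n --> \oo] --> m ->
  rising (x + (a n 0%N)%:R) p / rising (W n) p @[n --> \oo] --> m ^+ p.
Proof.
move=> vm.
rewrite (_ : (fun n => _) = fun n => \prod_(i < p)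
    (((x + (a n 0%N)%:R + i%:R) / W n) / ((W n + i%:R) / W n))); last first.
  apply/funext => n; rewrite /rising -prodf_div; apply: eq_bigr => i _.
  by field; rewrite !gt_eqF // ltr_wpDr.
rewrite (_ : m ^+ p = \prod_(i < p) (m / 1)); last first.
  by rewrite divr1 prodr_const card_ord.
apply: (@cvg_prod_nat (fun i n => ((x + (a n 0%N)%:R + i%:R) / W n) / ((W n + i%:R) / W n))
  (fun=> m / 1)) => i.
apply: cvgM; first exact: cvg_chain.
apply: cvgV; first by rewrite oner_neq0.
rewrite (_ : (fun n => _) = fun n => 1 + i%:R / W n); last first.
  by apply/funext => n; rewrite mulrDl divff // gt_eqF.
rewrite -[X in _ --> X]addr0; apply: cvgD; first exact: cvg_cst.
by rewrite -[X in _ --> X](mulr0 i%:R); apply: cvgMr; exact: cvg_inv_total.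
Qed.

(** A positive limit makes [a n j] eventually positive, whereas it vanishes from the last record on.
    Hence the ratio of index [j] is eventually unfrozen. *)
Lemma path_length j (m : R) : v j n @[n --> \oo] --> m -> 0 < m ->
  \forall n \near \oo, (j < l n)%N.
Proof.
move=> vm m0.
have h := @cvg_chain j m 0 vm; have h0 : x / W n @[n --> \oo] --> 0.
  by rewrite -[X in _ --> X](mulr0 x); apply: cvgMr; exact: cvg_inv_total.
have h1 : (x + (a n j)%:R + 0) / W n - x / W n @[n --> \oo] --> m - 0 by exact: cvgB.
rewrite subr0 in h1; have : \forall n \near \oo, 0 < (x + (a n j)%:R + 0) / W n - x / W n.
  exact: cvgr_gt h1 _ m0.
apply: filterS => n; rewrite -mulrBl addr0 [x + _]addrC addrK pmulr_lgt0 ?invr_gt0 //.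
rewrite ltr0n => an; rewrite ltnNge; apply/negP => lj.
by have [a0 _] := ca n; rewrite a0 in an.
Qed.

Lemma path_ratio e j (m m' : R) : v j n @[n --> \oo] --> m -> v j.+1 n @[n --> \oo] --> m' ->
  0 < m -> ratio x (l n) (a n) e j @[n --> \oo] --> (m' / m) ^+ e.
Proof.
move=> vm vm' m0.
pose f (i : nat) n := ((x + (a n j.+1)%:R + i%:R) / W n) / ((x + (a n j)%:R + i%:R) / W n).
have fm i : f i n @[n --> \oo] --> m' / m.
  apply: cvgM; first exact: cvg_chain.
  by apply: cvgV; [rewrite gt_eqF|exact: cvg_chain].
have h : \prod_(i < e) f i n @[n --> \oo] --> (m' / m) ^+ e.
  rewrite -[in X in _ --> X](card_ord e) -prodr_const.
  exact: (@cvg_prod_nat f (fun=> m' / m)).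
apply: cvg_trans h; apply: near_eq_cvg.
have := path_length vm m0; apply: filterS => n jl.
rewrite /ratio jl /rising -prodf_div; apply: eq_bigr => i _; rewrite /f.
have p1 : 0 < x + (a n j)%:R + i%:R by rewrite !ltr_wpDr.
by field; rewrite !gt_eqF.
Qed.

Lemma path_record j (m : R) : v j n @[n --> \oo] --> m ->
  (a n j).+1%:R / n.+1%:R @[n --> \oo] --> m.
Proof.
move=> vm.
(* The shift 1 - x turns [x + a n j] into [(a n j).+1]. *)
have h := @cvg_chain j m (1 - x) vm.
have hW : n.+1%:R / W n @[n --> \oo] --> (1 : R).
  rewrite (_ : (fun n => _) = fun n => 1 + (1 - c) / W n); last first.
    apply/funext => n; rewrite -natr1; field; rewrite gt_eqF //.
  rewrite -[X in _ --> X]addr0; apply: cvgD; first exact: cvg_cst.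
  by rewrite -[X in _ --> X](mulr0 (1 - c)); apply: cvgMr; exact: cvg_inv_total.
rewrite -[X in _ --> X]divr1.
rewrite (_ : (fun n => _) = fun n => ((x + (a n j)%:R + (1 - x)) / W n) / (n.+1%:R / W n)).
  by apply: cvgM => //; apply: cvgV; rewrite ?oner_neq0.
apply/funext => n; rewrite -[(a n j).+1%:R]natr1.
by field; rewrite !gt_eqF.
Qed.

End Paths.

(** * Almost sure limits as random variables *)

Lemma random_variable_of d (T : measurableType d) (R : realType) (P : probability T R)
  (f : T -> R) : measurable_fun setT f ->
  exists X : {RV P >-> R}, forall w, X w = f w.
Proof.
move=> mf; pose H := isMeasurableFun.Build _ _ _ _ f mf.
by exists (HB.pack_for {RV P >-> R} f H).
Qed.

(** The upper limit is measurable and equals the limit where that exists; clipping it to [0, 1]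
    gives the bounds at every point, as the moment arguments assume. *)
Lemma random_variable_limit d (T : measurableType d) (R : realType) (P : probability T R)
    (f : nat -> T -> R) :
  (forall n, measurable_fun setT (f n)) -> (forall n w, 0 <= f n w <= 1) ->
  exists X : {RV P >-> R}, (forall w, 0 <= X w <= 1) /\
    forall w (m : R), f n w @[n --> \oo] --> m -> X w = m.
Proof.
move=> mf f01.
have mg : measurable_fun setT (fun w => limn_sup (f ^~ w)).
  apply: measurable_fun_limn_sup => // w _.
    by exists 1 => _ [n _ <-]; case/andP: (f01 n w).
  by exists 0 => _ [n _ <-]; case/andP: (f01 n w).
pose g w := Num.max 0 (Num.min 1 (limn_sup (f ^~ w))).
have mg' : measurable_fun setT g.
  apply: measurable_maxr; first exact: measurable_cst.
  by apply: measurable_minr => //; exact: measurable_cst.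
have [X XE] := random_variable_of P mg'; exists X; split => [w|w m fm].
  by rewrite XE /g le_max lexx /= ge_max ler01 ge_min lexx.
have m0 : 0 <= m.
  by apply: (cvgr_to_ge fm); apply: nearW => n; case/andP: (f01 n w).
have m1 : m <= 1.
  by apply: (cvgr_to_le fm); apply: nearW => n; case/andP: (f01 n w).
rewrite XE /g cvg_limn_supE; last by apply/cvg_ex; exists m.
by rewrite (cvg_lim _ fm) // min_r // max_r.
Qed.

(** A law with a density has no atoms. The strict positivity obtained here allows division by
    limits. *)
Lemma beta_law_neq d (T : measurableType d) (R : realType) (P : probability T R)
    (X : {RV P >-> R}) a b : (forall w, 0 <= X w <= 1) -> has_beta_law P X a b ->
  {ae P, forall w, 0 < X w < 1}.
Proof.
move=> X01 bX.
have h r : P (X @^-1` [set r]) = 0%E.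
  have := bX [set r] (measurable_set1 r).
  by rewrite /distribution /pushforward => ->; rewrite (integral_Sset1 r) // => x [].
have mpre r : measurable (X @^-1` [set r]).
  by rewrite -[X in measurable X]setTI; exact: measurable_funP.
have ne r : {ae P, forall w, X w != r}.
  by exists (X @^-1` [set r]); split => // w /= /negP; rewrite negbK => /eqP.
apply: filterS2 (ne 0) (ne 1) => w X0 X1.
by have /andP[h0 h1] := X01 w; rewrite !lt_neqAle h0 h1 eq_sym X0 X1.
Qed.

Section Process.
Context {d : measure_display} {T : measurableType d} {R : realType}.
Variables (P : probability T R) (theta zeta : R) (pi : forall n : nat, T -> 'S_n).
Hypotheses (theta0 : 0 < theta) (zeta0 : 0 < zeta).
Hypothesis hpi : has_record_law P theta zeta pi.

(** The martingales lie in [0, 1], so their constant expectation passes to the limit. The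
    one-element permutation has no proper record, so all its ratios are frozen and the initial value
    is a product of moments. *)
Lemma mart_limit_expectation p q K e f (g : T -> R) : measurable_fun setT g ->
  {ae P, forall w, mart theta zeta p q K e f (pi n.+1 w) @[n --> \oo] --> g w} ->
  (\int[P]_w (g w)%:E = (rising theta p * rising zeta q / rising (theta + zeta) (p + q) *
     (\prod_(0 <= j < K) (theta / (theta + (e j)%:R))) *
     (\prod_(0 <= j < K) (zeta / (zeta + (f j)%:R))))%:E)%E.
Proof.
move=> mg cvg_g.
have M1 : mart theta zeta p q K e f (1%g : 'S_1) =
    rising theta p * rising zeta q / rising (theta + zeta) (p + q) *
     (\prod_(0 <= j < K) (theta / (theta + (e j)%:R))) *
     (\prod_(0 <= j < K) (zeta / (zeta + (f j)%:R))).
  rewrite /mart !proper1 low1 upp1 !addr0; congr (_ * _ * _).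
have := @dominated_convergence _ _ _ P setT measurableT
  (fun n w => (mart theta zeta p q K e f (pi n.+1 w))%:E) (fun w => (g w)%:E) (cst 1%E).
case.
- by move=> n; apply/measurable_EFinP; exact: (measurable_pi hpi (fun s => mart theta zeta p q K e f s)).
- exact/measurable_EFinP.
- by apply: filterS cvg_g => w fw _; apply: cvg_EFin => //; exact: nearW.
- exact: finite_measure_integrable_cst.
- by apply: aeW => w n _; rewrite lee_fin ger0_norm ?mart_ge0 // mart_le1.
move=> _ _ h; rewrite -M1 -(cvg_lim _ h) //; apply: cvg_lim => //.
apply: cvg_near_cst; apply: nearW => n.

exact: (martingale_expectation hpi n (mart_martingale theta0 zeta0 p q K e f)).
Qed.
End Process.

Section RandomPaths.
Context {d : measure_display} {T : measurableType d} {R : realType}.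
Variables (P : probability T R) (x c : R) (l : T -> nat -> nat) (a : T -> nat -> nat -> nat).
Variables (U : T -> R) (Z : nat -> T -> R).
Hypotheses (x0 : 0 < x) (c0 : 0 < c) (ca : forall w n, chain (l w n) (a w n)).
Local Notation v j w n := (chain_val x (l w n) (a w n) j / (c + n%:R)).
Local Notation r e j w n := (ratio x (l w n) (a w n) e j).
Hypothesis cvg_v : forall j, {ae P, forall w, cvgn (fun n => v j w n)}.
Hypothesis U_lim : forall w (m : R), v 0 w n @[n --> \oo] --> m -> U w = m.
Hypothesis U_gt0 : {ae P, forall w, 0 < U w}.
Hypothesis Z_lim : forall j w (m : R), r 1 j w n @[n --> \oo] --> m -> Z j w = m.
Hypothesis Z_gt0 : forall j,
  (forall e, {ae P, forall w, r e j w n @[n --> \oo] --> Z j w ^+ e}) ->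
  {ae P, forall w, 0 < Z j w}.

(** Induction on [j]: a positive limit of the j-th value gives the limits of the j-th ratio for all
    exponents; through [Z_gt0] these make Z_j positive, and with it the next limit. Leaving [U]
    abstract allows rho_0 on one side and 1 - rho_0 on the other. *)
Lemma ae_path_limits j : {ae P, forall w,
  [/\ v j w n @[n --> \oo] --> U w * \prod_(i < j) Z i w,
      0 < U w * \prod_(i < j) Z i w
    & forall e, r e j w n @[n --> \oo] --> Z j w ^+ e]}.
Proof.
have step k : {ae P, forall w, v k w n @[n --> \oo] --> U w * \prod_(i < k) Z i w /\
      0 < U w * \prod_(i < k) Z i w} ->
    {ae P, forall w, [/\ v k w n @[n --> \oo] --> U w * \prod_(i < k) Z i w,
      0 < U w * \prod_(i < k) Z i w, forall e, r e k w n @[n --> \oo] --> Z k w ^+ e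
      & v k.+1 w n @[n --> \oo] --> U w * \prod_(i < k.+1) Z i w]}.
  move=> vk; apply: filterS2 vk (cvg_v k.+1) => w [vk m0] /cvg_ex[m' vk'].
  have Zk : Z k w = m' / (U w * \prod_(i < k) Z i w).
    by apply: Z_lim; rewrite -[X in _ --> X]expr1; exact: path_ratio vk vk' m0.
  split => //; first by move=> e; rewrite Zk; exact: path_ratio vk vk' m0.
  by rewrite big_ord_recr mulrA /= Zk mulrC divfK // gt_eqF.
have base k : {ae P, forall w, v k w n @[n --> \oo] --> U w * \prod_(i < k) Z i w /\
      0 < U w * \prod_(i < k) Z i w}.
  elim: k => [|k /step vk].
    apply: filterS2 (cvg_v 0) U_gt0 => w /cvg_ex[m vm] U0.
    by rewrite big_ord0 mulr1 (U_lim vm); split => //; rewrite -(U_lim vm).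
  have Zk : {ae P, forall w, 0 < Z k w}.
    by apply: Z_gt0 => e; apply: filterS vk => w [].
  apply: filterS2 vk Zk => w [_ m0 _ vk] Z0; split => //.
  by rewrite big_ord_recr mulrA mulr_gt0.
by apply: filterS (step j (base j)) => w [].
Qed.

End RandomPaths.

(** * The limits of the factors *)

Section Limits.
Context {d : measure_display} {T : measurableType d} {R : realType}.
Variables (P : probability T R) (theta zeta : R) (pi : forall n : nat, T -> 'S_n).
Hypotheses (theta0 : 0 < theta) (zeta0 : 0 < zeta).
Hypothesis hpi : has_record_law P theta zeta pi.
Local Notation W n := (theta + zeta + n%:R).
Local Notation lowR w n := (proper_lower (pi n.+1 w)).
Local Notation uppR w n := (proper_upper (pi n.+1 w)).

Let c0 : 0 < theta + zeta. Proof. exact: addr_gt0. Qed.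

(* The pre-limits of T_k for k < 0, of rho_0 for k = 0 and of Z_k for k > 0. *)
Definition factor (k : int) n (s : 'S_n.+1) : R :=
  match k with
  | Posz 0 => martL theta zeta 0 s
  | Posz j.+1 => ratio zeta (proper_upper s) (upp s) 1 j
  | Negz j => ratio theta (proper_lower s) (low s) 1 j
  end.

Lemma factor_bounded k n (s : 'S_n.+1) : 0 <= factor k s <= 1.
Proof.
case: k => [[|j]|j] /=; first by rewrite mart_ge0 // mart_le1.
  by rewrite ratio_ge0 // ratio_le1 //; exact: upp_chain.
by rewrite ratio_ge0 // ratio_le1 //; exact: low_chain.
Qed.

Lemma factor_limits : exists Y : int -> {RV P >-> R},
  (forall k w, 0 <= Y k w <= 1) /\
  (forall k w (m : R), factor k (pi n.+1 w) @[n --> \oo] --> m -> Y k w = m).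
Proof.
have h k : exists X : {RV P >-> R}, (forall w, 0 <= X w <= 1) /\
    forall w (m : R), factor k (pi n.+1 w) @[n --> \oo] --> m -> X w = m.
  apply: (random_variable_limit P (f := fun n w => factor k (pi n.+1 w))) => [n|n w].
    exact: (measurable_pi hpi (fun s => factor k s)).
  exact: factor_bounded.
have [Y YE] := choice h.
by exists Y; split => k; case: (YE k).
Qed.

Variable Y : int -> {RV P >-> R}.
Hypothesis Y01 : forall k w, 0 <= Y k w <= 1.
Hypothesis Y_lim : forall k w (m : R), factor k (pi n.+1 w) @[n --> \oo] --> m -> Y k w = m.

Let mY k n : measurable_fun setT (fun w => Y k w ^+ n).
Proof. by apply: measurable_funX. Qed.

Let martL_fun j w : (fun n => chain_val theta (lowR w n) (low (pi n.+1 w)) j / W n) =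
  (fun n => martL theta zeta j (pi n.+1 w)).
Proof. by apply/funext => n; rewrite martLE. Qed.

Let martU_fun j w : (fun n => chain_val zeta (uppR w n) (upp (pi n.+1 w)) j / W n) =
  (fun n => martU theta zeta j (pi n.+1 w)).
Proof. by apply/funext => n; rewrite martUE. Qed.

Lemma martL0_cvg : {ae P, forall w, martL theta zeta 0 (pi n.+1 w) @[n --> \oo] --> Y 0 w}.
Proof.
apply: filterS (martL_cvg theta0 zeta0 hpi 0) => w /cvg_ex[m vm].
by rewrite (Y_lim (k := 0) vm).
Qed.

Lemma center_cvg p : {ae P, forall w, rising (theta + (low (pi n.+1 w) 0)%:R) p / rising (W n) p
  @[n --> \oo] --> Y 0 w ^+ p}.
Proof.
apply: filterS martL0_cvg => w vm.
apply: (path_center theta0 c0 (l := fun n => lowR w n) (a := fun n => low (pi n.+1 w))).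
  by move=> n; exact: low_chain.
by rewrite martL_fun.
Qed.

Lemma center_beta : has_beta_law P (Y 0) theta zeta.
Proof.
apply: beta_law_of_moments => // p.
rewrite (mart_limit_expectation theta0 zeta0 hpi (p := p) (q := 0) (K := 0)
  (e := fun=> 0%N) (f := fun=> 0%N)) //.
  by rewrite !big_geq // rising0 !mulr1 addn0.
apply: filterS (center_cvg p) => w h.
apply: cvg_trans h; apply: near_eq_cvg; apply: nearW => n.
by rewrite /mart !big_geq // rising0 !mulr1 addn0.
Qed.

(** By [risingD1], x / (x + e) is rising x e / rising (x + 1) e, the e-th moment of beta(x, 1). *)
Lemma side_beta (x : R) (X : {RV P >-> R}) : 0 < x -> (forall w, 0 <= X w <= 1) ->
  (forall e, \int[P]_w (X w ^+ e)%:E = (x / (x + e%:R))%:E)%E ->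
  has_beta_law P X x 1.
Proof.
move=> x0 X01 mom; apply: beta_law_of_moments => // e; rewrite mom.
have := risingD1 x e => h; congr EFin.
have p1 : 0 < rising (x + 1) e by rewrite rising_gt0 // addr_gt0.
have p2 : 0 < x + e%:R by rewrite ltr_wpDr.
by apply/eqP; rewrite eqr_div ?lt0r_neq0 // h.
Qed.

Let single (j e i : nat) : nat := if i == j then e else 0%N.

Let prod_single (F : nat -> nat -> R) j e : (forall i, F 0%N i = 1) ->
  \prod_(0 <= i < j.+1) F (single j e i) i = F e j.
Proof.
move=> F0; rewrite big_nat_recr //= big1_seq ?mul1r /single ?eqxx // => i.
by rewrite mem_index_iota => /andP[_ /andP[_ ij]]; rewrite ltn_eqF.
Qed.

(** Convergence is an assumption here because the resulting law is used inside the induction that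
    proves convergence for the next index. *)
Lemma low_moment j :
  (forall e, {ae P, forall w, ratio theta (lowR w n) (low (pi n.+1 w)) e j
    @[n --> \oo] --> Y (Negz j) w ^+ e}) ->
  has_beta_law P (Y (Negz j)) theta 1.
Proof.
move=> h; apply: side_beta => // e.
rewrite (mart_limit_expectation theta0 zeta0 hpi (p := 0) (q := 0) (K := j.+1)
  (e := single j e) (f := fun=> 0%N)) //.
  rewrite (prod_single (F := fun e _ => theta / (theta + e%:R))) => [|i]; last first.
    by rewrite addr0 divff // gt_eqF.
  rewrite [X in _ * X]big1 => [|i _]; last by rewrite addr0 divff // gt_eqF.
  by rewrite !rising0 !mulr1 divr1 mul1r.
apply: filterS (h e) => w {}h.
apply: cvg_trans h; apply: near_eq_cvg; apply: nearW => n; rewrite /mart.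
rewrite (prod_single (F := fun e i => ratio theta (lowR w n) (low (pi n.+1 w)) e i)) => [|i]; last first.
  exact: ratio0.
rewrite [X in _ * X]big1 => [|i _]; last exact: ratio0.
by rewrite !rising0 !mulr1 divr1 mul1r.
Qed.

Lemma upp_moment j :
  (forall e, {ae P, forall w, ratio zeta (uppR w n) (upp (pi n.+1 w)) e j
    @[n --> \oo] --> Y (Posz j.+1) w ^+ e}) ->
  has_beta_law P (Y (Posz j.+1)) zeta 1.
Proof.
move=> h; apply: side_beta => // e.
rewrite (mart_limit_expectation theta0 zeta0 hpi (p := 0) (q := 0) (K := j.+1)
  (e := fun=> 0%N) (f := single j e)) //.
  rewrite (prod_single (F := fun e _ => zeta / (zeta + e%:R))) => [|i]; last first.
    by rewrite addr0 divff // gt_eqF.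
  rewrite [X in _ * X * _]big1 => [|i _]; last by rewrite addr0 divff // gt_eqF.
  by rewrite !rising0 !mulr1 divr1 mul1r.
apply: filterS (h e) => w {}h.
apply: cvg_trans h; apply: near_eq_cvg; apply: nearW => n; rewrite /mart.
rewrite (prod_single (F := fun e i => ratio zeta (uppR w n) (upp (pi n.+1 w)) e i)) => [|i]; last first.
  exact: ratio0.
rewrite [X in _ * X * _]big1 => [|i _]; last exact: ratio0.
by rewrite !rising0 !mulr1 divr1 mul1r.
Qed.

Lemma low_limits j : {ae P, forall w,
  [/\ chain_val theta (lowR w n) (low (pi n.+1 w)) j / W n @[n --> \oo] -->
        Y 0 w * \prod_(i < j) Y (Negz i) w,
      0 < Y 0 w * \prod_(i < j) Y (Negz i) w
    & forall e, ratio theta (lowR w n) (low (pi n.+1 w)) e j @[n --> \oo] --> Y (Negz j) w ^+ e]}.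
Proof.
apply: (ae_path_limits (Z := fun j => Y (Negz j)) theta0 c0).
- by move=> w n; exact: low_chain.
- move=> k; apply: filterS (martL_cvg theta0 zeta0 hpi k) => w; by rewrite martL_fun.
- by move=> w m; rewrite martL_fun; exact: (Y_lim (k := 0)).
- by apply: filterS (beta_law_neq (Y01 0) center_beta) => w /andP[].
- by move=> k w m; exact: (Y_lim (k := Negz k)).
- move=> k h; apply: filterS (beta_law_neq (Y01 (Negz k)) (low_moment h)).
  by move=> w /andP[].
Qed.

Lemma martU0 n (s : 'S_n.+1) : martU theta zeta 0 s = 1 - martL theta zeta 0 s.
Proof.
have W0 := total_gt0 theta0 zeta0 n.
rewrite (martUE zeta theta0 0 s) (martLE theta zeta0 0 s) /chain_val !big_geq // !mulr1.
move: W0; rewrite (total_low_upp theta zeta s) => W0.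
by field; rewrite lt0r_neq0.
Qed.

Lemma upp_limits j : {ae P, forall w,
  [/\ chain_val zeta (uppR w n) (upp (pi n.+1 w)) j / W n @[n --> \oo] -->
        (1 - Y 0 w) * \prod_(i < j) Y (Posz i.+1) w,
      0 < (1 - Y 0 w) * \prod_(i < j) Y (Posz i.+1) w
    & forall e, ratio zeta (uppR w n) (upp (pi n.+1 w)) e j
        @[n --> \oo] --> Y (Posz j.+1) w ^+ e]}.
Proof.
apply: (ae_path_limits (Z := fun j => Y (Posz j.+1)) (U := fun w => 1 - Y 0 w) zeta0 c0).
- by move=> w n; exact: upp_chain.
- move=> k; apply: filterS (martU_cvg theta0 zeta0 hpi k) => w; by rewrite martU_fun.
- move=> w m; rewrite martU_fun (_ : (fun n => _) = fun n => 1 - martL theta zeta 0 (pi n.+1 w)).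
    move=> h; have : 1 - (1 - martL theta zeta 0 (pi n.+1 w)) @[n --> \oo] --> 1 - m.
      by apply: cvgB => //; exact: cvg_cst.
    rewrite (_ : (fun n => _) = fun n => martL theta zeta 0 (pi n.+1 w)); last first.
      by apply/funext => n; rewrite opprB addrC subrK.
    by move=> /(Y_lim (k := 0)) ->; rewrite opprB addrC subrK.
  by apply/funext => n; rewrite martU0.
- by apply: filterS (beta_law_neq (Y01 0) center_beta) => w /andP[]; rewrite subr_gt0.
- by move=> k w m; exact: (Y_lim (k := Posz k.+1)).
- move=> k h; apply: filterS (beta_law_neq (Y01 (Posz k.+1)) (upp_moment h)).
  by move=> w /andP[].
Qed.

Lemma low_beta j : has_beta_law P (Y (Negz j)) theta 1.
Proof. by apply: low_moment => e; apply: filterS (low_limits j) => w []. Qed.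

Lemma upp_beta j : has_beta_law P (Y (Posz j.+1)) zeta 1.
Proof. by apply: upp_moment => e; apply: filterS (upp_limits j) => w []. Qed.


Definition moment (k : int) (e : nat) : R :=
  match k with
  | Posz 0 => rising theta e / rising (theta + zeta) e
  | Posz j.+1 => zeta / (zeta + e%:R)
  | Negz j => theta / (theta + e%:R)
  end.

Let moment0 k : moment k 0 = 1.
Proof.
case: k => [[|j]|j] /=; first by rewrite !rising0 divr1.
  by rewrite addr0 divff // gt_eqF.
by rewrite addr0 divff // gt_eqF.
Qed.

(** The indices from -K to K, grouped as in [mart], which takes K ratios on each side. *)
Definition window K : seq int :=
  0%:Z :: [seq Negz j | j <- index_iota 0 K] ++ [seq Posz j.+1 | j <- index_iota 0 K].

Let big_window K (F : int -> R) : \prod_(k <- window K) F k =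
  F 0 * (\prod_(0 <= j < K) F (Negz j)) * (\prod_(0 <= j < K) F (Posz j.+1)).
Proof. by rewrite /window big_cons big_cat !big_map mulrA. Qed.

Lemma window_uniq K : uniq (window K).
Proof.
rewrite /window cons_uniq cat_uniq !map_inj_uniq ?iota_uniq /=; first last.
- by move=> i j [].
- by move=> i j [].
rewrite andbT mem_cat negb_or -andbA; apply/and3P; split.
- by apply/mapP => -[].
- by apply/mapP => -[].
- by apply/hasPn => k /mapP[j _ ->]; apply/mapP => -[].
Qed.

Lemma mem_window K (k : int) : (`|k| <= K)%N -> k \in window K.
Proof.
case: k => [[|j]|j] jK; rewrite ?mem_head // inE mem_cat.
  suff -> : Posz j.+1 \in [seq Posz j.+1 | j <- index_iota 0 K] by rewrite !orbT.
  by apply/mapP; exists j => //; rewrite mem_index_iota.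
suff -> : Negz j \in [seq Negz j | j <- index_iota 0 K] by rewrite orbT.
by apply/mapP; exists j => //; rewrite mem_index_iota.
Qed.

Lemma window_mem (J : seq int) : exists K, {subset J <= window K}.
Proof.
exists (\max_(k <- J) `|k|%N) => k kJ; apply: mem_window.
by rewrite (big_rem k) //= leq_maxl.
Qed.

Lemma window_moment K (e : int -> nat) :
  (\int[P]_w (\prod_(k <- window K) Y k w ^+ e k)%:E =
   (\prod_(k <- window K) moment k (e k))%:E)%E.
Proof.
rewrite (mart_limit_expectation theta0 zeta0 hpi (p := e 0) (q := 0) (K := K)
  (e := fun j => e (Negz j)) (f := fun j => e (Posz j.+1))).
- by rewrite big_window rising0 mulr1 addn0.
- by apply: measurable_prod => k _; exact: mY.
have lowK : {ae P, forall w, forall j, ratio theta (lowR w n) (low (pi n.+1 w)) (e (Negz j)) j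
    @[n --> \oo] --> Y (Negz j) w ^+ e (Negz j)}.
  by apply: ae_foralln => j; apply: filterS (low_limits j) => w [].
have uppK : {ae P, forall w, forall j, ratio zeta (uppR w n) (upp (pi n.+1 w)) (e (Posz j.+1)) j
    @[n --> \oo] --> Y (Posz j.+1) w ^+ e (Posz j.+1)}.
  by apply: ae_foralln => j; apply: filterS (upp_limits j) => w [].
apply: filterS3 (center_cvg (e 0)) lowK uppK => w h0 hl hu.
rewrite big_window !big_mkord.
rewrite (_ : (fun n => _) = fun n => rising (theta + (low (pi n.+1 w) 0)%:R) (e 0) / rising (W n) (e 0) *
  (\prod_(j < K) ratio theta (lowR w n) (low (pi n.+1 w)) (e (Negz j)) j) *
  (\prod_(j < K) ratio zeta (uppR w n) (upp (pi n.+1 w)) (e (Posz j.+1)) j)); last first.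
  by apply/funext => n; rewrite /mart rising0 mulr1 addn0 !big_mkord.
apply: cvgM; last exact: (cvg_prod_nat
    (f := fun j n => ratio zeta (uppR w n) (upp (pi n.+1 w)) (e (Posz j.+1)) j)
    (y := fun j => Y (Posz j.+1) w ^+ e (Posz j.+1))).
apply: cvgM => //; exact: (cvg_prod_nat
  (f := fun j n => ratio theta (lowR w n) (low (pi n.+1 w)) (e (Negz j)) j)
  (y := fun j => Y (Negz j) w ^+ e (Negz j))).
Qed.

(** Any finite index set is enlarged to a window by exponents 0, for which both powers and moments
    are 1. *)
Lemma joint_moment (J : seq int) (e : int -> nat) : uniq J ->
  (\int[P]_w (\prod_(k <- J) Y k w ^+ e k)%:E = (\prod_(k <- J) moment k (e k))%:E)%E.
Proof.
move=> uJ; have [K JK] := window_mem J.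
have perm : perm_eq J [seq k <- window K | k \in J].
  apply: uniq_perm => // [|k]; first by rewrite filter_uniq // window_uniq.
  by rewrite mem_filter; case: (boolP (k \in J)) => // /JK ->.
pose e' k := if k \in J then e k else 0%N.
have bigE (F : int -> nat -> R) : (forall k, F k 0%N = 1) ->
    \prod_(k <- J) F k (e k) = \prod_(k <- window K) F k (e' k).
  move=> F0; rewrite (perm_big _ perm) big_filter big_mkcond.
  by apply: eq_bigr => k _; rewrite /e'; case: ifP.
rewrite (bigE moment moment0) -window_moment; apply: eq_integral => w _.
by rewrite (bigE (fun k n => Y k w ^+ n)).
Qed.

Lemma factors_independent : mutually_independent P Y.
Proof.
apply: (indep_of_moments Y01 (m := moment)) => [k n|]; last exact: joint_moment.
have := @joint_moment [:: k] (fun=> n) isT; rewrite big_seq1 => <-.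
by apply: eq_integral => w _; rewrite big_seq1.
Qed.

(** [Negz j] is -(j + 1), whence j + 1 factors; k = 0 belongs to the upper branch, with the empty
    product. *)
Definition record_limit (k : int) (w : T) : R :=
  match k with
  | Posz j => 1 - (1 - Y 0 w) * \prod_(i < j) Y (Posz i.+1) w
  | Negz j => Y 0 w * \prod_(i < j.+1) Y (Negz i) w
  end.

Lemma record_cvg k : {ae P, forall w,
  (record_value (pi n w) k)%:R / n%:R @[n --> \oo] --> record_limit k w}.
Proof.
case: k => j.
  apply: filterS (upp_limits j) => w [vj _ _]; rewrite -cvg_shiftS /=.
  have h := path_record zeta0 c0 (fun n => upp_chain (pi n.+1 w)) vj.
  (* The record value is n + 1 - [upp]; the harmonic term compensates for the successor in
     [path_record]. *)
  rewrite (_ : (fun n => _) = fun n => 1 + n.+1%:R^-1 - (upp (pi n.+1 w) j).+1%:R / n.+1%:R).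
    apply: cvgB h; rewrite -[X in _ --> X]addr0.
    by apply: cvgD; [exact: cvg_cst|exact: cvg_harmonic].
  apply/funext => n; rewrite record_value_upp natrB; last first.
    have := chain_le (upp_chain (pi n.+1 w)) (leq0n j); have := low_upp (pi n.+1 w); lia.
  by rewrite -[(upp _ _).+1%:R]natr1 mulrBl mulrDl divff // mul1r; ring.
apply: filterS (low_limits j.+1) => w [vj _ _]; rewrite -cvg_shiftS /=.
have := path_record theta0 c0 (fun n => low_chain (pi n.+1 w)) vj.
rewrite (_ : (fun n => (record_value _ _)%:R / _) =
  fun n => (low (pi n.+1 w) j.+1).+1%:R / n.+1%:R :> R) //.
by apply/funext => n; rewrite NegzE record_value_low.
Qed.

End Limits.

(** * Conditional independence of the two sides given rho_0 *)

Section SubSigmaAlgebra.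
Context {d : measure_display} {T : measurableType d} {R : realType}.
Variable (P : probability T R).

(** Viewing T with the sigma-algebra generated by G lets the usual closure properties of measurable
    functions prove membership in it. *)
Lemma preimage_measurable_fun G (f : T -> R) :
  (forall B : set R, measurable B -> <<s G >> (f @^-1` B)) ->
  measurable_fun [set: g_sigma_algebraType G] (f : g_sigma_algebraType G -> R).
Proof. by move=> h _ B mB; rewrite setTI; exact: h. Qed.

Lemma sigma_of_sub (I : Type) (K : set I) (X : I -> {RV P >-> R}) G :
  (forall k, K k ->
    measurable_fun [set: g_sigma_algebraType G] (X k : g_sigma_algebraType G -> R)) ->
  sigma_of K X `<=` <<s G >>.
Proof.
move=> mX; apply: smallest_sub; first exact: smallest_sigma_algebra.
by move=> _ [k Kk [B mB <-]]; exact: (mX k Kk measurableT B mB).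
Qed.

End SubSigmaAlgebra.

Section Sides.
Context {d : measure_display} {T : measurableType d} {R : realType}.
Variables (P : probability T R) (Y : int -> {RV P >-> R}).
Hypothesis ind : mutually_independent P Y.

(** The factor Y_0 is placed with the lower side: events of the lower factors and Y_0 together are
    independent of cylinders in the upper factors. The upper records are measurable for the
    sigma-algebra of Y_0 and the upper factors, which is the one generated in
    [cond_independent_of_pi_system]. *)
Lemma cond_independent_sides (rho : int -> {RV P >-> R}) :
  (forall k w, rho k w = record_limit Y k w) ->
  cond_independent P (Y 0) (sigma_of [set k : int | k < 0] rho)
    (sigma_of [set k : int | 0 < k] rho).
Proof.
move=> rhoE.
pose F := <<s cylinder Y [set k : int | k <= 0] >>.
pose G := cylinder Y [set k : int | 0 < k].
have FI A B : F A -> F B -> F (A `&` B).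
  exact: (@measurableI _ (g_sigma_algebraType (cylinder Y [set k : int | k <= 0]))).
have cG K : cylinder Y K `<=` measurable by exact: cylinder_measurable.
have F1 : F setT by apply: sub_sigma_algebra; exact: cylinder_setT.
have cond := @cond_independent_of_pi_system _ _ _ P (Y 0) F G
  (sigma_measurable (cG _)) (cG _) F1 (@cylinder_setI _ _ _ _ _ _ _) (cylinder_setT _ _).
move=> A B FA GB; apply: cond.
- move=> A' C D FA' mC GD; apply: (sigma_indep ind _ (K1 := [set k : int | k <= 0])
    (K2 := [set k : int | 0 < k])).
  + by apply/seteqP; split => // k [/= ] /le_lt_trans h /h; rewrite ltxx.
  + by apply: FI FA' _; apply: sub_sigma_algebra; apply: cylinder_preimage => //=.
  + exact: sub_sigma_algebra.
- apply: sigma_of_sub FA => -[//|j] _.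
  rewrite (_ : (rho _ : T -> R) = fun w => Y 0 w * \prod_(i < j.+1) Y (Negz i) w); last first.
    by apply/funext => w; rewrite rhoE.
  have mY k : k <= 0 -> measurable_fun [set: g_sigma_algebraType (cylinder Y [set k : int | k <= 0])]
      (Y k : g_sigma_algebraType (cylinder Y [set k : int | k <= 0]) -> R).
    move=> k0; apply: preimage_measurable_fun => C mC.
    by apply: sub_sigma_algebra; exact: cylinder_preimage.
  apply: measurable_funM; first exact: mY.
  by apply: measurable_prod => i _; exact: mY.
- set S := [set _ | _]; apply: sigma_of_sub GB => -[[//|j]|//] _.
  rewrite (_ : (rho _ : T -> R) = fun w => 1 - (1 - Y 0 w) * \prod_(i < j.+1) Y (Posz i.+1) w); last first.
    by apply/funext => w; rewrite rhoE.
  have mY0 : measurable_fun [set: g_sigma_algebraType S] (Y 0 : g_sigma_algebraType S -> R).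
    apply: preimage_measurable_fun => C mC; apply: sub_sigma_algebra.
    by exists C, setT; split; [|exact: cylinder_setT|rewrite setIT].
  have mY k : 0 < k -> measurable_fun [set: g_sigma_algebraType S] (Y k : g_sigma_algebraType S -> R).
    move=> k0; apply: preimage_measurable_fun => C mC; apply: sub_sigma_algebra.
    by exists setT, (Y k @^-1` C); split; [|exact: cylinder_preimage|rewrite preimage_setT setTI].
  apply: measurable_funB; first exact: measurable_cst.
  apply: measurable_funM; first by apply: measurable_funB => //; exact: measurable_cst.
  by apply: measurable_prod => i _; exact: mY.
Qed.

(** The equality at 0 is one of random variables, so [Y 0] can replace [rho 0] in all later
    statements. *)
Lemma record_limit_variables : exists rho : int -> {RV P >-> R},
  rho 0 = Y 0 /\ forall k w, rho k w = record_limit Y k w.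
Proof.
have h k : exists X : {RV P >-> R},
    (k = 0 -> X = Y 0) /\ forall w, X w = record_limit Y k w.
  have [->|k0] := eqVneq k 0.
    by exists (Y 0); split => // w; rewrite /= big_ord0 mulr1 opprB addrC subrK.
  have [|X XE] := @random_variable_of _ _ _ P (record_limit Y k).
    case: k {k0} => j /=.
      apply: measurable_funB => //; apply: measurable_funM.
        exact: measurable_funB.
      exact: measurable_prod.
    by apply: measurable_funM => //; exact: measurable_prod.
  by exists X; split => // /eqP; rewrite (negbTE k0).
have [rho rhoE] := choice h; exists rho; split; first exact: (rhoE 0).1.
by move=> k; case: (rhoE k).
Qed.

End Sides.

Theorem proposition7 (R : realType) (d : measure_display)
    (T : measurableType d) (P : probability T R) (theta zeta : R)
    (pi : forall n : nat, T -> 'S_n)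
    (htheta : 0 < theta) (hzeta : 0 < zeta)
    (hpi : has_record_law P theta zeta pi) :
  exists rho : int -> {RV P >-> R},
    [/\ forall k : int,
          {ae P, forall w,
            ((record_value (pi n w) k)%:R / n%:R : R) @[n --> \oo] --> rho k w},
        has_beta_law P (rho 0) theta zeta,
        cond_independent P (rho 0)
          (sigma_of [set k : int | k < 0] rho)
          (sigma_of [set k : int | 0 < k] rho)
      & exists tau Z : int -> {RV P >-> R},
          [/\ forall k : int, k < 0 ->
                {ae P, forall w,
                  rho k w = rho 0 w * \prod_(i < `|k|%N) tau (k + i%:Z) w},
              forall k : int, 0 < k ->
                {ae P, forall w,
                  rho k w = 1 - (1 - rho 0 w) * \prod_(i < `|k|%N) Z (i.+1)%:Z w},
              forall k : int, k < 0 -> has_beta_law P (tau k) theta 1,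
              forall k : int, 0 < k -> has_beta_law P (Z k) zeta 1
            & mutually_independent P (fun k : int =>
                if k < 0 then tau k else if k == 0 then rho 0 else Z k)]].
Proof.
have [Y [Y01 Y_lim]] := factor_limits htheta hzeta hpi.
have ind := factors_independent htheta hzeta hpi Y01 Y_lim.
have [rho [rho0 rhoE]] := record_limit_variables Y.
exists rho; rewrite rho0; split.
- move=> k; apply: filterS (record_cvg htheta hzeta hpi Y01 Y_lim k) => w.
  by rewrite rhoE.
- exact: (center_beta htheta hzeta hpi Y01 Y_lim).
- exact: cond_independent_sides.
(* One family carries all factors: the T_k at negative indices, the Z_k at positive ones. *)
- exists Y, Y; split.
  + move=> [//|j] _; apply: aeW => w; rewrite rhoE /=; congr (_ * _).
    (* The product in the statement runs from k up to -1, that of [record_limit] from -1 down to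
       k. *)
    rewrite (reindex_inj rev_ord_inj) /=; apply: eq_bigr => i _; congr (Y _ w).
    by have := ltn_ord i; lia.
  + by move=> [[//|j]|//] _; apply: aeW => w; rewrite rhoE.
  + by move=> [//|j] _; exact: (low_beta htheta hzeta hpi Y01 Y_lim).
  + by move=> [[//|j]|//] _; exact: (upp_beta htheta hzeta hpi Y01 Y_lim).
  + rewrite (_ : (fun k => _) = Y) //; apply/funext => k.
    by case: ltP => // _; case: eqP => // ->.
Qed.
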